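(* Let $\dot{\mathfrak g}$ be the simple Lie algebra of type $A_{2\ell+1}$ realized as the traceless complex $(2\ell+2)\times(2\ell+2)$-matrices. Put $$\sigma_0(X)=-X^T,\qquad\sigma_1=\mathrm{Ad}\Big(-E_{2\ell+2,2\ell+2}+\sum_{i=1}^{2\ell+1}E_{i,i}\Big).$$ Then the twisted 2-toroidal Lie algebra $\mathfrak g(\sigma_0,\sigma_1)$ is the bi-affine Lie algebra of type $BC_\ell^{(2,2)}(2)$, i.e. its set $R$ of non-isotropic roots is the extended affine root system $$\begin{aligned}R=&\{\alpha+m\delta_0+n\delta_1\mid\alpha\in R(B_\ell)\text{ short},\ m,n\in\mathbb Z\}\cup\{\alpha+m\delta_0+2n\delta_1\mid\alpha\in R(B_\ell)\text{ long},\ m,n\in\mathbb Z\}\\&\cup\{\alpha+(2m+1)\delta_0+2n\delta_1\mid\alpha\in R(C_\ell)\text{ long},\ m,n\in\mathbb Z\}.\end{aligned}$$ The decomposition of $\dot{\mathfrak g}$ with respect to $\sigma_0,\sigma_1$ is as follows: $\dot{\mathfrak g}_{(\overline0,\overline0)}$ is the simple Lie algebra of type $B_\ell$; as modules over it, $\dot{\mathfrak g}_{(\overline1,\overline0)}$ is a $(2\ell^2+3\ell)$-dimensional irreducible representation (with no trivial summands), and each of the other two spaces $\dot{\mathfrak g}_{(\overline0,\overline1)}$ and $\dot{\mathfrak g}_{(\overline1,\overline1)}$ is the $(2\ell+1)$-dimensional irreducible representation (with no trivial summands).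
   Context: $E_{ij}$ are matrix units and $\mathrm{Ad}(A)(X)=AXA^{-1}$. $R(B_\ell)$ is the root system of $\dot{\mathfrak g}_{(\overline0,\overline0)}$ with respect to its Cartan subalgebra $\dot{\mathfrak h}_{\overline0}$, and the long roots of $R(C_\ell)$ are the elements $2\alpha$ with $\alpha\in R(B_\ell)$ short. Work over $\mathbb C$. Let $\dot{\mathfrak g}$ be a simple finite-dimensional Lie algebra with Killing form $(\cdot,\cdot)$, and $\sigma_0,\sigma_1$ commuting automorphisms of finite orders $n_0,n_1$ (order 1 allowed). Put $\epsilon_j=\exp(2\pi i/n_j)$ and, for $p,q\in\mathbb Z$, $\dot{\mathfrak g}_{(\overline p,\overline q)}=\{g\in\dot{\mathfrak g}\mid\sigma_0(g)=\epsilon_0^p g,\ \sigma_1(g)=\epsilon_1^q g\}$, where $\overline p=p \bmod n_0$, $\overline q=q\bmod n_1$. Let $\mathcal R=\mathbb C[t_0^{\pm1},t_1^{\pm1}]$, $\mathcal K=\Omega^1_{\mathcal R}/d\mathcal R$, $k_i=t_i^{-1}dt_i$, and let $\mathcal K(\Sigma)\subset\mathcal K$ be spanned by the elements $t_0^{n_0a}t_1^{n_1b}k_i$ ($a,b\in\mathbb Z$, $i=0,1$). The twisted 2-toroidal Lie algebra is $$\mathfrak g(\sigma_0,\sigma_1)=\bigoplus_{m,n\in\mathbb Z}\dot{\mathfrak g}_{(\overline m,\overline n)}\otimes t_0^mt_1^n\ \oplus\ \mathcal K(\Sigma)\ \oplus\ \mathbb Cd_0\oplus\mathbb Cd_1,$$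 with bracket $[g_1\otimes f_1,g_2\otimes f_2]=[g_1,g_2]\otimes f_1f_2+(g_1,g_2)f_2\,df_1$; $\mathcal K(\Sigma)$ commutes with itself and with all $g\otimes f$; $d_j=t_j\partial/\partial t_j$ acts by $[d_j,g\otimes t_0^{r_0}t_1^{r_1}]=r_j\,g\otimes t_0^{r_0}t_1^{r_1}$, $[d_j,t_0^{r_0}t_1^{r_1}k_i]=r_j\,t_0^{r_0}t_1^{r_1}k_i$; and $[d_0,d_1]=0$. Let $\dot{\mathfrak h}_{\overline 0}$ be a Cartan subalgebra of the reductive algebra $\dot{\mathfrak g}_{(\overline 0,\overline 0)}$ and $\mathfrak h=\dot{\mathfrak h}_{\overline 0}\oplus\mathbb Cd_0\oplus\mathbb Cd_1\oplus\mathbb Ck_0\oplus\mathbb Ck_1$. Elements of $\dot{\mathfrak h}_{\overline 0}^*$ are extended to $\mathfrak h$ by $0$ on all $d_i,k_i$; $\delta_i\in\mathfrak h^*$ is defined by $\delta_i(d_j)=\delta_{ij}$ and zero on $\dot{\mathfrak h}_{\overline 0}$ and all $k_j$. Let $V=\dot{\mathfrak h}_{\overline 0}^*\oplus\mathbb C\delta_0\oplus\mathbb C\delta_1$ with the bilinear form $(\cdot,\cdot)_V$ which on $\dot{\mathfrak h}_{\overline 0}^*$ is dual to the restriction of the Killing form to $\dot{\mathfrak h}_{\overline 0}$ and has $\delta_0,\delta_1$ in its radical. Then $R$ is the set of $\beta\in V$ with $(\beta,\beta)_V\ne0$ whose weight space in $\mathfrak g(\sigma_0,\sigma_1)$ under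 the adjoint action of $\mathfrak h$ is nonzero.
   Formalization: The space g_(1,0) has dimension 2l^2+3l+1 and contains the invariant diag(1,...,1,-(2l+1)); so instead of being irreducible it is stated to be the direct sum of a (2l^2+3l)-dimensional irreducible representation without trivial summands and a one-dimensional trivial one. *)

(* Defs.v *)
From HB Require Import structures.
From mathcomp Require Import all_boot all_order all_algebra.
From mathcomp Require Import complex.
From mathcomp Require Import all_classical all_reals all_analysis.
Set Implicit Arguments.
Unset Strict Implicit.
Unset Printing Implicit Defensive.
Import Order.TTheory GRing.Theory Num.Theory.
Local Open Scope classical_set_scope.
Local Open Scope ring_scope.
Local Open Scope complex_scope.

(* Lie algebras are subspaces of 'M[R[i]]_N, closed under the commutator;    *)
(* R[i], for R : realType, is the field of complex numbers.                   *)

Section LinearLieAlgebras.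
Variables (R : realType) (N : nat).
Notation C := R[i].
Notation M := 'M[C]_N.
Implicit Types (g L h W U T I : {vspace M}) (s : 'End(M)).

Definition lie (x y : M) : M := x *m y - y *m x.

Definition lie_subalgebra g : Prop :=
  forall x y, x \in g -> y \in g -> lie x y \in g.

Definition lie_ideal g I : Prop :=
  (I <= g)%VS /\ forall x y, x \in g -> y \in I -> lie x y \in I.

Definition lie_simple g : Prop :=
  [/\ lie_subalgebra g,
      exists x y, [/\ x \in g, y \in g & lie x y != 0]
    & forall I, lie_ideal g I -> I = 0%VS \/ I = g].

(* The span of the brackets [x, y], x in U, y in W. *)
Definition lie_prod U W : {vspace M} :=
  <<[seq lie x y | x <- vbasis U, y <- vbasis W]>>%VS.

Definition lie_nilpotent h : Prop := exists k, iter k (lie_prod h) h = 0%VS.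

Definition cartan_subalgebra g h : Prop :=
  [/\ (h <= g)%VS, lie_subalgebra h, lie_nilpotent h
    & forall x, x \in g -> (forall y, y \in h -> lie x y \in h) -> x \in h].

(* kappa(x, y) = tr (ad x o ad y) on g, for x, y in g. *)
Definition killing g (x y : M) : C :=
  \sum_(i < \dim g) coord (vbasis g) i (lie x (lie y (vbasis g)`_i)).

Definition lie_automorphism g s : Prop :=
  (s @: g)%VS = g /\
  forall x y, x \in g -> y \in g -> s (lie x y) = lie (s x) (s y).

Definition has_order g s (n : nat) : Prop :=
  [/\ (0 < n)%N, forall x, x \in g -> iter n s x = x
    & forall m, (0 < m < n)%N -> exists2 x, x \in g & iter m s x != x].

(* Modules over a Lie subalgebra L of M, acting on subspaces of M by ad. *)
Definition submodule L W U : Prop :=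
  (U <= W)%VS /\ forall x u, x \in L -> u \in U -> lie x u \in U.

Definition irreducible L W : Prop :=
  [/\ submodule L W W, W != 0%VS
    & forall U, submodule L W U -> U = 0%VS \/ U = W].

Definition acts_trivially L U : Prop :=
  forall x u, x \in L -> u \in U -> lie x u = 0.

Definition direct_sum_of_submodules L W U T : Prop :=
  [/\ submodule L W U, submodule L W T, (U + T)%VS = W & (U :&: T)%VS = 0%VS].

Definition no_trivial_summand L W : Prop :=
  forall U T, direct_sum_of_submodules L W U T -> acts_trivially L U ->
    U = 0%VS.

Definition dual h := 'Hom(subvs_of h, C^o).

Definition roots L h : set (dual h) :=
  [set a : dual h | a != 0 /\ exists x : M, [/\ x \in L, x != 0 &
    forall H : subvs_of h, lie (vsval H) x = (a H : C) *: x]].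
Arguments roots : clear implicits.

(* The element t_a of h with kappa(t_a, .) = a; it exists and is unique when  *)
(* the Killing form of g is nondegenerate on h.                               *)
Definition dual_vect g h (a : dual h) : subvs_of h :=
  xget 0 [set t | forall H : subvs_of h, killing g (vsval t) (vsval H) = a H].

Definition dual_form g h (a b : dual h) : C :=
  killing g (vsval (dual_vect g a)) (vsval (dual_vect g b)).

(* Short roots are those of minimal squared length, long roots all others, so *)
(* that all roots of a system of type B_1 are short.                          *)
Definition short_roots g L h : set (dual h) :=
  [set a : dual h | roots L h a /\
    forall b : dual h, roots L h b -> dual_form g a a <= dual_form g b b].
Arguments short_roots : clear implicits.

Definition long_roots g L h : set (dual h) :=
  [set a : dual h | roots L h a /\ ~ short_roots g L h a].

(* For L of type B_l, the long roots of the system of type C_l attached to it. *)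
Definition long_roots_C g L h : set (dual h) :=
  [set a *+ 2 | a in short_roots g L h].

Definition standard_B_root l (v : 'rV[C]_l) : Prop :=
  (exists i (e : bool), v = (-1) ^+ e *: delta_mx 0 i) \/
  (exists i j (e e' : bool), i != j /\
     v = (-1) ^+ e *: delta_mx 0 i + (-1) ^+ e' *: delta_mx 0 j).

Definition roots_of_type_B l L h : Prop :=
  exists f : 'Hom('rV[C]_l, dual h),
    [/\ lker f = 0%VS, limg f = fullv
      & forall a : dual h, roots L h a <-> exists2 v, standard_B_root v & a = f v].

Definition simple_of_type_B l L : Prop :=
  [/\ lie_simple L, exists h, cartan_subalgebra L h
    & forall h, cartan_subalgebra L h -> roots_of_type_B l L h].

End LinearLieAlgebras.

Arguments roots {R N} L h _.
Arguments short_roots {R N} g L h _.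
Arguments long_roots {R N} g L h _.
Arguments long_roots_C {R N} g L h _.

Section Toroidal.
Variables (R : realType) (N : nat).
Notation C := R[i].
Notation M := 'M[C]_N.
Variables (g : {vspace M}) (s0 s1 : 'End(M)) (n0 n1 : nat).

(* exp (2 pi i / n) *)
Definition unity_root (n : nat) : C :=
  cos (2 * pi / n%:R) +i* sin (2 * pi / n%:R).

Definition graded (p q : int) : {vspace M} :=
  (g :&: passmx.leigenspace s0 (unity_root n0 ^ p)
     :&: passmx.leigenspace s1 (unity_root n1 ^ q))%VS.

(* An element of the toroidal algebra is represented by its components:       *)
(* - loop r is the coefficient of t_0^{r.1} t_1^{r.2};                        *)
(* - form is the 1-form \sum_r t^r ((form r).1 k_0 + (form r).2 k_1), which   *)
(*   represents its class modulo dR;                                          *)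
(* - deg stands for deg.1 d_0 + deg.2 d_1.                                    *)
(* Equality in the toroidal algebra is [tor_eq], not Leibniz equality.        *)
Record tor : Type := Tor {
  loop : int * int -> M;
  form : int * int -> C * C;
  deg : C * C
}.

Definition pairing (e : C * C) (r : int * int) : C :=
  e.1 * r.1%:~R + e.2 * r.2%:~R.

Definition scale2 (c : C) (w : C * C) : C * C := (c * w.1, c * w.2).

Definition toC (r : int * int) : C * C := (r.1%:~R, r.2%:~R).

(* d (\sum_r f r t^r) = \sum_r f r t^r (r.1 k_0 + r.2 k_1) *)
Definition exact (w : int * int -> C * C) : Prop :=
  exists f : int * int -> C, finite_set [set r | f r != 0] /\
    forall r, w r = scale2 (f r) (toC r).

Definition tor_eq (x y : tor) : Prop :=
  [/\ loop x =1 loop y, exact (fun r => form x r - form y r)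
    & deg x = deg y].

Definition tor0 : tor := Tor (fun=> 0) (fun=> 0) 0.

Definition tor_scale (c : C) (x : tor) : tor :=
  Tor (fun r => c *: loop x r) (fun r => scale2 c (form x r))
      (scale2 c (deg x)).

Definition in_toroidal (x : tor) : Prop :=
  [/\ forall r, loop x r \in graded r.1 r.2,
      finite_set [set r | loop x r != 0],
      finite_set [set r | form x r != 0]
    & forall r, form x r != 0 -> (n0%:Z %| r.1)%Z /\ (n1%:Z %| r.2)%Z].

(* The sums over all of Z^2 have finite support for x, y in the algebra; in   *)
(* the second one, (x t^s, y t^{r-s}) contributes kappa(x, y) t^{r-s} d(t^s). *)
Definition tor_bracket (x y : tor) : tor :=
  Tor
    (fun r => \sum_(s \in [set: int * int]) lie (loop x s) (loop y (r - s))
              + pairing (deg x) r *: loop y r - pairing (deg y) r *: loop x r)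
    (fun r => \sum_(s \in [set: int * int])
                scale2 (killing g (loop x s) (loop y (r - s))) (toC s)
              + scale2 (pairing (deg x) r) (form y r)
              - scale2 (pairing (deg y) r) (form x r))
    0.

Variable h : {vspace M}.

(* H + c.1 k_0 + c.2 k_1 + e.1 d_0 + e.2 d_1 *)
Definition tor_cartan (H : subvs_of h) (c e : C * C) : tor :=
  Tor (fun r => if r == 0 then vsval H else 0)
      (fun r => if r == 0 then c else 0) e.

(* (a, (x, y)) stands for a + x delta_0 + y delta_1. *)
Definition wspace : Type := (dual h * (C * C))%type.

Definition wval (b : wspace) (H : subvs_of h) (e : C * C) : C :=
  b.1 H + (b.2.1 * e.1 + b.2.2 * e.2).

Definition wform (b b' : wspace) : C := dual_form g b.1 b'.1.

Definition weight_vector (b : wspace) (x : tor) : Prop :=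
  in_toroidal x /\
  forall H c e, tor_eq (tor_bracket (tor_cartan H c e) x)
                       (tor_scale (wval b H e) x).

Definition nonisotropic_roots : set wspace :=
  [set b | wform b b != 0 /\ exists x, weight_vector b x /\ ~ tor_eq x tor0].

End Toroidal.

Arguments nonisotropic_roots {R N} g s0 s1 n0 n1 h _.

Section TypeA.
Variable R : realType.
Notation C := R[i].

Definition sl N : {vspace 'M[C]_N} :=
  lker (linfun (fun X : 'M[C]_N => \tr X : C^o)).

Definition neg_transpose N : 'End('M[C]_N) := linfun (fun X : 'M[C]_N => - X^T).

Definition Ad N (A : 'M[C]_N) : 'End('M[C]_N) :=
  linfun (fun X : 'M[C]_N => A *m X *m invmx A).

Definition reflection n : 'M[C]_n.+1 :=
  - delta_mx ord_max ord_max + \sum_(i | i != ord_max) delta_mx i i.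

End TypeA.

(* Main.v *)
Require Import Defs.
From HB Require Import structures.
From mathcomp Require Import all_boot all_order all_algebra.
From mathcomp Require Import complex zify ring.
From mathcomp Require Import all_classical all_reals all_analysis.
Set Implicit Arguments.
Unset Strict Implicit.
Unset Printing Implicit Defensive.
Import Order.TTheory GRing.Theory Num.Theory.
Local Open Scope ring_scope.

(** The subalgebra g_(0,0) consists of the skew matrices X with vanishing last row and
    column, i.e. it is so(2l+1). No conjugacy theorem is used to treat an arbitrary
    Cartan subalgebra h. If y is in h and P is the projection onto a generalized
    eigenspace of y for a nonzero eigenvalue, then ad y is nilpotent on h, hence P
    commutes with h; so P - P^T normalizes h and therefore lies in h. Such
    projections are refined until h acts with a single eigenvalue on their images.
    By Engel's theorem the gl of such an image then embeds in h, which forces the image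
    to be a line, and on the common complement h acts nilpotently, so that by Engel's
    theorem again the skew endomorphisms of the complement are in h and nilpotent; the
    complement is therefore at most a line, and exactly a line because 2l+1 is odd.
    Hence h is the diagonal torus of a hyperbolic basis (v_a), its weights on the four
    graded pieces are read off from the matrices v_a v_b^T +- v_b v_a^T, and the Killing
    form, a multiple of the trace form, is diagonal on h.

    For simplicity and irreducibility, a polynomial in the operator ad (E_ij - E_ji) keeps
    exactly those entries of a matrix that have one index in {i, j}; composing such
    operators isolates a single entry of a nonzero element of a submodule, and
    the matrix units generate the rest. *)

(** * Projections onto generalized eigenspaces *)

(** A Cartan subalgebra is given only as nilpotent and self-normalizing. Neither its commutativity
    nor the semisimplicity of its elements is available at the outset, which is why the argument
    runs through generalized eigenspaces.

    The three families in R come from a parity rule. The matrix v_a v_b^T +- v_b v_a^T has weight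
    mu_a + mu_b; the parity of the delta_0-degree fixes the sign, and that of the delta_1-degree
    decides whether exactly one factor is the last coordinate vector. A short weight pairs a
    hyperbolic vector with one of the two vectors of weight zero and occurs in every degree; a long
    one needs two hyperbolic vectors, hence an even delta_1-degree; a doubled one comes only from
    v_a v_a^T, which is symmetric, hence also needs an odd delta_0-degree.

    In bidegree (1,0) the last diagonal entry is determined by the trace, so the dimension is that
    of the symmetric matrices of size 2l+1, namely (2l+1)(l+1) = 2l^2+3l+1. The matrix diag(1, ...,
    1, -(2l+1)) spans a trivial line in this piece, so the irreducible module is only a complement
    of that line. *)

Section Commutator.
Variable A : nzRingType.
Implicit Types x y z a b c : A.

Definition ad a x := a * x - x * a.

Lemma ad0 a : ad a 0 = 0. Proof. by rewrite /ad mulr0 mul0r subr0. Qed.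

Lemma adB a x y : ad a (x - y) = ad a x - ad a y.
Proof. by rewrite /ad mulrBr mulrBl opprB addrACA [- _ + _]addrC opprB -!addrA; congr (_ + _); rewrite addrCA. Qed.

Lemma iter_ad0 a k : iter k (ad a) 0 = 0.
Proof. by elim: k => //= k ->; rewrite ad0. Qed.

Lemma iter_adB a k x y : iter k (ad a) (x - y) = iter k (ad a) x - iter k (ad a) y.
Proof. by elim: k => //= k ->; rewrite adB. Qed.

Lemma comm_ad0 a x : GRing.comm a x -> ad a x = 0.
Proof. by move=> h; rewrite /ad h subrr. Qed.

Lemma adML a b x : GRing.comm a b -> ad a (b * x) = b * ad a x.
Proof. by move=> h; rewrite /ad mulrBr !mulrA h. Qed.

Lemma adMR a b x : GRing.comm a b -> ad a (x * b) = ad a x * b.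
Proof. by move=> h; rewrite /ad mulrBl -!mulrA h. Qed.

(** Double induction: [a * x * b] differs from [x * (a * b)] by [ad a x * b]. The commutator needs
    one application of [ad a] fewer, and [a * b] one power of [a] fewer. *)
Lemma exp_ad_nilL a k m x b :
  iter k (ad a) x = 0 -> a ^+ m * b = 0 -> a ^+ (k + m) * (x * b) = 0.
Proof.
elim: k m x b => [|k IHk] m x b; first by move=> /= ->; rewrite mul0r mulr0.
elim: m b => [|m IHm] b.
  by move=> _; rewrite expr0 mul1r => ->; rewrite !mulr0.
rewrite iterSr => adk amb.
have := IHk m.+1 _ _ adk amb.
rewrite /ad mulrBl mulrBr => /eqP; rewrite subr_eq0 => /eqP.
rewrite -[x * a * b]mulrA -[a * x * b]mulrA [LHS]mulrA -exprSr => eq.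
have -> : (k.+1 + m.+1 = (k + m.+1).+1)%N by [].
by rewrite eq addnS -addSn; apply: IHm; rewrite ?iterSr // mulrA -exprSr.
Qed.

Lemma exp_ad_nilR a k m x b :
  iter k (ad a) x = 0 -> b * a ^+ m = 0 -> (b * x) * a ^+ (k + m) = 0.
Proof.
elim: k m x b => [|k IHk] m x b; first by move=> /= ->; rewrite mulr0 mul0r.
elim: m b => [|m IHm] b.
  by move=> _; rewrite expr0 mulr1 => ->; rewrite !mul0r.
rewrite iterSr => adk amb.
have := IHk m.+1 _ _ adk amb.
rewrite /ad mulrBr mulrBl => /eqP; rewrite subr_eq0 => /eqP.
rewrite !mulrA -[RHS]mulrA -exprS => eq.
have -> : (k.+1 + m.+1 = (k + m.+1).+1)%N by [].
rewrite -eq addnS -addSn; apply: IHm; rewrite ?iterSr //.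
by rewrite -mulrA -exprS.
Qed.

(** [ad a] is the difference of the commuting left and right multiplications by [a]; a monomial of
    degree [r + s] in them contains [r] left or [s] right factors. *)
Lemma iter_ad_nil a r s x : a ^+ r * x = 0 -> x * a ^+ s = 0 ->
  iter (r + s) (ad a) x = 0.
Proof.
elim: r s x => [|r IHr] s x; first by rewrite expr0 mul1r => -> _; rewrite iter_ad0.
elim: s x => [|s IHs] x; first by rewrite expr0 mulr1 => _ ->; rewrite iter_ad0.
move=> hr hs; rewrite addSn iterSr /ad iter_adB.
rewrite IHr ?mulrA -?exprSr // -?mulrA ?hs ?mulr0 //.
by rewrite -addSnnS IHs ?subrr // -?mulrA -?exprS // mulrA hr mul0r.
Qed.

End Commutator.

Section Spectral.
Variables (F : closedFieldType) (n : nat).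
Local Notation M := 'M[F]_n.+1.
Implicit Types (x y z e w : M) (lam : F) (p q : {poly F}).

Lemma ad_shift lam y x : ad (y - lam%:M) x = ad y x.
Proof.
have e : lam%:M * x = x * lam%:M by exact: esym (scalar_mxC _ _).
by rewrite /ad mulrBl mulrBr e opprB addrA subrK.
Qed.

Lemma iter_ad_shift lam y x k : iter k (ad (y - lam%:M)) x = iter k (ad y) x.
Proof. by elim: k => //= k ->; rewrite ad_shift. Qed.

Lemma horner_mx_eigen y lam w p : y * w = lam *: w -> horner_mx y p * w = p.[lam] *: w.
Proof.
move=> yw; elim/poly_ind: p => [|p c IH].
  by rewrite rmorph0 mul0r horner0 scale0r.
rewrite rmorphD rmorphM /= horner_mx_X horner_mx_C mulrDl -mulrA yw -scalerAr IH.
by rewrite scalerA hornerMXaddC scalerDl mulrC -mulmxE mul_scalar_mx.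
Qed.

Lemma horner_mx_XsubC y lam : horner_mx y ('X - lam%:P) = y - lam%:M.
Proof. by rewrite rmorphB /= horner_mx_X horner_mx_C. Qed.

(* [horner_mx y p] is the projection onto the generalized eigenspace of y for lam. *)
Lemma gen_eigen_proj y lam : exists p u m,
  p + u * ('X - lam%:P) ^+ m.+1 = 1 /\
  horner_mx y p * (y - lam%:M) ^+ m.+1 = 0.
Proof.
have [m [q qn cE]] := multiplicity_XsubC (char_poly y) lam.
have nz : char_poly y != 0 by apply: monic_neq0 (char_poly_monic y).
rewrite nz /= in qn.
(* The exponent [m.+1] is positive even if [lam] is not an eigenvalue ([m = 0]), so that the Bezout
   identity always gives [p.[lam] = 1]. *)
have cop : coprimep q (('X - lam%:P) ^+ m.+1).
  by apply: coprimep_expr; rewrite coprimep_XsubC.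
have /Bezout_eq1_coprimepP[[v u] /= uv] := cop.
exists (v * q), u, m; split; first by [].
rewrite -horner_mx_XsubC -rmorphXn -rmorphM /=.
rewrite exprSr mulrA -[v * q * _]mulrA -cE !rmorphM /= Cayley_Hamilton.
by rewrite mulr0 mul0r.
Qed.

Section Proj.
Variables (y : M) (lam : F) (p u : {poly F}) (m : nat).
Hypothesis pu : p + u * ('X - lam%:P) ^+ m.+1 = 1.
Hypothesis py : horner_mx y p * (y - lam%:M) ^+ m.+1 = 0.
Let P := horner_mx y p.

Lemma projC : 1 - P = horner_mx y u * (y - lam%:M) ^+ m.+1.
Proof.
apply/eqP; rewrite subr_eq addrC -horner_mx_XsubC -rmorphXn -rmorphM /P.
by rewrite -rmorphD /= pu rmorph1.
Qed.

Lemma proj_comm : GRing.comm (y - lam%:M) P.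
Proof.
by rewrite -horner_mx_XsubC; apply: comm_horner_mx2.
Qed.

Lemma proj_idem : P * P = P.
Proof.
apply/eqP; rewrite -subr_eq0 -[X in _ - X]mulr1 -mulrBr -oppr_eq0 -mulrN opprB projC.
rewrite mulrA [P * _](comm_horner_mx2 y p u) -mulrA py mulr0.
exact/eqP.
Qed.

Lemma proj_nil : (y - lam%:M) ^+ m.+1 * P = 0.
Proof. by rewrite -[RHS]py; apply: commr_sym; apply: commrX; apply: commr_sym; apply: proj_comm. Qed.

Lemma proj_eigen w : y * w = lam *: w -> P * w = w.
Proof.
move=> yw; rewrite /P (horner_mx_eigen _ yw).
have /(congr1 (horner^~ lam)) := pu.
rewrite hornerD hornerM horner_exp hornerXsubC subrr expr0n /= mulr0 addr0 hornerC.
by move->; rewrite scale1r.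
Qed.

(** [x * P] and [P * x] are killed by a high power of [y - lam], on the left and on the right
    respectively. Being idempotent, [1 - P] is divisible by every such power; hence [x] has no
    component between the images of [P] and [1 - P], in either direction. *)
Lemma proj_commute k x : iter k (ad y) x = 0 -> GRing.comm x P.
Proof.
rewrite -(iter_ad_shift lam) => kx.
have Qn j : (1 - P) = horner_mx y (u ^+ j.+1) * (y - lam%:M) ^+ (m.+1 * j.+1).
  have -> : 1 - P = (1 - P) ^+ j.+1.
    elim: j => // j IH; rewrite exprS -IH mulrBl mul1r mulrBr mulr1 proj_idem subrr.
    by rewrite subr0.
  rewrite projC exprMn_comm; first by rewrite rmorphXn exprM.
  by apply: commrX; rewrite -horner_mx_XsubC; apply: comm_horner_mx2.
have Qn' j : (1 - P) = (y - lam%:M) ^+ (m.+1 * j.+1) * horner_mx y (u ^+ j.+1).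
  rewrite {1}(Qn j); apply: commrX.
  by rewrite -horner_mx_XsubC; apply: comm_horner_mx2.
have [hl hr] := (exp_ad_nilL kx proj_nil, exp_ad_nilR kx py).
move: (k + m.+1)%N hl hr => K hl hr.
have le : (K <= m.+1 * K.+1)%N by rewrite mulSn; lia.
have h1 : (1 - P) * (x * P) = 0.
  by rewrite (Qn K) -(subnK le) exprD -!mulrA hl !mulr0.
have h2 : P * x * (1 - P) = 0.
  by rewrite (Qn' K) -(subnK le) addnC exprD !mulrA hr !mul0r.
move: h1 h2; rewrite mulrBl mul1r mulrBr mulr1 => /eqP.
rewrite subr_eq0 => /eqP h1 /eqP; rewrite subr_eq0 => /eqP h2.
by rewrite /GRing.comm h1 h2 mulrA.
Qed.

End Proj.

(** Multiplying [e] successively by the linear factors of the characteristic polynomial ends in 0;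
    the last nonzero product has eigenvectors as columns. It is a polynomial in [y] times [e], hence
    compatible with the projections of [y]. *)
Lemma eigen_factor y e : e != 0 -> exists lam q,
  horner_mx y q * e != 0 /\ y * (horner_mx y q * e) = lam *: (horner_mx y q * e).
Proof.
move=> e0.
have [r rE] := closed_field_poly_normal (char_poly y).
have : horner_mx y (\prod_(z <- r) ('X - z%:P)) * e = 0.
  have /eqP/monicP := char_poly_monic y.
  move=> /eqP lc; rewrite lc scale1r in rE.
  by rewrite -rE Cayley_Hamilton mul0r.
elim: r {rE} => [|z r IH].
  by rewrite big_nil rmorph1 mul1r => /eqP; rewrite (negPf e0).
rewrite big_cons => h.
case: (eqVneq (horner_mx y (\prod_(z <- r) ('X - z%:P)) * e) 0) => [/IH//|q0].
exists z, (\prod_(z <- r) ('X - z%:P)); split=> //.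
apply/eqP; rewrite -subr_eq0 -mul_scalar_mx -mulmxE -mulmxBl mulmxE.
by rewrite -horner_mx_XsubC mulrA -rmorphM; apply/eqP.
Qed.

End Spectral.

(** * Subspaces cut out by linear functions *)

Lemma linfun_linear (F : fieldType) (aT rT : vectType F) (f : aT -> rT) :
  linear f -> linfun f =1 f.
Proof.
by move=> fl x; exact: (lfunE (HB.pack f (GRing.isLinear.Build _ _ _ _ f fl)) x).
Qed.

Lemma memv_lker_linfun (F : fieldType) (aT rT : vectType F) (f : aT -> rT) x :
  linear f -> (x \in lker (linfun f)) = (f x == 0).
Proof. by move=> fl; rewrite memv_ker linfun_linear. Qed.

Lemma memv_cap_linfun (F : fieldType) (aT rT : vectType F) (W : {vspace aT}) (f : aT -> rT) x :
  linear f -> (x \in (W :&: lker (linfun f))%VS) = (x \in W) && (f x == 0).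
Proof. by move=> fl; rewrite memv_cap memv_lker_linfun. Qed.

Lemma entry_subZ (F : nzRingType) m k (x y : 'M[F]_(m, k)) c i j :
  (x - c *: y) i j = x i j - c * y i j.
Proof. by rewrite !mxE. Qed.

(** * Dimensions of spaces of matrices *)

Section HalfBlocks.
Variables (C : fieldType) (n : nat).

(** The indices are grouped into pairs {2t, 2t+1}; the kernel consists of the block diagonal
    matrices with blocks of size 2, in which a standard Cartan subalgebra is found. *)
Definition off_half_blocks (x : 'M[C]_n) : 'M[C]_n :=
  \matrix_(r, s) (x r s *+ ((r : nat)./2 != (s : nat)./2)).

Definition half_block_space : {vspace 'M[C]_n} := lker (linfun off_half_blocks).

Lemma half_block_spaceP x : x \in half_block_space <->
  forall r s : 'I_n, (r : nat)./2 != (s : nat)./2 -> x r s = 0.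
Proof.
rewrite /half_block_space memv_lker_linfun => [|a y z]; last first.
  apply/matrixP => r s; rewrite !mxE.
  by case: (_ != _); rewrite ?mulr1n ?mulr0n ?mulr0 ?addr0.
split=> [/eqP/matrixP x0 r s rs|x0]; first by have := x0 r s; rewrite !mxE rs.
apply/eqP/matrixP => r s; rewrite !mxE.
by have [_|/x0->] := eqVneq _ _; rewrite ?mulr0n ?mul0rn.
Qed.

End HalfBlocks.

Section EntrySpace.
Variables (C : fieldType) (n K : nat).

Lemma dim_entries (W : {vspace 'M[C]_n}) (pos : 'I_K -> 'I_n * 'I_n) :
  (forall x, x \in W -> (forall k, x (pos k).1 (pos k).2 = 0) -> x = 0) ->
  (forall w : 'rV[C]_K, exists2 x, x \in W & forall k, x (pos k).1 (pos k).2 = w 0 k) ->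
  \dim W = K.
Proof.
move=> inj surj.
pose psi (x : 'M[C]_n) : 'rV[C]_K := \row_k x (pos k).1 (pos k).2.
have lin : linear psi by move=> a y z; apply/rowP => k; rewrite !mxE.
have <- : \dim (linfun psi @: W) = \dim W.
  apply: limg_dim_eq; apply/eqP; rewrite -subv0; apply/subvP => x.
  rewrite memv_cap memv_lker_linfun // => /andP[xW /eqP/rowP px].
  rewrite (inj x xW) ?mem0v // => k; by have := px k; rewrite !mxE.
have -> : (linfun psi @: W)%VS = fullv.
  apply/vspaceP => w; rewrite memvf; apply/memv_imgP.
  have [x xW xw] := surj w; exists x => //.
  by rewrite linfun_linear //; apply/rowP => k; rewrite mxE xw.
by rewrite dimvf /dim /= mul1n.
Qed.

End EntrySpace.

Section SymmetricDimension.
Variables (C : fieldType) (n : nat).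
Local Notation M := 'M[C]_n.+1.

Definition lower_pairs : {set 'I_n.+1 * 'I_n.+1} :=
  [set p : 'I_n.+1 * 'I_n.+1 | (p.1 < n)%N && (p.2 <= p.1)%N].

Lemma card_lower_pairs : (#|lower_pairs| * 2 = n * n.+1)%N.
Proof.
have sumS m : ((\sum_(i < m) i.+1) * 2 = m * m.+1)%N.
  by elim: m => [|m IH]; rewrite ?big_ord0 // big_ord_recr /= mulnDl IH; lia.
rewrite -sumS -sum1_card; congr (_ * 2)%N.
rewrite (eq_bigl (fun p : 'I_n.+1 * 'I_n.+1 => (p.1 < n) && (p.2 <= p.1))%N); last first.
  by move=> p; rewrite inE.
rewrite -(pair_big_dep (fun i : 'I_n.+1 => (i < n)%N) (fun i j : 'I_n.+1 => (j <= i)%N) (fun _ _ => 1%N)) /=.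
rewrite (big_ord_narrow (leqnSn n)); apply: eq_bigr => i _ /=.
rewrite (big_ord_narrow_leq (ltnW (ltn_ord i))).
by rewrite sum_nat_const card_ord muln1.
Qed.

Definition symmetric_block : {vspace M} :=
  (lker (linfun (fun x : M => x - x^T)) :&: lker (linfun (fun x : M => col ord_max x)))%VS.

Lemma symmetric_blockP (x : M) : x \in symmetric_block <->
  x^T = x /\ forall r, x r ord_max = 0.
Proof.
have lin1 : linear (fun x : M => x - x^T).
  by move=> a y z; apply/matrixP => i j; rewrite !mxE; ring.
have lin2 : linear (fun x : M => col ord_max x).
  by move=> a y z; apply/matrixP => i j; rewrite !mxE.
rewrite memv_cap (memv_lker_linfun x lin1) (memv_lker_linfun x lin2).
split=> [/andP[xT /eqP/matrixP xc]|[xT xc]].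
  split; first by move: xT; rewrite subr_eq0 => /eqP <-.
  by move=> r; have := xc r 0; rewrite !mxE.
by rewrite xT subrr eqxx; apply/eqP/matrixP => i j; rewrite !mxE.
Qed.

Lemma dim_symmetric_block : \dim symmetric_block = #|lower_pairs|.
Proof.
pose pos (k : 'I_#|lower_pairs|) := enum_val k.
apply: (dim_entries (pos := pos)) => [x /symmetric_blockP[xT xc] x0|w].
  have x0' p : p \in lower_pairs -> x p.1 p.2 = 0.
    by move=> pA; have := x0 (enum_rank_in pA p); rewrite /pos enum_rankK_in.
  have sk r s : x s r = x r s by rewrite -{1}xT mxE.
  have low (r s : 'I_n.+1) : (s <= r)%N -> x r s = 0.
    move=> sr; have [->|ro] := eqVneq r ord_max; first by rewrite -sk xc.
    apply: (x0' (r, s)); rewrite inE /= sr andbT.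
    by rewrite ltn_neqAle -ltnS ltn_ord andbT.
  apply/matrixP => r s; rewrite mxE; have [sr|/ltnW rs] := leqP s r; first exact: low.
  by rewrite -sk low.
pose x : M := \matrix_(r, s) \sum_k w 0 k *+ ((pos k == (r, s)) || (pos k == (s, r))).
have posP k : ((pos k).1 < n)%N /\ ((pos k).2 <= (pos k).1)%N.
  by have := enum_valP k; rewrite inE => /andP.
exists x => [|k].
  apply/symmetric_blockP; split.
    by apply/matrixP => r s; rewrite !mxE; apply: eq_bigr => k _; rewrite orbC.
  move=> r; rewrite mxE big1 // => k _; have [k1 k2] := posP k.
  have -> : (pos k == (r, ord_max)) = false.
    by apply/negP => /eqP E; move: k1 k2; rewrite E /=; lia.
  have -> : (pos k == (ord_max, r)) = false.
    by apply/negP => /eqP E; move: k1 k2; rewrite E /=; lia.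
  exact: mulr0n.
rewrite mxE (bigD1 k) //= -surjective_pairing eqxx big1 ?addr0 // => j jk.
have -> : (pos j == pos k) = false by rewrite (inj_eq enum_val_inj) (negPf jk).
have -> : (pos j == ((pos k).2, (pos k).1)) = false; last exact: mulr0n.
apply/negP => /eqP E; move/negP: jk; apply; apply/eqP/enum_val_inj; rewrite -/(pos j) -/(pos k) E.
have [_ j2] := posP j; have [_ k2] := posP k; rewrite E /= in j2.
have E2 : (pos k).1 = (pos k).2 by apply/val_inj/eqP; rewrite eqn_leq j2.
by rewrite [RHS]surjective_pairing E2.
Qed.

(** Rank-nullity for the trace, which is onto because the first diagonal matrix unit lies in the
    block. *)
Lemma dim_symmetric_traceless : (0 < n)%N ->
  (\dim (symmetric_block :&: lker (linfun (fun x : M => \tr x : C^o))) + 1 = #|lower_pairs|)%N.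
Proof.
move=> n0; have lin : linear (fun x : M => \tr x : C^o).
  by move=> a y z; rewrite linearD linearZ.
rewrite -dim_symmetric_block -(limg_ker_dim (linfun (fun x : M => \tr x : C^o)) symmetric_block).
congr (_ + _)%N; apply/esym/eqP; rewrite eqn_leq; apply/andP; split.
  by rewrite (leq_trans (dimvS (subvf _))) // dimvf /dim.
rewrite lt0n dimv_eq0; apply/eqP => im0.
pose e : M := delta_mx ord0 ord0.
have eS : e \in symmetric_block.
  apply/symmetric_blockP; split; first by rewrite trmx_delta.
  by move=> r; rewrite mxE -[ord_max == _]val_eqE /= (gtn_eqF n0) andbF.
have := memv_img (linfun (fun x : M => \tr x : C^o)) eS; rewrite im0 memv0 linfun_linear //.
rewrite /mxtrace (bigD1 ord0) //= big1 ?mxE ?eqxx ?addr0 ?oner_eq0 // => i io.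
by rewrite mxE (negPf io).
Qed.

End SymmetricDimension.

(** Labels of a basis of the (2l+2)-dimensional space: l hyperbolic pairs and two further
    vectors. *)
Definition frame_index l := ('I_l * bool + bool)%type.

Lemma sum_frame_index (V : nmodType) l (F : frame_index l -> V) :
  \sum_a F a = F (inr true) + F (inr false)
             + \sum_i (F (inl (i, true)) + F (inl (i, false))).
Proof.
rewrite /frame_index big_sumType /= big_bool addrC; congr (_ + _).
transitivity (\sum_(i < l) \sum_(b : bool) F (inl (i, b))).
  by rewrite pair_bigA; apply: eq_bigr => p _; case: p.
by apply: eq_bigr => i _; rewrite big_bool.
Qed.

(** * Structure of Cartan subalgebras *)

Section CartanFrame.
Variables (C : numClosedFieldType) (n : nat).
Local Notation M := 'M[C]_n.+1.
Implicit Types (x y z w e f P : M) (lam : C).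

Local Notation dd := (delta_mx ord_max ord_max : M).

Lemma trmxX x k : (x ^+ k)^T = x^T ^+ k.
Proof. by elim: k => [|k IH]; rewrite ?trmx1 // exprS -mulmxE trmx_mul IH exprSr. Qed.

Lemma commT x y : x^T = - x -> GRing.comm x y -> GRing.comm x y^T.
Proof.
move=> xT; rewrite /GRing.comm => /(congr1 trmx).
by rewrite -!mulmxE !trmx_mul xT mulmxN mulNmx => /oppr_inj.
Qed.

Lemma horner_mx_comm y z p : GRing.comm y z -> GRing.comm z (horner_mx y p).
Proof. by move=> yz; exact: (comm_mx_horner p (commr_sym yz)). Qed.

Lemma horner_mx_trmx_comm y z p : y^T = - y -> GRing.comm y z ->
  GRing.comm z (horner_mx y p)^T.
Proof.
move=> yT yz; have /(horner_mx_comm p) := commT yT yz.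
rewrite /GRing.comm => /(congr1 trmx).
by rewrite -!mulmxE !trmx_mul trmxK.
Qed.

Lemma eigen_nilp y x lam a m : y * x = a *: x -> (y - lam%:M) ^+ m * x = (a - lam) ^+ m *: x.
Proof.
move=> yx; have := horner_mx_eigen (('X - lam%:P) ^+ m) yx.
by rewrite rmorphXn /= horner_mx_XsubC horner_exp hornerXsubC.
Qed.

(** As [y] is skew, [P^T] belongs to the eigenvalue [- lam], which differs from [lam]. Thus
    [P * P^T] is killed by powers of [y - lam] and of [y + lam], and these are coprime polynomials
    in [y]. *)
Lemma projT_orth y lam p u m : y^T = - y -> lam != 0 ->
  p + u * ('X - lam%:P) ^+ m.+1 = 1 ->
  horner_mx y p * (y - lam%:M) ^+ m.+1 = 0 ->
  horner_mx y p * (horner_mx y p)^T = 0.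
Proof.
move=> yT lam0 pu py; set P := horner_mx y p.
have PPT : GRing.comm P P^T.
  apply: horner_mx_trmx_comm => //; apply: horner_mx_comm; exact: commr_refl.
have h1 : horner_mx y (('X - lam%:P) ^+ m.+1) * (P * P^T) = 0.
  by rewrite rmorphXn /= horner_mx_XsubC mulrA (proj_nil py) mul0r.
have h2 : horner_mx y (('X - (- lam)%:P) ^+ m.+1) * (P * P^T) = 0.
  suff e0 : (y - (- lam)%:M) ^+ m.+1 * P^T = 0.
    by rewrite rmorphXn /= horner_mx_XsubC PPT mulrA e0 mul0r.
  have := congr1 trmx py.
  rewrite trmx0 -mulmxE trmx_mul trmxX linearB /= yT tr_scalar_mx -opprD mulmxE.
  rewrite raddfN opprK exprNn -signr_odd mulr_sign.
  by case: odd; rewrite // mulNr => /eqP; rewrite oppr_eq0 => /eqP.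
have /Bezout_eq1_coprimepP[[v1 v2] /= v12] :
    coprimep (('X - lam%:P) ^+ m.+1) (('X - (- lam)%:P) ^+ m.+1).
  apply: coprimep_expl; apply: coprimep_expr; rewrite coprimep_XsubC2 //.
  by rewrite -opprD oppr_eq0 -mulr2n mulrn_eq0.
have := congr1 (fun q => horner_mx y q * (P * P^T)) v12.
rewrite rmorphD !rmorphM /= mulrDl -!mulrA [P * P^T]lock in h1 h2 *.
by rewrite h1 h2 !mulr0 addr0 rmorph1 mul1r -lock.
Qed.

Variable h : {pred M}.
Hypothesis hT : forall y, y \in h -> y^T = - y.
Hypothesis hnil : exists k, forall x y, x \in h -> y \in h -> iter k (ad x) y = 0.

(** The algebra so(2l+1) in degree (0,0), described without reference to the gradation. *)
Definition skew_dd x := x^T = - x /\ x * dd = 0.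

(** Engel's theorem joined to self-normalization of [h]. It is applied below to a copy of gl, to the
    skew endomorphisms of a submodule and to the centralizer of [h]. *)
Hypothesis h_engel : forall W : M -> Prop, (forall w, W w -> skew_dd w) ->
  (forall y w, y \in h -> W w -> W (ad y w)) ->
  (forall y w, y \in h -> W w -> exists k, iter k (ad y) w = 0) ->
  forall w, W w -> w \in h.

Let hproj y lam p u m : y \in h ->
  p + u * ('X - lam%:P) ^+ m.+1 = 1 ->
  horner_mx y p * (y - lam%:M) ^+ m.+1 = 0 ->
  forall x, x \in h -> GRing.comm x (horner_mx y p).
Proof.
move=> yh pu py x xh; have [k hk] := hnil.
by apply: (proj_commute pu py (k := k)); apply: hk.
Qed.

(* e is the projection onto an isotropic h-submodule, along the orthogonal of
   the isotropic submodule onto which e^T projects. *)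
Definition isotropic_proj e :=
  [/\ e * e = e, e * e^T = 0 /\ e^T * e = 0,
      forall y, y \in h -> GRing.comm y e & e * dd = 0 /\ dd * e = 0].

Let mem_skew e : e * dd = 0 -> dd * e = 0 -> skew_dd (e - e^T).
Proof.
move=> e1 e2; split; first by rewrite linearB /= trmxK opprB.
have : (dd * e)^T = 0 by rewrite e2 trmx0.
rewrite -mulmxE trmx_mul trmx_delta mulmxE => e3.
by rewrite mulrBl e1 e3 subrr.
Qed.

Lemma isotropic_refine e y lam p u m : isotropic_proj e -> y \in h ->
  p + u * ('X - lam%:P) ^+ m.+1 = 1 ->
  horner_mx y p * (y - lam%:M) ^+ m.+1 = 0 ->
  isotropic_proj (horner_mx y p * e).
Proof.
move=> [ee [eeT eTe] eh [ed de]] yh pu py; set P := horner_mx y p.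
have PP : P * P = P by apply: (proj_idem pu py).
have eP : GRing.comm e P by apply: horner_mx_comm; apply: eh.
have eTP : GRing.comm e^T P by apply: horner_mx_comm; apply/commT/eh => //; apply: hT.
have eTPT : GRing.comm e^T P^T.
  by apply: horner_mx_trmx_comm; [apply: hT|apply/commT/eh => //; apply: hT].
have TE : (P * e)^T = e^T * P^T by rewrite -mulmxE trmx_mul.
split.
- by rewrite mulrA -[P * e * P]mulrA eP mulrA PP -mulrA ee.
- rewrite TE; split; first by rewrite mulrA -[P * e * _]mulrA eeT mulr0 mul0r.
  by rewrite eTPT mulrA -[_ * e^T * P]mulrA eTP -!mulrA eTe !mulr0.
- by move=> x xh; apply: commrM; [apply: (hproj yh pu py) | apply: eh].
- by rewrite -mulrA ed mulr0 -eP mulrA de mul0r.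
Qed.

(** The orthogonal projection onto a nondegenerate [h]-submodule of the first 2l+1 coordinates. *)
Definition symmetric_proj f :=
  [/\ f * f = f, f^T = f, forall y, y \in h -> GRing.comm y f & f * dd = 0].

Lemma symmetric_projd f : symmetric_proj f -> dd * f = 0.
Proof.
case=> _ fT _ /(congr1 trmx); rewrite -mulmxE trmx_mul trmx_delta fT trmx0.
by rewrite mulmxE.
Qed.

Lemma symmetric_refine f y lam p u m : symmetric_proj f -> y \in h -> lam != 0 ->
  p + u * ('X - lam%:P) ^+ m.+1 = 1 ->
  horner_mx y p * (y - lam%:M) ^+ m.+1 = 0 ->
  isotropic_proj (horner_mx y p * f).
Proof.
move=> sf yh lam0 pu py; set P := horner_mx y p.
have df := symmetric_projd sf; have [ff fT fh fd] := sf.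
have PP : P * P = P by apply: (proj_idem pu py).
have fP : GRing.comm f P by apply: horner_mx_comm; apply: fh.
have fPT : GRing.comm f P^T by apply: horner_mx_trmx_comm; [apply: hT|apply: fh].
have PPT : P * P^T = 0 by apply: (projT_orth _ lam0 pu py); apply: hT.
have PTP : P^T * P = 0.
  rewrite -PPT; apply: commr_sym; apply: horner_mx_trmx_comm; first exact: hT.
  by apply: horner_mx_comm; apply: commr_refl.
have TE : (P * f)^T = f * P^T by rewrite -mulmxE trmx_mul fT.
split.
- by rewrite mulrA -[P * f * P]mulrA fP mulrA PP -mulrA ff.
- rewrite TE; split; first by rewrite mulrA -[P * f * f]mulrA ff -mulrA fPT mulrA PPT mul0r.
  by rewrite mulrA -[f * _ * P]mulrA PTP mulr0 mul0r.
- by move=> x xh; apply: commrM; [apply: (hproj yh pu py) | apply: fh].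
- by rewrite -mulrA fd mulr0 -fP mulrA df mul0r.
Qed.

(** This is the descent for both inductions on the rank. Equal ranks would give [e = X * e'], hence
    [e * e' = e], so that [e = e']. *)
Lemma rank_idem_lt e e' : e * e' = e' -> e' * e = e' -> e' * e' = e' -> e' != e ->
  (\rank e' < \rank e)%N.
Proof.
move=> h1 h2 h3 ne; rewrite ltn_neqAle mxrankS ?andbT; last first.
  by rewrite -h2; apply: submxMl.
apply: contra ne => /eqP re.
have /mxrank_leqif_sup : (e' <= e)%MS by rewrite -h2; apply: submxMl.
case=> _; rewrite re eqxx => /esym/submxP[X eE].
by rewrite -h1 eE mulmxE -mulrA h3.
Qed.

Lemma isotropic_rank1 e : isotropic_proj e -> e != 0 ->
  exists u w : 'cV[C]_n.+1, [/\ isotropic_proj (u *m w^T), w^T *m u = 1%:M,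
    e * (u *m w^T) = u *m w^T & (u *m w^T) * e = u *m w^T].
Proof.
have [r] := ubnP (\rank e); elim: r e => // r IH e rk ge e0.
have [ee [eeT eTe] eh [ed de]] := ge.
have [single|] := pselect (forall y, y \in h -> exists lam m, (y - lam%:M) ^+ m * e = 0);
  last first.
  move=> /existsNP[y /not_implyP[yh ynil]].
  have [lam [q [w0 wE]]] := eigen_factor y e0; set w := _ * e in w0 wE.
  have [p [u [m [pu py]]]] := gen_eigen_proj y lam.
  set P := horner_mx y p in py.
  have ge' := isotropic_refine ge yh pu py; rewrite -/P in ge'.
  have eP : GRing.comm e P by apply: horner_mx_comm; apply: eh.
  have [ee' _ _ _] := ge'.
  have e'0 : P * e != 0.
    apply: contra w0 => /eqP Pe; rewrite -(proj_eigen pu wE) -/P /w mulrA.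
    by rewrite (comm_horner_mx2 y p q) -mulrA -/P Pe mulr0.
  have l1 : e * (P * e) = P * e by rewrite mulrA eP -mulrA ee.
  have l2 : P * e * e = P * e by rewrite -mulrA ee.
  have lt : (\rank (P * e)%R < \rank e)%N.
    apply: rank_idem_lt => //; apply/eqP => Pe; apply: ynil; exists lam, m.+1.
    by rewrite -Pe mulrA (proj_nil py) mul0r.
  have [|u1 [w1 [g1 uw1 l3 l4]]] := IH _ _ ge' e'0; first exact: leq_trans lt _.
  exists u1, w1; split=> //.
    by rewrite -l3 mulrA l1.
  by rewrite -l4 -mulrA l2.
(* [y - lam] is nilpotent on [e] from both sides, so [ad y] is nilpotent on [e * z * e]. The
   matrices of this form, made skew, are a copy of gl of the image of [e]. *)
have mem z : e * z * e - (e * z * e)^T \in h.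
  apply: (h_engel (W := fun w => exists z, w = e * z * e - (e * z * e)^T)); last by exists z.
  - by move=> w [t ->]; apply: mem_skew; rewrite -?mulrA ?ed ?mulr0 // mulrA de mul0r.
  - move=> y w yh [t ->]; exists (ad y t).
    rewrite -(adML _ (eh y yh)) -(adMR _ (eh y yh)) adB; congr (_ - _).
    by rewrite /ad linearB /= -mulmxE !trmx_mul (hT yh) mulmxN mulNmx opprK addrC.
  - move=> y w yh [t ->]; have [lam [m lm]] := single y yh.
    have n1 : iter (m + m) (ad y) (e * t * e) = 0.
      rewrite -(iter_ad_shift lam); apply: iter_ad_nil; first by rewrite !mulrA lm !mul0r.
      have ey : GRing.comm e (y - lam%:M).
      by apply: commrB; [exact/commr_sym/eh | exact: scalar_mxC].
    by rewrite -[_ * e * _]mulrA (commrX m ey) lm mulr0.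
    exists (m + m)%N; rewrite iter_adB n1 sub0r; apply/eqP; rewrite oppr_eq0.
    suff <- : (iter (m + m) (ad y) (e * t * e))^T = iter (m + m) (ad y) (e * t * e)^T.
      by rewrite n1 trmx0.
    elim: (m + m)%N => //= k <-.
    by rewrite /ad linearB /= -mulmxE !trmx_mul (hT yh) mulmxN mulNmx opprK addrC.
have [i [j eij]] : exists i j, e i j != 0.
  apply: contrapT => hn; move/negP: e0; apply; apply/eqP/matrixP => i j.
  by rewrite mxE; apply: contrapT => /eqP eij; apply: hn; exists i, j.
(* [e * z * e] is column [j] times row [i] of [e], scaled so as to be idempotent. *)
pose z : M := (e i j)^-1 *: delta_mx j i.
pose u : 'cV[C]_n.+1 := e *m delta_mx j 0.
pose w : 'cV[C]_n.+1 := ((e i j)^-1 *: (delta_mx 0 i *m e))^T.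
have uw : u *m w^T = e * z * e.
  by rewrite /u /w trmxK -scalemxAr -!mulmxE /z -scalemxAr -scalemxAl !mulmxA -[e *m _ *m _]mulmxA mul_delta_mx.
have wu : w^T *m u = 1%:M.
  rewrite /u /w trmxK -scalemxAl !mulmxA -[_ *m e *m e]mulmxA [e *m e]ee.
  rewrite -rowE -colE; apply/matrixP => a b; rewrite !ord1 !mxE eqxx mulr1n.
  by rewrite mulVf.
have e1e1 : (e * z * e) * (e * z * e) = e * z * e.
  by rewrite -uw -!mulmxE -mulmxA (mulmxA _ u) wu mul1mx.
have e1T : (e * z * e)^T = e^T * z^T * e^T by rewrite -!mulmxE !trmx_mul mulmxA.
(* The element [e * z * e - (e * z * e)^T] of [h] has eigenvalue 1 on [e * z * e] and 0 on
   [e - e * z * e]. Since it has a single eigenvalue on [e], the difference must vanish. *)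
suff eE : e = e * z * e.
  by exists u, w; rewrite uw -eE ee.
have [lam [m lm]] := single _ (mem z).
pose y : M := e * z * e - (e * z * e)^T; rewrite -/y in lm.
have y1 : y * (e * z * e) = 1 *: (e * z * e).
  rewrite /y mulrBl e1e1 scale1r e1T !mulrA -[_ * e^T * e]mulrA eTe.
  by rewrite mulr0 !mul0r subr0.
have y2 : y * (e - e * z * e) = 0 *: (e - e * z * e).
  rewrite mulrBr y1 scale1r scale0r /y mulrBl -[e * z * e * e]mulrA ee e1T.
  by rewrite -[_ * e^T * e]mulrA eTe mulr0 subr0 subrr.
have lam1 : lam = 1.
  have := eigen_nilp lam m y1; rewrite !mulrA lm !mul0r => /esym/eqP.
  rewrite scaler_eq0 expf_eq0 subr_eq0 => /orP[/andP[_ /eqP->] //|/eqP e10].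
  move: wu; have : w^T *m (u *m w^T) *m u = 0 by rewrite uw e10 mulmx0 mul0mx.
  rewrite mulmxA => h0 wu; move: h0; rewrite wu mul1mx wu => /matrixP/(_ 0 0).
  by rewrite !mxE => /eqP; rewrite oner_eq0.
have := eigen_nilp lam m y2.
have -> : e - e * z * e = e * (e - e * z * e) by rewrite mulrBr !mulrA ee.
rewrite mulrA lm mul0r => /esym/eqP; rewrite lam1 scaler_eq0 expf_eq0 sub0r oppr_eq0 oner_eq0.
by rewrite andbF /= mulrBr !mulrA ee subr_eq0 => /eqP.
Qed.

(** Removing the generalized kernel of [y] by [1 - P0] leaves a nonzero part of [f]. An eigenvector
    found there is killed by [P0], whereas one of eigenvalue 0 would be fixed by it. *)
Lemma not_nilpotent_eigen f y : symmetric_proj f -> y \in h ->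
  ~ (exists m, y ^+ m * f = 0) ->
  exists lam p u m, [/\ lam != 0, p + u * ('X - lam%:P) ^+ m.+1 = 1,
    horner_mx y p * (y - lam%:M) ^+ m.+1 = 0 & horner_mx y p * f != 0].
Proof.
move=> [ff fT fh fd] yh ynil.
have [p0 [u0 [m0 [pu0 py0]]]] := gen_eigen_proj y 0.
set P0 := horner_mx y p0 in py0.
have y0 : y - 0%:M = y by rewrite raddf0 subr0.
have f10 : (1 - P0) * f != 0.
  apply/eqP; rewrite mulrBl mul1r => /eqP; rewrite subr_eq0 => /eqP fE.
  by apply: ynil; exists m0.+1; rewrite fE mulrA -{1}y0 (proj_nil py0) mul0r.
have [lam [q [w0 wE]]] := eigen_factor y f10; set w := _ * (_ * f) in w0 wE.
have [p [u [m [pu py]]]] := gen_eigen_proj y lam.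
exists lam, p, u, m; split=> //.
  apply: contra w0 => /eqP l0; rewrite l0 in wE; rewrite -(proj_eigen pu0 wE) -/P0 /w.
  have PP0 : P0 * P0 = P0 by apply: (proj_idem pu0 py0).
  have Pq : P0 * horner_mx y q = horner_mx y q * P0 by apply: comm_horner_mx2.
  by rewrite [P0 * _]mulrA Pq -mulrA [P0 * _]mulrA mulrBr mulr1 PP0 subrr mul0r mulr0.
set P := horner_mx y p.
apply: contra w0 => /eqP Pf; rewrite -(proj_eigen pu wE) -/P /w.
have Pq : P * horner_mx y q = horner_mx y q * P by apply: comm_horner_mx2.
have PP : P * P0 = P0 * P by apply: comm_horner_mx2.
rewrite [P * _]mulrA Pq -mulrA [P * _]mulrA mulrBr mulr1.
by rewrite PP mulrBl -mulrA Pf mulr0 subr0 mulr0.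
Qed.

Lemma symmetric_proj_sub f e : symmetric_proj f -> isotropic_proj e ->
  f * e = e -> e * f = e -> symmetric_proj (f - e - e^T).
Proof.
move=> [ff fT fh fd] [ee [eeT eTe] eh [ed de]] fe ef.
have feT : f * e^T = e^T by rewrite -{1}fT -!mulmxE -trmx_mul mulmxE ef.
have eTf : e^T * f = e^T by rewrite -{1}fT -!mulmxE -trmx_mul mulmxE fe.
have eTeT : e^T * e^T = e^T by rewrite -!mulmxE -trmx_mul mulmxE ee.
split.
- rewrite !mulrBl !mulrBr ff fe feT ef ee eeT eTf eTe eTeT.
  by rewrite !(subr0, subrr).
- by rewrite !linearB /= trmxK fT addrAC.
- move=> y yh; apply: commrB; first by apply: commrB; [apply: fh|apply: eh].
  by apply: commT; [apply: hT|apply: eh].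
- have : (dd * e)^T = 0 by rewrite de trmx0.
  rewrite -mulmxE trmx_mul trmx_delta mulmxE => eTd.
  by rewrite !mulrBl fd ed eTd !subr0.
Qed.

Definition rank1_pair (uw : 'cV[C]_n.+1 * 'cV[C]_n.+1) : M := uw.1 *m uw.2^T.

(** While some [y] is not nilpotent on [f], an isotropic [h]-stable line exists in its image.
    Together with the line of the transposed projection it spans a hyperbolic plane, whose
    orthogonal complement has smaller rank. *)
Lemma symmetric_split f : symmetric_proj f -> exists f0 s,
  [/\ symmetric_proj f0, f * f0 = f0 /\ f0 * f = f0,
      forall y, y \in h -> exists m, y ^+ m * f0 = 0,
      f = f0 + \sum_(uw <- s) (rank1_pair uw + (rank1_pair uw)^T) &
      forall uw, uw \in s -> isotropic_proj (rank1_pair uw) /\ uw.2^T *m uw.1 = 1%:M].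
Proof.
have [r] := ubnP (\rank f); elim: r f => // r IH f rk sf.
have [nil|] := pselect (forall y, y \in h -> exists m, y ^+ m * f = 0).
  have [ff _ _ _] := sf.
  by exists f, [::]; split=> //; rewrite big_nil addr0.
move=> /existsNP[y /not_implyP[yh ynil]].
have [lam [p [u [m [lam0 pu py Pf]]]]] := not_nilpotent_eigen sf yh ynil.
have ie := symmetric_refine sf yh lam0 pu py.
have [ff fT fh fd] := sf.
have fP : GRing.comm f (horner_mx y p) by apply: horner_mx_comm; apply: fh.
have [u1 [w1 []]] := isotropic_rank1 ie Pf.
set e : M := u1 *m w1^T => ie1 wu1 pe1 ep1.
have fe : f * e = e.
  by rewrite -pe1 mulrA; congr (_ * _); rewrite mulrA fP -mulrA ff.
have ef : e * f = e.
  by rewrite -ep1 -mulrA; congr (_ * _); rewrite -mulrA ff.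
have e0 : e != 0.
  apply/eqP => e0; have : w1^T *m (u1 *m w1^T) *m u1 = 0 by rewrite -/e e0 mulmx0 mul0mx.
  rewrite mulmxA wu1 mul1mx wu1 => /matrixP/(_ 0 0).
  by rewrite !mxE => /eqP; rewrite oner_eq0.
have sf' := symmetric_proj_sub sf ie1 fe ef.
set f' := f - e - e^T in sf'.
have [f'f' _ _ _] := sf'.
have [ee [eeT eTe] _ _] := ie1.
have feT : f * e^T = e^T by rewrite -{1}fT -!mulmxE -trmx_mul mulmxE ef.
have eTf : e^T * f = e^T by rewrite -{1}fT -!mulmxE -trmx_mul mulmxE fe.
have ff' : f * f' = f' by rewrite /f' !mulrBr ff fe feT.
have f'f : f' * f = f' by rewrite /f' !mulrBl ff ef eTf.
have lt : (\rank f' < \rank f)%N.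
  apply: rank_idem_lt => //; apply/eqP => /(congr1 (fun t => e * t)).
  rewrite /f' !mulrBr ef ee eeT subrr subr0 => e00.
  by rewrite -e00 eqxx in e0.
have [|f0 [s [sf0 [h1 h2] nil fE sP]]] := IH f' _ sf'; first exact: leq_trans lt _.
exists f0, ((u1, w1) :: s); split=> //.
- by split; [rewrite -[in LHS]h1 mulrA ff' h1 | rewrite -[in LHS]h2 -mulrA f'f h2].
- by rewrite big_cons addrCA -fE /f' /rank1_pair /= -/e -(addrA f) -opprD [RHS]addrC subrK.
- by move=> uw; rewrite inE => /predU1P[->|/sP//].
Qed.

(** All of so of the image of [f] is nilpotent; for a symmetric idempotent this leaves only images
    of dimension at most 1, as the trace shows. *)
Definition nil_skew f := forall z, z^T = - z -> exists m, (f * z * f) ^+ m * f = 0.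

Lemma delta_mul_delta (f : M) a b c d :
  delta_mx a b * f * delta_mx c d = f b c *: delta_mx a d.
Proof.
have -> : (delta_mx a b : M) = delta_mx a 0 *m (delta_mx 0 b : 'rV_n.+1).
  by rewrite mul_delta_mx.
have -> : (delta_mx c d : M) = delta_mx c 0 *m (delta_mx 0 d : 'rV_n.+1).
  by rewrite mul_delta_mx.
rewrite -!mulmxE !mulmxA -(mulmxA _ _ f) -rowE -(mulmxA _ _ (delta_mx c 0)) -colE.
have -> : col c (row b f) = (f b c)%:M.
  by apply/matrixP => i j; rewrite !ord1 !mxE eqxx mulr1n.
by rewrite mul_mx_scalar -scalemxAl mul_delta_mx.
Qed.

(** For [z] the rotation in the coordinates [i] and [j], the square of [f * z * f] multiplies column
    [i] of [f] by the negative of the principal minor. By nilpotency the minor or the column is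
    zero. *)
Lemma nil_skew_minor f i j : f * f = f -> f^T = f -> nil_skew f ->
  f i j ^+ 2 = f i i * f j j.
Proof.
move=> ff fT /(_ (delta_mx i j - delta_mx j i)) [|m].
  by rewrite linearB /= !trmx_delta opprB.
set z : M := _ - _; set y := f * z * f => ym.
pose D := f i j ^+ 2 - f i i * f j j.
have fji : f j i = f i j by rewrite -{1}fT mxE.
have yy : (y * y) * (f * delta_mx i i) = D *: (f * delta_mx i i).
  rewrite /y -!mulrA [f * (f * _)]mulrA ff [f * (f * _)]mulrA ff scalerAr; congr (_ * _).
  rewrite !mulrA /z.
  have -> : (delta_mx i j - delta_mx j i) * f * (delta_mx i j - delta_mx j i) =
    f i j *: delta_mx i j - f j j *: delta_mx i i - (f i i *: delta_mx j j - f i j *: delta_mx j i).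
    by rewrite !mulrBl !mulrBr !delta_mul_delta fji.
  rewrite !mulrBl -!scalerAl !delta_mul_delta !scalerA fji.
  rewrite [f i i * f i j]mulrC subrr subr0 -scalerBl.
  by congr (_ *: _); rewrite /D expr2 [f j j * _]mulrC.
have := horner_mx_eigen ('X^m) yy.
rewrite rmorphXn /= horner_mx_X hornerXn exprMn_comm; last exact: commr_refl.
rewrite [y ^+ m * y ^+ m * _]mulrA -[y ^+ m * _ * f]mulrA ym mulr0 mul0r.
move/esym/eqP; rewrite scaler_eq0 expf_eq0 => /orP[/andP[_]|/eqP f0].
  by rewrite subr_eq0 => /eqP.
have fi a : f a i = 0.
  have /matrixP/(_ a i) := f0; rewrite -mulmxE mxE (bigD1 i) //= big1.
    by rewrite !mxE !eqxx mulr1 addr0.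
  by move=> b bi; rewrite mxE (negPf bi) mulr0.
by rewrite -fji !fi mul0r expr0n.
Qed.

(** Summing the vanishing minors in the diagonal of [f * f = f] gives [f i i = f i i * \tr f]. So
    the diagonal is zero, and by the minors again so are all entries. *)
Lemma nil_skew_trace f : f * f = f -> f^T = f -> nil_skew f ->
  \tr f != 1 -> f = 0.
Proof.
move=> ff fT nf tr1.
have d0 i : f i i = 0.
  have : f i i = f i i * \tr f.
    rewrite -{1}ff -mulmxE mxE mulr_sumr; apply: eq_bigr => j _.
    by rewrite -(nil_skew_minor _ _ ff fT nf) -{2}fT mxE expr2.
  move/eqP; rewrite -subr_eq0 -{1}[f i i]mulr1 -mulrBr mulf_eq0 => /orP[/eqP//|].
  by rewrite subr_eq0 eq_sym (negPf tr1).
apply/matrixP => i j; rewrite mxE; apply/eqP.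
by rewrite -sqrf_eq0 (nil_skew_minor _ _ ff fT nf) d0 mul0r.
Qed.

(** A column of [f], divided by a square root of its diagonal entry, gives a rank-one symmetric
    idempotent below [f]. The difference inherits the nilpotency and has trace 0, so it vanishes. *)
Lemma nil_skew_rank1 f : f * f = f -> f^T = f -> nil_skew f -> \tr f = 1 ->
  exists z : 'cV[C]_n.+1, f = z *m z^T.
Proof.
move=> ff fT nf tr1.
have [i fii] : exists i, f i i != 0.
  apply: contrapT => hn; have : \tr f = 0.
    apply: big1 => i _; apply: contrapT => /eqP hi; apply: hn; by exists i.
  by rewrite tr1 => /eqP; rewrite oner_eq0.
pose z : 'cV[C]_n.+1 := (sqrtC (f i i))^-1 *: (f *m delta_mx i 0).
pose f1 := z *m z^T.
have f1E : f1 = (f i i)^-1 *: (f * delta_mx i i * f).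
  rewrite /f1 /z linearZ /= -scalemxAl -scalemxAr scalerA -invfM -expr2 sqrtCK.
  congr (_ *: _); rewrite trmx_mul fT trmx_delta !mulmxA -(mulmxA f).
  by rewrite mul_delta_mx.
have ff1 : f * f1 = f1 by rewrite f1E -scalerAr !mulrA ff.
have f1f : f1 * f = f1 by rewrite f1E -scalerAl -!mulrA ff.
have f1f1 : f1 * f1 = f1.
  have E2 : (f * delta_mx i i * f) * (f * delta_mx i i * f) = f i i *: (f * delta_mx i i * f).
    rewrite !mulrA -[_ * f * f]mulrA ff -[f * _ * f]mulrA -[f * (_ * f) * _]mulrA.
    by rewrite delta_mul_delta -scalerAr -scalerAl mulrA.
  by rewrite f1E -scalerAl -scalerAr !scalerA E2 scalerA -mulrA mulVf // mulr1.
have f1T : f1^T = f1 by rewrite /f1 trmx_mul trmxK.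
have tr1' : \tr f1 = 1.
  rewrite f1E linearZ /= -mulrA mxtrace_mulC -mulmxA [f *m f]ff mulmxE.
  rewrite -mulmxE mxtrace_mulC /mxtrace (bigD1 i) //= big1 ?addr0.
    rewrite !mxE (bigD1 i) //= big1 ?addr0 ?mxE ?eqxx ?mulr1 ?mulVf // => j ji.
    by rewrite mxE (negPf ji) mulr0.
  move=> j ji; rewrite mxE big1 // => k _.
  by rewrite mxE (negPf ji) andbF mulr0.
exists z; rewrite -/f1; apply/eqP; rewrite -subr_eq0; apply/eqP.
have f'f : (f - f1) * f = f - f1 by rewrite mulrBl ff f1f.
have ff' : f * (f - f1) = f - f1 by rewrite mulrBr ff ff1.
apply: nil_skew_trace.
- by rewrite mulrBl !mulrBr ff ff1 f1f f1f1 subrr subr0.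
- by rewrite linearB /= fT f1T.
- move=> t tT; have [|m tm] := nf ((f - f1) * t * (f - f1)).
    by rewrite -!mulmxE !trmx_mul linearB /= fT f1T tT mulNmx mulmxN mulmxA.
  exists m; rewrite !mulrA ff' -!mulrA f'f !mulrA in tm.
  by rewrite -{3}ff' mulrA tm mul0r.
- by rewrite linearB /= tr1 tr1' subrr eq_sym oner_eq0.
Qed.

Lemma symmetric_nil_skew f : symmetric_proj f ->
  (forall y, y \in h -> exists m, y ^+ m * f = 0) -> nil_skew f.
Proof.
move=> sf fnil z zT; have [ff fT fh fd] := sf; apply: (fnil).
apply: (h_engel (W := fun w => exists2 z, z^T = - z & w = f * z * f)); last by exists z.
- move=> w [t tT ->]; split; last by rewrite -!mulrA fd !mulr0.
  by rewrite -!mulmxE !trmx_mul fT tT mulNmx mulmxN mulmxA.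
- move=> y w yh [t tT ->]; exists (ad y t); last by rewrite -(adML _ (fh y yh)) -(adMR _ (fh y yh)).
  by rewrite /ad linearB /= -!mulmxE !trmx_mul (hT yh) tT !(mulmxN, mulNmx) !opprK opprB.
- move=> y w yh [t tT ->]; have [m ym] := fnil y yh.
  exists (m + m)%N; apply: iter_ad_nil; first by rewrite !mulrA ym !mul0r.
  by rewrite -[_ * f * _]mulrA (commrX m (commr_sym (fh y yh))) ym mulr0.
Qed.

Hypothesis hdd : forall y, y \in h -> y * dd = 0.

Lemma isotropic_mem e : isotropic_proj e -> e - e^T \in h.
Proof.
move=> [ee _ eh [ed de]].
(* Here [W] is the centralizer of [h], to which [e - e^T] belongs. *)
apply: (h_engel (W := fun w => skew_dd w /\ forall y, y \in h -> ad y w = 0)).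
- by move=> w [].
- move=> y w yh [_ ->] //; split; last by move=> *; rewrite ad0.
  by split; rewrite ?trmx0 ?oppr0 ?mul0r.
- by move=> y w yh [_ w0]; exists 1%N; apply: w0.
split; first exact: mem_skew.
move=> y yh; apply: comm_ad0; apply: commrB; first exact: eh.
by apply: commT; [apply: hT | apply: eh].
Qed.

Lemma tr_rank1_pair uw : uw.2^T *m uw.1 = 1%:M -> \tr (rank1_pair uw) = 1.
Proof. by move=> h1; rewrite /rank1_pair mxtrace_mulC h1 mxtrace1. Qed.

Lemma symmetric_proj_dd : symmetric_proj (1 - dd).
Proof.
have d2 : dd * dd = dd by rewrite -mulmxE mul_delta_mx.
split.
- by rewrite !(mulrBl, mulrBr) !mul1r mulr1 d2 subrr subr0.
- by rewrite linearB /= trmx1 trmx_delta.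
- move=> y yh; apply: commrB; first exact: commr1.
  rewrite /GRing.comm hdd //; have /(congr1 trmx) := hdd yh.
  by rewrite -mulmxE trmx_mul trmx_delta hT // mulmxN trmx0 => /eqP; rewrite oppr_eq0 => /eqP.
- by rewrite mulrBl mul1r d2 subrr.
Qed.

Lemma cartan_split l : n = (2 * l).+1 ->
  exists (s : seq ('cV[C]_n.+1 * 'cV[C]_n.+1)) (z : 'cV[C]_n.+1),
  [/\ size s = l, symmetric_proj (z *m z^T),
      1 = dd + z *m z^T + \sum_(uw <- s) (rank1_pair uw + (rank1_pair uw)^T) &
      forall uw, uw \in s -> isotropic_proj (rank1_pair uw) /\ uw.2^T *m uw.1 = 1%:M].
Proof.
move=> nE; have [f0 [s [sf0 _ nil dE sP]]] := symmetric_split symmetric_proj_dd.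
have [ff fT _ _] := sf0; have nf := symmetric_nil_skew sf0 nil.
have tr0 : \tr f0 + (size s)%:R *+ 2 = (2 * l).+1%:R.
  have := congr1 mxtrace dE; rewrite !linearD /= linearN /= mxtrace1 linear_sum /=.
  rewrite (eq_big_seq (fun=> 2)); last first.
    move=> uw /sP[_ wu]; rewrite linearD /= mxtrace_tr tr_rank1_pair //.
  rewrite big_const_seq count_predT iter_addr_0 -mulrnA mulnC mulrnA => <-.
  have -> : \tr dd = 1.
    by rewrite /mxtrace (bigD1 ord_max) //= big1 ?mxE ?eqxx ?addr0 // => i io; rewrite mxE (negPf io).
  by rewrite mulrSr addrK nE.
(* If [\tr f0] is not 1, then [f0 = 0] and the trace is twice the number of pairs, whereas 2l+1 is
   odd. *)
have [tr1|/eqP tr1] := pselect (\tr f0 = 1); last first.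
  move: tr0; rewrite (nil_skew_trace ff fT nf tr1) mxtrace0 add0r -mulrnA => /eqP.
  by rewrite eqr_nat; lia.
have [z zE] := nil_skew_rank1 ff fT nf tr1; exists s, z; split=> //.
- move: tr0 => /eqP; rewrite tr1 -mulrnA nat1r eqr_nat; lia.
- by rewrite -zE.
- by rewrite -addrA -zE -dE addrC subrK.
Qed.

Definition frame_dual l (a : frame_index l) : frame_index l :=
  match a with inl (i, b) => inl (i, ~~ b) | inr b => inr b end.

Lemma frame_dualK l : involutive (@frame_dual l).
Proof. by case=> [[i b]|b] //=; rewrite negbK. Qed.

(** When [v a] is an eigenvector of [y], this is the eigenvalue, because [v (frame_dual a)] is dual
    to [v a]. The formula is visibly linear in [y]. *)
Definition frame_coef l (v : frame_index l -> 'cV[C]_n.+1) y a : C :=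
  ((v (frame_dual a))^T *m y *m v a) 0 0.

(* A hyperbolic basis: the isotropic vectors v (inl (i, false)) and v (inl (i, true))
   are paired with each other, v (inr false) spans the zero weight space of the
   (2l+1)-dimensional representation, and v (inr true) is the last coordinate vector. *)
Definition is_frame l (v : frame_index l -> 'cV[C]_n.+1) :=
  [/\ v (inr true) = delta_mx ord_max 0,
      forall a b, (v a)^T *m v b = (b == frame_dual a)%:R%:M
    & \sum_a v a *m (v (frame_dual a))^T = 1%:M].

Lemma cartan_frame l : n = (2 * l).+1 ->
  exists v : frame_index l -> 'cV[C]_n.+1,
  [/\ is_frame v,
      forall i, v (inl (i, false)) *m (v (inl (i, true)))^T
              - v (inl (i, true)) *m (v (inl (i, false)))^T \in h &
      forall y a, y \in h -> y *m v a = frame_coef v y a *: v a].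
Proof.
move=> nE; have [s [z [ls sz oneE sP]]] := cartan_split nE.
have sz' : size s == l by apply/eqP.
pose t i := tnth (Tuple sz') i.
have tP i : isotropic_proj (rank1_pair (t i)) /\ (t i).2^T *m (t i).1 = 1%:M.
  by apply: sP; apply: (mem_tnth i (Tuple sz')).
pose v (a : frame_index l) : 'cV[C]_n.+1 := match a with
  | inl (i, b) => if b then (t i).2 else (t i).1
  | inr b => if b then delta_mx ord_max 0 else z end.
have comp : \sum_a v a *m (v (frame_dual a))^T = 1%:M.
  rewrite [RHS]oneE sum_frame_index /= trmx_delta mul_delta_mx; congr (_ + _).
  rewrite -[s]/(tval (Tuple sz')) big_tuple; apply: eq_bigr => i _.
  by rewrite addrC /rank1_pair trmx_mul trmxK.
have card : #|{: frame_index l}| = n.+1.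
  by rewrite card_sum card_prod card_ord card_bool; lia.
(* Completeness reads [V *m W = 1%:M] for square matrices formed by the vectors and their duals;
   orthogonality is [W *m V = 1%:M]. *)
have orth a b : (v a)^T *m v b = (b == frame_dual a)%:R%:M.
  pose phi (j : 'I_n.+1) : frame_index l := enum_val (cast_ord (esym card) j).
  have phiE a' : phi (cast_ord card (enum_rank a')) = a'.
    by rewrite /phi cast_ordK enum_rankK.
  have phiI : injective phi.
    by move=> i j /enum_val_inj /cast_ord_inj.
  pose V : 'M[C]_n.+1 := \matrix_(i, j) v (phi j) i 0.
  pose W : 'M[C]_n.+1 := \matrix_(j, i) v (frame_dual (phi j)) i 0.
  have VW : V *m W = 1%:M.
    rewrite -comp; apply/matrixP => i j; rewrite mxE summxE.
    rewrite (reindex phi) /=; last first.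
      by apply: onW_bij; exists (fun a' => cast_ord card (enum_rank a')) => // k; apply: phiI; rewrite phiE.
    by apply: eq_bigr => k _; rewrite !mxE big_ord1 !mxE.
  have WV := mulmx1C VW.
  pose j := cast_ord card (enum_rank (frame_dual a)).
  pose k := cast_ord card (enum_rank b).
  have /matrixP/(_ j k) := WV; rewrite !mxE => WVjk.
  apply/matrixP => x x'; rewrite !ord1 !mxE eqxx mulr1n.
  rewrite -[in RHS](phiE b) -[in RHS](phiE (frame_dual a)) -/j -/k.
  rewrite (inj_eq phiI) eq_sym -WVjk; apply: eq_bigr => i _.
  by rewrite !mxE /j /k !phiE frame_dualK.
exists v; split; first by split.
  by move=> i; have := isotropic_mem (tP i).1; rewrite /rank1_pair trmx_mul trmxK.
move=> y a yh.
have [_ _ dh _] := symmetric_proj_dd.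
(* This product is the rank-one projection onto the line of [v a]; whatever commutes with it has
   [v a] as an eigenvector. *)
have cm : GRing.comm y (v a *m (v (frame_dual a))^T).
  case: a => [[i []]|[]] /=.
  - have [[_ _ eh _] _] := tP i.
    by have := commT (hT yh) (eh y yh); rewrite trmx_mul trmxK.
  - by have [[_ _ eh _] _] := tP i; exact: eh.
  - rewrite trmx_delta mul_delta_mx.
    have -> : dd = 1 - (1 - dd) by rewrite opprB addrCA subrr addr0.
    by apply: commrB; [apply: commr1 | apply: dh].
  - by have [_ _ fh _] := sz; exact: fh.
have va : v a = v a *m (v (frame_dual a))^T *m v a.
  by rewrite -mulmxA orth frame_dualK eqxx mulmx1.
have cm' : y *m (v a *m (v (frame_dual a))^T) = v a *m (v (frame_dual a))^T *m y by exact: cm.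
have c1 : (v (frame_dual a))^T *m y *m v a = (frame_coef v y a)%:M by rewrite [LHS]mx11_scalar.
by rewrite {1}va mulmxA cm' -!mulmxA [_^T *m (y *m _)]mulmxA c1 mul_mx_scalar.
Qed.

End CartanFrame.

(** * Weights of a diagonal torus *)

Section FrameWeights.
Variables (C : numClosedFieldType) (n l : nat).
Local Notation M := 'M[C]_n.+1.
Implicit Types (x y : M) (p q : bool).

(** Membership in a graded piece in terms of the parities of the degrees. For even [p] the condition
    that -x^T equals x makes [x] skew, whence the sign with [~~ p]. *)
Definition bigraded p q x :=
  [/\ \tr x = 0, x^T = (-1) ^+ (~~ p) *: x
    & forall i j, x i j != 0 -> (i == ord_max) (+) (j == ord_max) = q].

Variables (h : {pred M}) (v : frame_index l -> 'cV[C]_n.+1).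
Hypothesis hT : forall y, y \in h -> y^T = - y.
Hypothesis frame_v : is_frame v.
Hypothesis eigen_v : forall y a, y \in h -> y *m v a = frame_coef v y a *: v a.
Local Notation mu := (frame_coef v).

(* The pairs for which v_c v_d^T + (-1)^(p+1) v_d v_c^T is a nonzero element of
   bidegree (p, q), up to its trace. *)
Definition allowed p q (c d : frame_index l) :=
  (((c == inr true) (+) (d == inr true)) == q) && (p || (c != d)).

Lemma bilin_trmx (w u : 'cV[C]_n.+1) y :
  (w^T *m y *m u) 0 0 = (u^T *m y^T *m w) 0 0.
Proof.
transitivity ((w^T *m y *m u)^T 0 0); first by rewrite [RHS]mxE.
by rewrite !trmx_mul trmxK mulmxA.
Qed.

Lemma frame_coef_dual y a : y^T = - y -> mu y (frame_dual a) = - mu y a.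
Proof.
move=> yT; rewrite /frame_coef frame_dualK.
by rewrite bilin_trmx yT mulmxN mulNmx mxE.
Qed.

Lemma eigen_vT y a : y \in h -> (v a)^T *m y = - mu y a *: (v a)^T.
Proof.
move=> yh; have := congr1 trmx (eigen_v a yh).
rewrite trmx_mul linearZ /= hT // mulmxN => /eqP.
by rewrite eqr_oppLR => /eqP ->; rewrite scaleNr.
Qed.

Lemma frame_support c i : v c i 0 != 0 -> (i == ord_max) = (c == inr true).
Proof.
have [vd orth _] := frame_v; have [->|cm] := eqVneq c (inr true).
  by rewrite vd mxE; case: (i == _) => //=; rewrite mulr0n eqxx.
apply: contraNF => /eqP ->; have /matrixP/(_ 0 0) := orth (inr true) c.
rewrite (negPf cm) vd trmx_delta -rowE !mxE mul0rn => ->.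
exact: eqxx.
Qed.

Lemma frame_neq0 c : v c != 0.
Proof.
have [_ orth _] := frame_v; apply/eqP => v0; have /matrixP/(_ 0 0) := orth (frame_dual c) c.
rewrite v0 mulmx0 frame_dualK eqxx !mxE eqxx => /eqP.
by rewrite eq_sym oner_eq0.
Qed.

Lemma frame_entry_neq0 x : x != 0 -> exists c d, ((v c)^T *m x *m v d) 0 0 != 0.
Proof.
move=> x0; apply: contrapT => hn; move/negP: x0; apply; apply/eqP.
have [_ _ comp] := frame_v.
have z c d : (v c)^T *m x *m v d = 0.
  rewrite [LHS]mx11_scalar; apply: contrapT => cd; apply: hn; exists c, d.
  by apply/eqP => e0; apply: cd; rewrite e0 raddf0.
have zr c : (v c)^T *m x = 0.
  rewrite -[LHS]mulmx1 -comp mulmx_sumr big1 // => a _.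
  by rewrite mulmxA z mul0mx.
rewrite -[LHS]mul1mx -comp (reindex_inj (inv_inj (@frame_dualK l))) mulmx_suml big1 // => a _.
by rewrite frame_dualK -mulmxA zr mulmx0.
Qed.

(** Between [v c] and [v d] the commutator with [y] multiplies the entry of [x] by
    [- mu y c - mu y d]; a nonzero entry thus determines the weight, the sign being absorbed in the
    dual labels. A skew [x] has no entry with [c = d]. *)
Lemma weight_allowed p q x (alpha : M -> C) : bigraded p q x -> x != 0 ->
  (forall y, y \in h -> ad y x = alpha y *: x) ->
  exists c d, allowed p q c d /\ forall y, y \in h -> alpha y = mu y c + mu y d.
Proof.
move=> [_ xT xs] x0 xw; have [c [d cd]] := frame_entry_neq0 x0.
exists (frame_dual c), (frame_dual d); split; last first.
  move=> y yh; rewrite !frame_coef_dual ?hT //.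
  pose T := (v c)^T *m x *m v d.
  have h1 : (v c)^T *m (y * x) *m v d = - mu y c *: T.
    by rewrite -[y * x]/(y *m x) mulmxA eigen_vT // -!scalemxAl.
  have h2 : (v c)^T *m (x * y) *m v d = mu y d *: T.
    by rewrite -[x * y]/(x *m y) -!mulmxA eigen_v // -!scalemxAr /T mulmxA.
  have := congr1 (fun t => ((v c)^T *m t *m v d) 0 0) (xw y yh).
  rewrite /ad mulmxBr mulmxBl h1 h2 -scalerBl -scalemxAr -scalemxAl -/T.
  by rewrite [LHS]mxE [RHS]mxE => /(mulIf cd) <-.
have dualm e : (frame_dual e == inr true) = (e == inr true) by case: e => [[]|].
rewrite /allowed !dualm (inj_eq (inv_inj (@frame_dualK l))); apply/andP; split.
  move: cd; rewrite mxE => cd.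
  have [j] : exists j, ((v c)^T *m x) 0 j * v d j 0 != 0.
    apply: contrapT => hn; move/negP: cd; apply; apply/eqP; apply: big1 => j _.
    by apply: contrapT => /eqP jn; apply: hn; exists j.
  rewrite mulf_eq0 negb_or mxE => /andP[ci dj].
  have [k] : exists k, (v c)^T 0 k * x k j != 0.
    apply: contrapT => hn; move/negP: ci; apply; apply/eqP; apply: big1 => k _.
    by apply: contrapT => /eqP jn; apply: hn; exists k.
  rewrite mulf_eq0 negb_or mxE => /andP[ci' xkj].
  by rewrite -(frame_support ci') -(frame_support dj); apply/eqP/xs.
case: p xT => //= xT; apply: contra cd => /eqP cd; rewrite -cd.
have := bilin_trmx (v c) (v c) x.
rewrite xT expr1 scaleN1r mulmxN mulNmx [RHS]mxE => /eqP.
by rewrite -subr_eq0 opprK -mulr2n mulrn_eq0.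
Qed.

(** The excluded pairs of dual labels have weight zero; for all others the trace vanishes by
    orthogonality. *)
Lemma allowed_weight p q c d : allowed p q c d -> d != frame_dual c ->
  exists x, [/\ bigraded p q x, x != 0 &
    forall y, y \in h -> ad y x = (mu y c + mu y d) *: x].
Proof.
move=> /andP[/eqP qE pcd] dc; have [_ orth _] := frame_v.
pose s : C := (-1) ^+ (~~ p).
exists (v c *m (v d)^T + s *: (v d *m (v c)^T)); split.
- have tr a b : b != frame_dual a -> \tr (v a *m (v b)^T) = 0.
    move=> ba; rewrite mxtrace_mulC orth.
    suff -> : (a == frame_dual b) = false by rewrite raddf0 mxtrace0.
    by apply: contraNF ba => /eqP ->; rewrite frame_dualK.
  split.
  + rewrite linearD linearZ /= !tr ?mulr0 ?addr0 //.
    by apply: contra dc => /eqP->; rewrite frame_dualK.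
  + rewrite linearD linearZ /= !trmx_mul !trmxK scalerDr scalerA -expr2 sqrr_sign scale1r.
    exact: addrC.
  + move=> i j; rewrite !mxE !big_ord1 !mxE => nz.
    have [ij|] := eqVneq (v c i 0 * v d j 0) 0.
      move: nz; rewrite ij add0r !mulf_eq0 !negb_or => /andP[_ /andP[di cj]].
      by rewrite (frame_support di) (frame_support cj) addbC.
    rewrite mulf_eq0 negb_or => /andP[ci dj].
    by rewrite (frame_support ci) (frame_support dj).
- apply/eqP => /(congr1 (fun t => t *m v (frame_dual d))).
  rewrite mul0mx mulmxDl -scalemxAl -!mulmxA !orth eqxx mulmx1.
  rewrite (inj_eq (inv_inj (@frame_dualK l))).
  have [dE|ndc] := eqVneq d c.
    move: pcd; rewrite /s dE eqxx orbF => -> /=; rewrite mulmx1 scale1r => /eqP.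
    rewrite -mulr2n -scaler_nat scaler_eq0 pnatr_eq0 /=.
    exact/negP/frame_neq0.
  rewrite raddf0 mulmx0 scaler0 addr0 => /eqP.
  exact/negP/frame_neq0.
move=> y yh; rewrite /ad -[y * _]/(y *m _) -[_ * y]/(_ *m y).
rewrite mulmxDr mulmxDl -scalemxAl -scalemxAr !mulmxA !eigen_v //.
rewrite -!mulmxA !eigen_vT // -!scalemxAl -!scalemxAr scalerDr !scalerA.
by apply/matrixP => i j; rewrite !mxE; ring.
Qed.

Definition frame_weight (a : frame_index l) : 'rV[C]_l :=
  match a with inl (i, b) => (-1) ^+ b *: delta_mx 0 i | inr _ => 0 end.

Lemma frame_coef_inr y b : y \in h -> mu y (inr b) = 0.
Proof.
move=> yh; have := @frame_coef_dual y (inr b) (hT yh) => /= /eqP.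
by rewrite -subr_eq0 opprK -mulr2n mulrn_eq0 => /eqP.
Qed.

Lemma frame_coefE y a : y \in h ->
  mu y a = \sum_i frame_weight a 0 i * mu y (inl (i, false)).
Proof.
move=> yh; case: a => [[i b]|b]; last first.
  by rewrite frame_coef_inr // big1 // => i _; rewrite mxE mul0r.
rewrite (bigD1 i) //= big1 ?addr0 => [|j ji]; rewrite !mxE !eqxx.
  case: b; rewrite mulr1 ?mul1r //= mulN1r.
  by rewrite -(frame_coef_dual _ (hT yh)).
by rewrite (negPf ji) mulr0 mul0r.
Qed.

Definition frame_torus (i : 'I_l) : M :=
  v (inl (i, false)) *m (v (inl (i, true)))^T - v (inl (i, true)) *m (v (inl (i, false)))^T.

Lemma frame_torus_coef i j : mu (frame_torus i) (inl (j, false)) = (i == j)%:R.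
Proof.
have [_ orth _] := frame_v.
rewrite /frame_coef /frame_torus /= mulmxBr mulmxBl !mulmxA orth -[_ *m _ *m v _]mulmxA orth /=.
rewrite [X in _ - X]( _ : _ = 0); last first.
  rewrite orth.
  have -> : (inl (i, true) == frame_dual (inl (j, true)) :> frame_index l) = false.
    by rewrite /= /eq_op /= /eq_op /= andbF.
  by rewrite raddf0 !mul0mx.
rewrite subr0 -scalar_mxM mxE eqxx mulr1n -natrM mulnb.
rewrite /eq_op /= /eq_op /= !andbT.
by rewrite -[(j == i)]eq_sym andbb.
Qed.

(** Multiply the completeness relation of the frame by [y]. It follows that the elements
    [frame_torus i] span [h], with no separate dimension count. *)
Lemma frame_torus_sum y : y \in h ->
  y = \sum_i mu y (inl (i, false)) *: frame_torus i.
Proof.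
move=> yh; have [_ _ comp] := frame_v.
rewrite -[LHS]mulmx1 -comp mulmx_sumr sum_frame_index !mulmxA !eigen_v //.
rewrite !frame_coef_inr // !scale0r !mul0mx !add0r; apply: eq_bigr => i _.
rewrite !mulmxA !eigen_v // -[inl (i, true)]/(frame_dual (inl (i, false))).
rewrite frame_coef_dual ?hT // /= /frame_torus scalerBr -!scalemxAl scaleNr addrC.
by [].
Qed.

End FrameWeights.

(** * Submodules of spaces of matrices *)

Section Sieve.
Variables (C : numClosedFieldType) (n : nat).
Local Notation M := 'M[C]_n.+1.
Implicit Types (x y : M) (i j k r s : 'I_n.+1).

Definition rot i j : M := delta_mx i j - delta_mx j i.

Lemma delta_mulE i j k r : (delta_mx i j : M) * delta_mx k r = (j == k)%:R *: delta_mx i r.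
Proof.
have [->|jk] := eqVneq j k; first by rewrite -mulmxE mul_delta_mx scale1r.
by rewrite -mulmxE mul_delta_mx_0 // scale0r.
Qed.

Lemma ad2E (f e x : M) : f * f = - e ->
  ad f (ad f x) = - (e * x) - x * e - 2 *: (f * x * f).
Proof.
move=> ff; rewrite /ad !(mulrBl, mulrBr) !mulrA ff -[x * f * f]mulrA ff mulNr mulrN.
by apply/matrixP => i j; rewrite !mxE; ring.
Qed.

(** The polynomial t^4 + 4 t^2 vanishes at the eigenvalues 0 and +-2i of [ad f] and takes the value
    -3 at +-i. The right-hand side is -3 times the projection onto the part of [x] with [e] on
    exactly one side. *)
Lemma ad4E (f e x : M) : f * f = - e -> f * e = f -> e * f = f -> e * e = e ->
  ad f (ad f (ad f (ad f x))) + 4 *: ad f (ad f x)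
    = - 3 *: (e * x + x * e - 2 *: (e * x * e)).
Proof.
move=> ff fe ef ee; rewrite !(ad2E _ ff); set y := (f * x * f); set z := e * x * e.
have h1 : e * (- (e * x) - x * e - 2 *: y) = - (e * x) - z - 2 *: y.
  by rewrite !mulrBr mulrN !mulrA ee -scalerAr /y !mulrA ef.
have h2 : (- (e * x) - x * e - 2 *: y) * e = - z - x * e - 2 *: y.
  by rewrite !mulrBl mulNr -[x * e * e]mulrA ee -scalerAl /y -[_ * f * e]mulrA fe.
have h3 : f * (- (e * x) - x * e - 2 *: y) * f = - y - y - 2 *: z.
  rewrite !(mulrBr, mulrBl) mulrN mulNr -scalerAr -scalerAl /y !mulrA fe.
  by rewrite -[f * x * e * f]mulrA ef ff mulNr -[_ * f * f]mulrA ff mulrN mulNr opprK.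
rewrite h1 h2 h3; apply/matrixP => i j; rewrite !mxE.
by move: (z i j) (y i j) ((e * x) i j) ((x * e) i j) => a b c d; rewrite /GRing.scale /=; ring.
Qed.

Lemma rot_sqr i j : i != j -> rot i j * rot i j = - (delta_mx i i + delta_mx j j).
Proof.
move=> ij; rewrite /rot !(mulrBl, mulrBr) !delta_mulE !eqxx [j == i]eq_sym (negPf ij).
by rewrite !scale0r !scale1r sub0r subr0 opprD.
Qed.

Definition crosses i j r s := ((r == i) || (r == j)) (+) ((s == i) || (s == j)).

Definition sieve i j x : M := \matrix_(r, s) (x r s *+ crosses i j r s).

(* On matrix units, [ad (rot i j)] has eigenvalues +-i exactly on the entries with
   one index in {i, j}, and 0 or +-2i on the others. *)
Lemma sieveE i j x : i != j ->
  sieve i j x = (- 3)^-1 *: (iter 4 (ad (rot i j)) x + 4 *: iter 2 (ad (rot i j)) x).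
Proof.
move=> ij; pose e : M := delta_mx i i + delta_mx j j.
have fe : rot i j * e = rot i j.
  rewrite /rot /e !(mulrBl, mulrDr) !delta_mulE !eqxx (negPf ij) [j == i]eq_sym (negPf ij).
  by rewrite !scale0r !scale1r addr0 add0r.
have ef : e * rot i j = rot i j.
  rewrite /rot /e !(mulrBr, mulrDl) !delta_mulE !eqxx (negPf ij) [j == i]eq_sym (negPf ij).
  by rewrite !scale0r !scale1r addr0 add0r.
have ee : e * e = e.
  rewrite /e !(mulrDr, mulrDl) !delta_mulE !eqxx (negPf ij) [j == i]eq_sym (negPf ij).
  by rewrite !scale0r !scale1r addr0 add0r.
rewrite /= (ad4E _ (rot_sqr ij) fe ef ee) -/e scalerA mulVf ?scale1r; last first.
  by rewrite oppr_eq0 pnatr_eq0.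
have dl k y r s : ((delta_mx k k : M) * y) r s = (r == k)%:R * y r s.
  rewrite -mulmxE mxE (bigD1 k) //= big1 => [|t tk]; first by rewrite mxE eqxx andbT addr0; case: eqP => [->|] //; rewrite !mul0r.
  by rewrite mxE (negPf tk) andbF mul0r.
have dr k y r s : (y * (delta_mx k k : M)) r s = (s == k)%:R * y r s.
  rewrite -mulmxE mxE (bigD1 k) //= big1 => [|t tk]; first by rewrite mxE eqxx addr0 mulrC; case: eqP => [->|] //; rewrite !mul0r.
  by rewrite mxE (negPf tk) mulr0.
have el y r s : (e * y) r s = ((r == i) || (r == j))%:R * y r s.
  rewrite mulrDl mxE !dl -mulrDl; congr (_ * _).
  by have [->|ri] := eqVneq r i; rewrite ?(negPf ij) ?addr0 ?add0r.
have er y r s : (y * e) r s = ((s == i) || (s == j))%:R * y r s.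
  rewrite mulrDr mxE !dr -mulrDl; congr (_ * _).
  by have [->|ri] := eqVneq s i; rewrite ?(negPf ij) ?addr0 ?add0r.
apply/matrixP => r s; rewrite /sieve /crosses mxE mxE [X in X + _]mxE el er mxE mxE er el.
case: (_ || _); case: (_ || _) => /=; rewrite ?mulr1n ?mulr0n; ring.
Qed.

Lemma sieve_ad2 i j x : i != j -> ad (rot i j) (ad (rot i j) x) = 0 -> sieve i j x = 0.
Proof. by move=> ij h; rewrite sieveE //= h !ad0 !scaler0 addr0 scaler0. Qed.

Let neqF (a b : 'I_n.+1) : a != b -> ((a == b) = false) * ((b == a) = false).
Proof. by move=> ab; rewrite [b == a]eq_sym (negPf ab). Qed.

Lemma rot_rot a b c : a != b -> a != c -> b != c ->
  ad (rot a b) (rot b c) = rot a c.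
Proof.
move=> ab ac bc; rewrite /ad /rot !(mulrBl, mulrBr).
by rewrite !(delta_mulE, eqxx, scale0r, scale1r, scaler0, (subr0, sub0r, addr0, add0r, opprK, oppr0), neqF ab, neqF ac, neqF bc).
Qed.

Definition sym_unit a b : M := delta_mx a b + delta_mx b a.

Lemma rot_sym_unit a b c : a != b -> a != c -> b != c ->
  ad (rot a b) (sym_unit b c) = sym_unit a c.
Proof.
move=> ab ac bc; rewrite /ad /rot /sym_unit !(mulrDl, mulrDr, mulrBl, mulrBr, mulrN, mulNr).
by rewrite !(delta_mulE, eqxx, scale0r, scale1r, scaler0, (subr0, sub0r, addr0, add0r, opprK, oppr0), neqF ab, neqF ac, neqF bc).
Qed.

Lemma rot_sym_unit_diag a b : a != b ->
  ad (rot a b) (sym_unit a b) = 2 *: (delta_mx a a - delta_mx b b).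
Proof.
move=> ab; rewrite /ad /rot /sym_unit !(mulrDl, mulrDr, mulrBl, mulrBr, mulrN, mulNr).
rewrite !(delta_mulE, eqxx, scale0r, scale1r, scaler0, (subr0, sub0r, addr0, add0r, opprK, oppr0), neqF ab).
by apply/matrixP => i j; rewrite !mxE; ring.
Qed.

Lemma rot_diag a b x : (forall i j, i != j -> x i j = 0) ->
  ad (rot a b) x = (x b b - x a a) *: sym_unit a b.
Proof.
move=> xd.
have xl i j : (x * delta_mx i j : M) = x i i *: delta_mx i j.
  apply/matrixP => r s; rewrite -mulmxE !mxE (bigD1 i) //= big1 => [|k ki].
    rewrite mxE eqxx addr0; have [->|ri] := eqVneq r i; first by [].
    by rewrite xd // mul0r mulr0.
  by rewrite mxE (negPf ki) mulr0.
have xr i j : (delta_mx i j * x : M) = x j j *: delta_mx i j.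
  apply/matrixP => r s; rewrite -mulmxE !mxE (bigD1 j) //= big1 => [|k kj].
    rewrite mxE eqxx addr0 andbT; have [->|sj] := eqVneq s j; first by rewrite andbT mulrC.
    by rewrite xd 1?eq_sym // mulr0 andbF mulr0.
  by rewrite mxE (negPf kj) andbF mul0r.
rewrite /ad /rot mulrBl mulrBr !xl !xr /sym_unit.
by apply/matrixP => r s; rewrite !mxE; ring.
Qed.

Lemma rot_col_unit a b m (c : C) : a != b -> a != m -> b != m ->
  ad (rot b a) (delta_mx a m + c *: delta_mx m a) = delta_mx b m + c *: delta_mx m b.
Proof.
move=> ab am bm; rewrite /ad /rot !(mulrDl, mulrDr, mulrBl, mulrBr, mulrN, mulNr) -!scalerAl -!scalerAr.
by rewrite !(delta_mulE, eqxx, scale0r, scale1r, scaler0, scalerN, (subr0, sub0r, addr0, add0r, opprK, oppr0), neqF ab, neqF am, neqF bm).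
Qed.

End Sieve.

Section StableSubspaces.
Variables (C : numClosedFieldType) (l : nat).
Hypothesis l_gt0 : (0 < l)%N.
Local Notation n := (2 * l).+1.
Local Notation M := 'M[C]_n.+1.
Local Notation om := (ord_max : 'I_n.+1).
Implicit Types (x y : M) (i j k r s a b c : 'I_n.+1).

Lemma ex_third a b : exists c, [/\ c != om, c != a & c != b].
Proof.
have [c] : exists c, c \notin [:: om; a; b].
  apply: contrapT => hn.
  have E : #|[:: om; a; b]| = #|'I_n.+1|.
    apply: eq_card => c; rewrite [RHS]inE.
    by apply: contrapT => /negP hc; apply: hn; exists c.
  by have := card_size [:: om; a; b]; rewrite E card_ord /=; move: l_gt0; lia.
by rewrite !inE !negb_or => /and3P[? ? ?]; exists c.
Qed.

(** Five distinct indices cannot exhaust a set of 2l+2 elements, an even number. *)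
Lemma small_not4 a b r s : uniq [:: om; a; b; r; s] -> exists c, c \notin [:: om; a; b; r; s].
Proof.
move=> u; apply: contrapT => hn.
have : #|'I_n.+1| = size [:: om; a; b; r; s].
  rewrite -(card_uniqP u); apply: eq_card => c; rewrite inE.
  by apply/esym; apply: contrapT => /negP hc; apply: hn; exists c.
by rewrite card_ord /=; lia.
Qed.

Variable V : {vspace M}.
Hypothesis V_stable : forall i j x, i != om -> j != om -> i != j -> x \in V ->
  ad (rot C i j) x \in V.

Lemma sieve_mem i j x : i != om -> j != om -> i != j -> x \in V -> sieve i j x \in V.
Proof.
move=> io jo ij xV; rewrite sieveE //=.
have st := V_stable io jo ij.
by rewrite memvZ // memvD ?memvZ // !st.
Qed.

Lemma sieves_mem ps x : (forall p, p \in ps -> [/\ p.1 != om, p.2 != om & p.1 != p.2]) ->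
  x \in V ->
  (\matrix_(r, s) (x r s *+ all (fun p => crosses p.1 p.2 r s) ps) : M) \in V.
Proof.
move=> + xV; elim: ps => [|[i j] ps IH] ps_ok.
  rewrite (_ : \matrix_(r, s) _ = x) //; apply/matrixP => r s.
  by rewrite mxE mulr1n.
have [io jo ij] := ps_ok (i, j) (mem_head _ _).
rewrite (_ : \matrix_(r, s) _ = sieve i j (\matrix_(r, s) (x r s *+ all (fun p => crosses p.1 p.2 r s) ps))).
  by apply: sieve_mem => //; apply: IH => p pps; apply: ps_ok; rewrite inE pps orbT.
apply/matrixP => r s; rewrite !mxE /=.
by case: (crosses i j r s); rewrite ?mulr1n ?mulr0n.
Qed.

(** The whole last row and column vanish, including the last diagonal entry, which an even second
    degree alone would allow. *)
Definition even_support x := forall r s, x r s != 0 -> r != om /\ s != om.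
Definition odd_support x := forall r s, x r s != 0 -> (r == om) (+) (s == om).

Lemma unit_pairE a b x r s : a != b ->
  (x a b *: delta_mx a b + x b a *: delta_mx b a : M) r s =
  x r s *+ (((r == a) && (s == b)) || ((r == b) && (s == a))).
Proof.
move=> ab; rewrite !mxE.
have [/andP[/eqP-> /eqP->]|_] := boolP ((r == a) && (s == b)).
  by rewrite (negPf ab) /= mulr0 addr0 mulr1 mulr1n.
have [/andP[/eqP-> /eqP->]|_] := boolP ((r == b) && (s == a)).
  by rewrite mulr0 add0r mulr1 mulr1n.
by rewrite !mulr0 addr0 mulr0n.
Qed.

(* If n were 4, the sieves would also leave the pair complementary to {a, b}; n is odd. *)
Lemma isolate_even a b x : a != om -> b != om -> a != b -> even_support x -> x \in V ->
  x a b *: delta_mx a b + x b a *: delta_mx b a \in V.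
Proof.
move=> ao bo ab xe xV; have [c [co ca cb]] := ex_third a b.
pose K := [seq k <- enum 'I_n.+1 | [&& k != om, k != a & k != b]].
(* Besides {a, b}, the sieves (a, k) leave only pairs that avoid [a] and cover every [k] in [K]. If
   such a pair contains [b], it is {b, c}, which the sieve (b, c) removes; otherwise there would be
   five indices in all. *)
pose ps := (b, c) :: [seq (a, k) | k <- K].
have ps_ok p : p \in ps -> [/\ p.1 != om, p.2 != om & p.1 != p.2].
  rewrite inE => /predU1P[->|/mapP[k]]; first by split; rewrite //= eq_sym.
  by rewrite mem_filter => /andP[/and3P[ko ka kb] _] ->; split; rewrite //= eq_sym.
have KP k : k != om -> k != a -> k != b -> k \in K.
  by move=> ko ka kb; rewrite mem_filter ko ka kb mem_enum.
have := sieves_mem ps_ok xV; congr (_ \in V); apply/matrixP => r s.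
rewrite unit_pairE // mxE.
have [->|/xe[ro so]] := eqVneq (x r s) 0; first by rewrite !mul0rn.
congr (_ *+ nat_of_bool _).
apply/allP/idP => [H|].
  have Hk k : k != om -> k != a -> k != b -> crosses a k r s.
    by move=> ko ka kb; apply: (H (a, k)); rewrite inE; apply/orP; right; apply: map_f; apply: KP.
  have Hc : crosses b c r s by apply: (H (b, c)); rewrite mem_head.
  have Hac := Hk c co ca cb.
  have [ra|ra] := eqVneq r a.
    have [//|sb] := eqVneq s b; have [sa|sa] := eqVneq s a.
      by move: Hac; rewrite /crosses ra sa eqxx.
    by have := Hk s so sa sb; rewrite /crosses ra !eqxx orbT.
  have [sa|sa] := eqVneq s a.
    have [rb|rb] := eqVneq r b; first by rewrite orbT.
    by have := Hk r ro ra rb; rewrite /crosses sa !eqxx orbT.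
  have Hk' k : k != om -> k != a -> k != b -> (r == k) (+) (s == k).
    by move=> ko ka kb; have := Hk k ko ka kb; rewrite /crosses (negPf ra) (negPf sa).
  have Hc' := Hk' c co ca cb.
  have [rb|rb] := eqVneq r b.
    move: Hc' Hc; rewrite /crosses rb eqxx /= eq_sym (negPf cb) /= => /eqP->.
    by rewrite eqxx orbT.
  have [sb|sb] := eqVneq s b.
    move: Hc' Hc; rewrite /crosses sb eqxx /= [b == c]eq_sym (negPf cb) addbF => /eqP->.
    by rewrite eqxx orbT.
  have rs : r != s by apply/eqP => rs; move: Hc'; rewrite rs addbb.
  have [|d] := @small_not4 a b r s.
    by rewrite /= !inE !negb_or rs ![om == _]eq_sym ao bo ro so ab ![a == _]eq_sym ra sa ![b == _]eq_sym rb sb.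
  rewrite !inE !negb_or => /and5P[d1 d2 d3 d4 d5].
  by have := Hk' d d1 d2 d3; rewrite ![_ == d]eq_sym (negPf d4) (negPf d5).
move=> rs p; rewrite inE => /predU1P[->|/mapP[k]] /=.
  rewrite /crosses; move: rs => /orP[]/andP[/eqP-> /eqP->]; rewrite eqxx (negPf ab) /=;
  by rewrite [a == c]eq_sym (negPf ca).
rewrite mem_filter => /andP[/and3P[ko ka kb] _] -> /=.
rewrite /crosses; move: rs => /orP[]/andP[/eqP-> /eqP->]; rewrite eqxx [b == a]eq_sym (negPf ab) /=;
by rewrite [b == k]eq_sym (negPf kb).
Qed.

(** An entry with one index [om] passes the sieve {a, k} only if its other index is [a] or [k]; two
    choices of [k] leave [a]. *)
Lemma isolate_odd a x : a != om -> odd_support x -> x \in V ->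
  x a om *: delta_mx a om + x om a *: delta_mx om a \in V.
Proof.
move=> ao xo xV; have [k [ko ka _]] := ex_third a a.
have [k' [k'o k'a k'k]] := ex_third a k.
have ps_ok p : p \in [:: (a, k); (a, k')] -> [/\ p.1 != om, p.2 != om & p.1 != p.2].
  by rewrite !inE => /orP[]/eqP->; split; rewrite //= eq_sym.
have := sieves_mem ps_ok xV; congr (_ \in V); apply/matrixP => r s.
rewrite unit_pairE // mxE /=.
have oF : ((om == a) = false) * ((om == k) = false) * ((om == k') = false).
  by rewrite ![om == _]eq_sym (negPf ao) (negPf ko) (negPf k'o).
have E t : ((t == a) || (t == k)) && (((t == a) || (t == k')) && true) = (t == a).
  rewrite andbT -orb_andr; case: (t == a) => //=.
  by apply/negP => /andP[/eqP-> ]; rewrite eq_sym (negPf k'k).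
have [->|/xo] := eqVneq (x r s) 0; first by rewrite !mul0rn.
have [->|rm] := eqVneq r om; have [->|sm] := eqVneq s om; rewrite //= => _.
  by congr (_ *+ nat_of_bool _); rewrite /crosses !oF /= E.
by congr (_ *+ nat_of_bool _); rewrite /crosses !oF /= !addbF E andbT orbF.
Qed.

Lemma exists_entry x : x != 0 -> exists r s, x r s != 0.
Proof.
move=> x0; apply: contrapT => hn; move/negP: x0; apply; apply/eqP/matrixP => r s.
by rewrite mxE; apply: contrapT => /eqP rs; apply: hn; exists r, s.
Qed.

(** Moving one end at a time: (a, b) to (a, a'), swapped to (a', a), then to (a', b'). *)
Lemma spread_pairs (P : 'I_n.+1 -> 'I_n.+1 -> Prop) :
  (forall a b, P a b -> P b a) ->
  (forall a b c, a != om -> b != om -> c != om -> a != b -> a != c -> b != c ->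
     P a b -> P a c) ->
  forall a b, a != om -> b != om -> a != b -> P a b ->
  forall a' b', a' != om -> b' != om -> a' != b' -> P a' b'.
Proof.
move=> Psym Pstep a b ao bo ab Pab.
have from a0 b0 : a0 != om -> b0 != om -> a0 != b0 -> P a0 b0 ->
    forall b', b' != om -> a0 != b' -> P a0 b'.
  move=> a0o b0o ab0 Pab0 b' b'o a0b'; have [<- //|bb'] := eqVneq b0 b'.
  exact: Pstep Pab0.
move=> a' b' a'o b'o ab'; have [aE|aa'] := eqVneq a a'.
  by subst a'; apply: (from a b).
have a'a : a' != a by rewrite eq_sym.
have Pa'a : P a' a by apply: Psym; apply: (from a b).
exact: (from a' a).
Qed.

Lemma skew_span x y : x^T = - x -> even_support x -> x \in V -> x != 0 ->
  y^T = - y -> even_support y -> y \in V.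
Proof.
move=> xT xe xV x0 yT ye.
have sk (z : M) r s : z^T = - z -> z s r = - z r s by move=> /matrixP/(_ r s); rewrite !mxE.
have diag (z : M) r : z^T = - z -> z r r = 0.
  by move=> zT; have /eqP := sk z r r zT; rewrite -subr_eq0 opprK -mulr2n mulrn_eq0 => /eqP.
have [a [b xab]] := exists_entry x0; have [ao bo] := xe _ _ xab.
have ab : a != b by apply: contraNneq xab => ->; rewrite diag.
have rab : rot C a b \in V.
  have := isolate_even ao bo ab xe xV; rewrite (sk x a b) // scaleNr -scalerBr.
  by move=> /(memvZ (x a b)^-1); rewrite scalerA mulVf // scale1r.
have rall := @spread_pairs (fun a b => rot C a b \in V) _ _ a b ao bo ab rab.
have -> : y = 2^-1 *: \sum_r \sum_s y r s *: rot C r s.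
  have -> : \sum_r \sum_s y r s *: rot C r s = y - y^T.
    rewrite [X in X - _]matrix_sum_delta [X in _ - X^T]matrix_sum_delta.
    rewrite linear_sum -sumrB; apply: eq_bigr => r _; rewrite linear_sum -sumrB.
    by apply: eq_bigr => s _; rewrite linearZ /= trmx_delta scalerBr.
  by rewrite yT opprK -mulr2n -scaler_nat scalerA mulVf ?scale1r // pnatr_eq0.
rewrite memvZ // memv_suml // => r _; rewrite memv_suml // => s _.
have [->|yrs] := eqVneq (y r s) 0; first by rewrite scale0r mem0v.
have [ro so] := ye _ _ yrs; rewrite memvZ // rall //.
- by move=> i j; rewrite /rot -opprB memvN.
- move=> i j k io jo ko ij ik jk rij.
  have := V_stable ko jo _ rij; rewrite eq_sym => /(_ jk).
  have -> : rot C i j = - rot C j i by rewrite /rot opprB.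
  rewrite -sub0r adB ad0 sub0r rot_rot 1?eq_sym // memvN => rki.
  by rewrite -memvN /rot opprB.
- by apply: contraNneq yrs => ->; rewrite diag.
Qed.

Lemma odd_span x y (e : bool) : x^T = (-1) ^+ e *: x -> odd_support x -> x \in V -> x != 0 ->
  y^T = (-1) ^+ e *: y -> odd_support y -> y \in V.
Proof.
move=> xT xo xV x0 yT yo.
have sk (z : M) r s : z^T = (-1) ^+ e *: z -> z s r = (-1) ^+ e * z r s.
  by move=> /matrixP/(_ r s); rewrite !mxE.
pose U a : M := delta_mx a om + (-1) ^+ e *: delta_mx om a.
have [a ao xa] : exists2 a, a != om & x a om != 0.
  have [r [s xrs]] := exists_entry x0.
  have := xo _ _ xrs; have [rE|ro] := eqVneq r om; have [sE|so] := eqVneq s om => //= _.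
    exists s => //; rewrite -rE (sk x r s) // mulf_eq0 negb_or xrs andbT.
    by rewrite signr_eq0.
  by exists r; rewrite // -sE.
have Ua : U a \in V.
  have := isolate_odd ao xo xV; rewrite (sk x a om) // mulrC -scalerA -scalerDr.
  by move=> /(memvZ (x a om)^-1); rewrite scalerA mulVf // scale1r.
have Uall b : b != om -> U b \in V.
  move=> bo; have [<- //|ab] := eqVneq a b.
  rewrite /U -(@rot_col_unit _ _ a b) //; apply: V_stable => //.
  by rewrite eq_sym.
have yU b : b != om -> y b om *: U b = y b om *: delta_mx b om + y om b *: delta_mx om b.
  by move=> bo; rewrite /U scalerDr scalerA mulrC -(sk y b om).
have -> : y = \sum_(b | b != om) y b om *: U b.
  apply/matrixP => r s; rewrite summxE.
  rewrite (eq_bigr (fun b => y r s *+ (((r == b) && (s == om)) || ((r == om) && (s == b))))); last first.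
    by move=> b bo; rewrite yU // unit_pairE.
  have [->|/yo] := eqVneq (y r s) 0; first by rewrite big1 // => b _; rewrite mul0rn.
  have [->|ro] := eqVneq r om; have [->|so] := eqVneq s om => //= _.
    rewrite (bigD1 s) //= eqxx andbF /= mulr1n big1 ?addr0 // => b /andP[bo bs].
    by rewrite [s == b]eq_sym (negPf bs) andbF mulr0n.
  rewrite (bigD1 r) //= eqxx /= mulr1n big1 ?addr0 // => b /andP[bo bs].
  by rewrite [r == b]eq_sym (negPf bs) mulr0n.
by rewrite memv_suml // => b bo; rewrite memvZ // Uall.
Qed.

(** A nonzero off-diagonal entry is isolated directly. A diagonal [x] of trace zero is not scalar on
    the first 2l+1 coordinates, so its bracket with a suitable rotation is a nonzero multiple of
    some [sym_unit]. *)
Lemma sym_span x y : x^T = x -> even_support x -> \tr x = 0 -> x \in V -> x != 0 ->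
  y^T = y -> even_support y -> \tr y = 0 -> y \in V.
Proof.
move=> xT xe xtr xV x0 yT ye ytr.
have sk (z : M) r s : z^T = z -> z s r = z r s by move=> /matrixP/(_ r s); rewrite !mxE.
have [a [b [ao bo ab Gab]]] : exists a b, [/\ a != om, b != om, a != b & sym_unit C a b \in V].
  have [[a [b [ab xab]]]|hd] := pselect (exists a b, a != b /\ x a b != 0).
    have [ao bo] := xe _ _ xab; exists a, b; split=> //.
    have := isolate_even ao bo ab xe xV; rewrite (sk x a b) // -scalerDr.
    by move=> /(memvZ (x a b)^-1); rewrite scalerA mulVf // scale1r.
  have xd i j : i != j -> x i j = 0.
    by move=> ij; apply: contrapT => /eqP xij; apply: hd; exists i, j.
  have [a [b xab]] := exists_entry x0.
  have bE : b = a by apply/eqP; apply: contraNT xab => ba; rewrite xd // eq_sym.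
  subst b; have [ao _] := xe _ _ xab.
  have [b [bo ab xb]] : exists b, [/\ b != om, a != b & x b b != x a a].
    apply: contrapT => hn; have : \tr x = x a a *+ (2 * l).+1.
      rewrite /mxtrace (bigD1 om) //= [x om om](_ : _ = 0) ?add0r; last first.
        by apply: contrapT => /eqP /xe[]; rewrite eqxx.
      rewrite (eq_bigr (fun=> x a a)) ?sumr_const ?cardC1 ?card_ord //.
      move=> i io; have [->//|ia] := eqVneq i a.
      by apply: contrapT => /eqP xi; apply: hn; exists i; split; rewrite // eq_sym.
    by rewrite xtr => /esym/eqP; rewrite mulrn_eq0 (negPf xab).
  exists a, b; split=> //; have := V_stable ao bo ab xV.
  rewrite rot_diag // => /(memvZ (x b b - x a a)^-1).
  by rewrite scalerA mulVf ?scale1r // subr_eq0.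
have Gall := @spread_pairs (fun a b => sym_unit C a b \in V) _ _ a b ao bo ab Gab.
have {}Gall : forall a' b', a' != om -> b' != om -> a' != b' -> sym_unit C a' b' \in V.
  apply: Gall; first by move=> i j; rewrite /sym_unit addrC.
  move=> i j k io jo ko ij ik jk Gij.
  have Gji : sym_unit C j i \in V by rewrite /sym_unit addrC.
  have := V_stable ko jo _ Gji; rewrite eq_sym => /(_ jk).
  by rewrite rot_sym_unit 1?eq_sym // /sym_unit addrC.
have Dall r : r != om -> delta_mx r r - delta_mx a a \in V.
  move=> ro; have [->|ra] := eqVneq r a; first by rewrite subrr mem0v.
  have := V_stable ro ao ra (Gall _ _ ro ao ra).
  by rewrite rot_sym_unit_diag // => /(memvZ 2^-1); rewrite scalerA mulVf ?pnatr_eq0 // scale1r.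
(* The diagonal generators are made traceless by means of a fixed index [a]; in the sum below the
   corrections add up to a multiple of [\tr y], which is zero. *)
pose D r s : M := sym_unit C r s - (r == s)%:R *: (2 *: delta_mx a a).
have -> : y = 2^-1 *: \sum_r \sum_s y r s *: D r s.
  have -> : \sum_r \sum_s y r s *: D r s = y + y^T - (\tr y) *: (2 *: delta_mx a a).
    rewrite [X in X + _ - _]matrix_sum_delta [X in _ + X^T - _]matrix_sum_delta.
    rewrite linear_sum -big_split /mxtrace scaler_suml -sumrB; apply: eq_bigr => r _ /=.
    rewrite linear_sum -big_split /= [X in _ - X](_ : _ =
      \sum_s y r s *: ((r == s)%:R *: (2 *: delta_mx a a))); last first.
      rewrite (bigD1 r) //= eqxx scale1r big1 ?addr0 // => s sr.
      by rewrite eq_sym (negPf sr) scale0r scaler0.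
    rewrite -sumrB; apply: eq_bigr => s _.
    by rewrite linearZ /= trmx_delta -scalerDr -scalerBr.
  by rewrite ytr scale0r subr0 yT -mulr2n -scaler_nat scalerA mulVf ?pnatr_eq0 // scale1r.
rewrite memvZ // memv_suml // => r _; rewrite memv_suml // => s _.
have [->|yrs] := eqVneq (y r s) 0; first by rewrite scale0r mem0v.
have [ro so] := ye _ _ yrs; rewrite memvZ // /D.
have [<-|rs] := eqVneq r s; last by rewrite scale0r subr0 Gall.
by rewrite scale1r /sym_unit -mulr2n -scaler_nat -scalerBr memvZ // Dall.
Qed.

End StableSubspaces.

(** * Engel's theorem *)

Section Engel.
Variables (R : realType) (n : nat).
Local Notation C := R[i].
Local Notation M := 'M[C]_n.+1.
Implicit Types (x y z w : M) (U W h L : {vspace M}).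

Lemma lie_ad x y : lie x y = ad x y. Proof. by []. Qed.

Lemma lieC x y : lie x y = - lie y x. Proof. by rewrite /lie opprB. Qed.

Lemma lieDl x y z : lie (x + y) z = lie x z + lie y z.
Proof. by rewrite /lie mulmxDl mulmxDr opprD addrACA. Qed.

Lemma lieZl (a : C) x z : lie (a *: x) z = a *: lie x z.
Proof. by rewrite /lie -scalemxAl -scalemxAr -scalerBr. Qed.

Lemma lieDr x y z : lie x (y + z) = lie x y + lie x z.
Proof. by rewrite lieC lieDl opprD -!lieC. Qed.

Lemma lieZr (a : C) x z : lie x (a *: z) = a *: lie x z.
Proof. by rewrite lieC lieZl -scalerN -lieC. Qed.

Lemma lie0 x : lie x 0 = 0. Proof. by rewrite /lie mulmx0 mul0mx subrr. Qed.

Lemma lie0l x : lie 0 x = 0. Proof. by rewrite lieC lie0 oppr0. Qed.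

Lemma lieNl x y : lie (- x) y = - lie x y.
Proof. by rewrite -scaleN1r lieZl scaleN1r. Qed.

Lemma lie_sumr x I r (P : pred I) (F : I -> M) :
  lie x (\sum_(i <- r | P i) F i) = \sum_(i <- r | P i) lie x (F i).
Proof. by apply: (big_morph (lie x)); [exact: lieDr | exact: lie0]. Qed.

Lemma lie_suml x I r (P : pred I) (F : I -> M) :
  lie (\sum_(i <- r | P i) F i) x = \sum_(i <- r | P i) lie (F i) x.
Proof. by elim/big_rec2: _ => [|i y z _ <-]; rewrite ?lie0l ?lieDl. Qed.

Lemma jacobi y x w : lie y (lie x w) = lie (lie y x) w + lie x (lie y w).
Proof.
rewrite /lie !(mulmxBl, mulmxBr) !mulmxA.
by apply/matrixP => i j; rewrite !mxE; ring.
Qed.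

Lemma lie_prod_mem U W x y : x \in U -> y \in W -> lie x y \in lie_prod U W.
Proof.
move=> xU yW; rewrite (coord_vbasis xU) lie_suml memv_suml // => i _.
rewrite lieZl memvZ // (coord_vbasis yW) lie_sumr memv_suml // => j _.
rewrite lieZr memvZ // memv_span //.
by apply/allpairsP; exists ((vbasis U)`_i, (vbasis W)`_j); split=> //; apply: mem_nth; rewrite size_tuple.
Qed.

Lemma lie_prod_sub U W (V : {vspace M}) :
  (forall x y, x \in U -> y \in W -> lie x y \in V) -> (lie_prod U W <= V)%VS.
Proof.
move=> h; apply/span_subvP => _ /allpairsP[[x y] /= [xU yW ->]].
by apply: h; apply: vbasis_mem.
Qed.

Variable h : {vspace M}.
Hypothesis h_sub : lie_subalgebra h.
Let lcs j := iter j (lie_prod h) h.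

Lemma lcs_lie j x y : x \in h -> y \in lcs j -> lie x y \in lcs j.+1.
Proof. by move=> xh yj; apply: lie_prod_mem. Qed.

Lemma lcs_anti j : (lcs j.+1 <= lcs j)%VS.
Proof.
elim: j => [|j IH]; first exact: lie_prod_sub.
by apply: lie_prod_sub => x y xh yj; apply: lcs_lie => //; apply: (subvP IH).
Qed.

Lemma lcs_le j : (lcs j <= h)%VS.
Proof. by elim: j => [|j IH]; [exact: subvv | exact: subv_trans (lcs_anti j) IH]. Qed.

Hypothesis h_nil : lie_nilpotent h.

Lemma nilpotent_ad : exists k, forall x y, x \in h -> y \in h -> iter k (lie x) y = 0.
Proof.
have [k hk] := h_nil; exists k => x y xh yh; apply/eqP; rewrite -memv0 -hk -/(lcs k).
by elim: k {hk} => //= k IH; apply: lie_prod_mem.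
Qed.

Variable W : M -> Prop.
Hypothesis W_stable : forall y w, y \in h -> W w -> W (lie y w).
Hypothesis W_nil : forall y w, y \in h -> W w -> exists k, iter k (lie y) w \in h.
Hypothesis W_norm :
  forall w, W w -> (forall y, y \in h -> lie y w \in h) -> w \in h.

(* Engel's theorem for the h-module (W + h)/h, by descending along the lower central series. *)
Lemma engel w : W w -> w \in h.
Proof.
move=> Ww; case: (boolP (w \in h)) => // wh.
have [k hk] := h_nil.
(* [Q k] holds because the k-th term of the series is zero; [Q 0] contradicts [W_norm]. *)
pose Q j := exists w, [/\ W w, w \notin h & forall y, y \in lcs j -> lie y w \in h].
have Qk : Q k.
  exists w; split=> // y; rewrite /lcs hk memv0 => /eqP->.
  by rewrite lie0l mem0v.
suff Qd j : Q j.+1 -> Q j.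
  have {Qk Qd} : Q 0%N by elim: k Qk {hk} => // k IH /Qd.
  by case=> v [Wv vh /W_norm]; rewrite (negPf vh); apply.
case=> v [Wv vh hv].
suff [v' [Wv' vh' _ hv']] : exists v, [/\ W v, v \notin h,
    forall y, y \in lcs j.+1 -> lie y v \in h &
    forall y, y \in (vbasis (lcs j) : seq M) -> lie y v \in h].
  exists v'; split=> // y yj; rewrite (coord_vbasis yj) lie_suml memv_suml // => i _.
  by rewrite lieZl memvZ // hv' // mem_nth // size_tuple.
have : {subset (vbasis (lcs j) : seq M) <= lcs j} by move=> x; apply: vbasis_mem.
elim: (tval _) => [|x s IH] sj; first by exists v.
have {IH}[|v1 [Wv1 vh1 hv1 hs1]] := IH.
  by move=> y ys; apply: sj; rewrite inE ys orbT.
have xj : x \in lcs j by apply: sj; rewrite mem_head.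
have xh : x \in h by apply: subvP xj; apply: lcs_le.
(* These conditions survive [lie x]: in the Jacobi identity the extra term is the bracket with
   [lie y x], which lies in [lcs j.+1]. *)
pose T v := [/\ W v, forall y, y \in lcs j.+1 -> lie y v \in h
               & forall y, y \in s -> lie y v \in h].
have Tx u : T u -> T (lie x u).
  case=> Wu hu su; split; first exact: W_stable.
    move=> y yj; rewrite jacobi memvD //; last by rewrite h_sub // hu.
    rewrite (lieC y) lieNl memvN hu //; apply: (subvP (lcs_anti _)).
    exact: lcs_lie.
  move=> y ys; rewrite jacobi memvD //; last by rewrite h_sub // su.
  apply: hu; apply: lcs_lie => //; apply: subvP (lcs_le j) _ _.
  by apply: sj; rewrite inE ys orbT.
have Tk k' u : T u -> T (iter k' (lie x) u) by move=> Tu; elim: k' => //= k' /Tx.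
have Tv1 : T v1 by [].
(* The last iterate outside [h] is sent into [h] by [x], so one more basis vector of [lcs j] is
   dealt with. *)
have exk : exists k', iter k' (lie x) v1 \in h by apply: W_nil.
case: (ex_minnP exk) => [[|k'] /= k'h k'min]; first by rewrite k'h in vh1.
exists (iter k' (lie x) v1); have [Wk hk' sk] := Tk k' _ Tv1.
split=> //; first by apply/negP => /k'min; rewrite ltnn.
by move=> y; rewrite inE => /predU1P[->|/sk].
Qed.

End Engel.

(** * The gradation *)

Section Gradation.
Variables (R : realType) (n : nat).
Local Notation C := R[i].
Local Notation M := 'M[C]_n.+1.
Implicit Types (x y : M) (p q : int).

Definition parity p := odd `|p|%N.

Lemma parityD p q : parity (p + q) = parity p (+) parity q.
Proof. by rewrite /parity; case: p q => [m|m] [k|k] /=; lia. Qed.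

Lemma unity_root2 p : unity_root R 2 ^ p = (-1) ^+ parity p :> C.
Proof.
have -> : unity_root R 2 = -1.
  rewrite /unity_root mulrC mulrA mulVf ?pnatr_eq0 // mul1r cospi sinpi.
  by apply/eqP; rewrite eq_complex /= oppr0 !eqxx.
rewrite /parity signr_odd; case: p => m //.
by rewrite /exprz -exprVn invrN1.
Qed.

Lemma mem_sl x : (x \in sl R n.+1) = (\tr x == 0).
Proof.
rewrite memv_ker linfun_linear // => a y z.
by rewrite linearD linearZ.
Qed.

Lemma neg_transposeE x : neg_transpose R n.+1 x = - x^T.
Proof.
rewrite /neg_transpose linfun_linear // => a y z.
by rewrite linearD linearZ /= opprD scalerN.
Qed.

Lemma reflectionE : reflection R n = diag_mx (\row_i (-1) ^+ (i == ord_max)).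
Proof.
apply/matrixP => i j; rewrite /reflection !mxE summxE.
have [->|im] := eqVneq i ord_max.
  rewrite /= big1 ?addr0; first by rewrite eq_sym expr1 mulNrn.
  by move=> k km; rewrite mxE eq_sym (negPf km).
rewrite mulr0n oppr0 add0r (bigD1 i) //= mxE eqxx big1 ?addr0 ?expr0 1?eq_sym //.
by move=> k /andP[_ ki]; rewrite mxE eq_sym (negPf ki).
Qed.

Lemma reflection_sqr : reflection R n *m reflection R n = 1%:M.
Proof.
rewrite reflectionE mul_diag_mx; apply/matrixP => i j; rewrite !mxE.
by rewrite mulrnAr -expr2 sqrr_sign.
Qed.

Lemma AdE x : Ad (reflection R n) x = reflection R n *m x *m reflection R n.
Proof.
have invD : invmx (reflection R n) = reflection R n.
  have [_ u] := mulmx1_unit reflection_sqr.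
  by rewrite -[LHS]mul1mx -reflection_sqr mulmxK.
rewrite /Ad linfun_linear ?invD // => a y z.
by move: (reflection R n) => D; rewrite mulmxDr mulmxDl -scalemxAr -scalemxAl.
Qed.

Lemma Ad_entry x i j :
  Ad (reflection R n) x i j = (-1) ^+ ((i == ord_max) (+) (j == ord_max)) * x i j.
Proof.
rewrite AdE reflectionE mul_diag_mx mul_mx_diag !mxE.
by rewrite signr_addb; exact: mulrAC.
Qed.

Local Notation g := (sl R n.+1).
Local Notation s0 := (neg_transpose R n.+1).
Local Notation s1 := (Ad (reflection R n)).
Local Notation gr := (graded g s0 s1 2 2).

Lemma graded_mem p q x : (x \in gr p q) =
  [&& \tr x == 0, - x^T == (-1) ^+ parity p *: x & s1 x == (-1) ^+ parity q *: x].
Proof.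
have eig (s : 'End(M)) (a : C) : (x \in passmx.leigenspace s a) = (s x == a *: x).
  by rewrite memv_ker add_lfunE opp_lfunE scale_lfunE id_lfunE subr_eq0.
rewrite memv_cap memv_cap -andbA -neg_transposeE -(unity_root2 p) -(unity_root2 q).
exact: (congr2 andb (mem_sl x) (congr2 andb (eig s0 _) (eig s1 _))).
Qed.

Lemma gradedP p q x : reflect [/\ \tr x = 0, x^T = (-1) ^+ (~~ parity p) *: x :> M
    & forall i j, x i j != 0 -> (i == ord_max) (+) (j == ord_max) = parity q]
  (x \in gr p q).
Proof.
rewrite graded_mem; apply: (iffP and3P) => [[/eqP tx /eqP xT /eqP xD]|[tx xT xD]].
  split=> //.
    by rewrite -[LHS]opprK xT signrN scaleNr.
  move=> i j xij; have := congr1 (fun t : M => t i j) xD.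
  rewrite /= Ad_entry mxE => /(mulIf xij) /eqP.
  by rewrite (inj_eq (@signr_inj _)) => /eqP.
split; first exact/eqP.
  by rewrite xT signrN scaleNr opprK.
apply/eqP/matrixP => i j; rewrite Ad_entry mxE.
have [->|/xD ->//] := eqVneq (x i j) 0; by rewrite !mulr0.
Qed.

Lemma neg_transposeK : involutive s0.
Proof. by move=> x; rewrite 2!neg_transposeE linearN /= trmxK opprK. Qed.

Lemma Ad_reflectionK : involutive s1.
Proof.
by move=> x; apply/matrixP => i j; rewrite 2!Ad_entry mulrA -signr_addb addbb mul1r.
Qed.

Lemma involution_automorphism (s : 'End(M)) : involutive s ->
  (forall x, x \in g -> s x \in g) ->
  (forall x y, s (lie x y) = lie (s x) (s y)) -> lie_automorphism g s.
Proof.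
move=> sK sg sl; split=> //; apply/vspaceP => x; apply/memv_imgP/idP.
  by case=> y yg ->; apply: sg.
by move=> xg; exists (s x); [apply: sg | rewrite sK].
Qed.

Lemma neg_transpose_automorphism : lie_automorphism g s0.
Proof.
apply: involution_automorphism; first exact: neg_transposeK.
  by move=> x; rewrite 2!mem_sl neg_transposeE linearN /= mxtrace_tr oppr_eq0.
move=> x y; rewrite 3!neg_transposeE /lie linearB /= !trmx_mul.
by rewrite !(mulmxN, mulNmx) !opprK opprB.
Qed.

Lemma Ad_reflection_automorphism : lie_automorphism g s1.
Proof.
have DM x y : s1 x *m s1 y = s1 (x *m y).
  have := reflection_sqr; rewrite 3!AdE; move: (reflection R n) => D D2.
  by rewrite !mulmxA -[_ *m D *m D]mulmxA D2 mulmx1.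
apply: involution_automorphism; first exact: Ad_reflectionK.
  by move=> x; rewrite 2!mem_sl AdE mxtrace_mulC mulmxA reflection_sqr mul1mx.
by move=> x y; rewrite /lie 2!DM linearB.
Qed.

Lemma neg_transpose_Ad_reflection x : s0 (s1 x) = s1 (s0 x).
Proof.
apply/matrixP => i j; rewrite Ad_entry 2!neg_transposeE !mxE Ad_entry addbC.
by rewrite mulrN.
Qed.

Lemma involution_order2 (s : 'End(M)) : involutive s ->
  (exists2 x, x \in g & s x != x) -> has_order g s 2.
Proof.
move=> sK ex; split=> //; first by move=> x _ /=; rewrite sK.
by move=> [|[|m]].
Qed.

Lemma swap_mem_sl (i j : 'I_n.+1) (a b : C) : i != j ->
  a *: delta_mx i j + b *: delta_mx j i \in g.
Proof.
move=> ij; rewrite mem_sl linearD !linearZ /=.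
have tr0 (k m : 'I_n.+1) : k != m -> \tr (delta_mx k m : M) = 0.
  move=> km; apply: big1 => r _; rewrite mxE.
  by case: eqP => // ->; rewrite (negPf km).
by rewrite (tr0 i j) // (tr0 j i) 1?eq_sym // ?scaler0 ?mulr0 addr0.
Qed.

Lemma neg_transpose_order : (0 < n)%N -> has_order g s0 2.
Proof.
move=> n0; apply: involution_order2; first exact: neg_transposeK.
have lt : (ord0 : 'I_n.+1) != ord_max by rewrite -val_eqE /= neq_ltn n0.
exists (1 *: delta_mx ord0 ord_max + 1 *: delta_mx ord_max ord0); first exact: swap_mem_sl.
apply/eqP => /matrixP/(_ ord0 ord_max).
rewrite neg_transposeE !mxE !eqxx (negPf lt) [ord_max == _]eq_sym (negPf lt) /=.
rewrite !mul1r mulr0n mulr1n addr0 add0r => /eqP; rewrite eq_sym.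
by rewrite -subr_eq0 opprK -mulr2n pnatr_eq0.
Qed.

Lemma Ad_reflection_order : (0 < n)%N -> has_order g s1 2.
Proof.
move=> n0; apply: involution_order2; first exact: Ad_reflectionK.
have lt : (ord0 : 'I_n.+1) != ord_max by rewrite -val_eqE /= neq_ltn n0.
exists (1 *: delta_mx ord0 ord_max + 1 *: delta_mx ord_max ord0); first exact: swap_mem_sl.
apply/eqP => /matrixP/(_ ord0 ord_max).
rewrite Ad_entry !mxE !eqxx (negPf lt) /= !mul1r mulr0n mulr1n addr0 mulr1 => /eqP; rewrite eq_sym.
by rewrite -subr_eq0 opprK -mulr2n pnatr_eq0.
Qed.

(** An endomorphism of the full matrix space with image in [L] has the same trace on [L] as on the
    whole space, where matrix units form a basis. *)
Lemma trace_coord (L : {vspace M}) (phi : {linear M -> M}) :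
  (forall x, phi x \in L) ->
  \sum_(i < \dim L) coord (vbasis L) i (phi (vbasis L)`_i)
    = \sum_j \sum_k phi (delta_mx j k) j k.
Proof.
move=> phiL.
transitivity (\sum_(i < \dim L) \sum_j \sum_k
    (vbasis L)`_i j k * coord (vbasis L) i (phi (delta_mx j k))).
  apply: eq_bigr => i _; rewrite [X in phi X]matrix_sum_delta !linear_sum.
  apply: eq_bigr => j _; rewrite !linear_sum; apply: eq_bigr => k _.
  by rewrite !linearZ.
rewrite exchange_big; apply: eq_bigr => j _.
rewrite exchange_big; apply: eq_bigr => k _ /=.
rewrite {2}(coord_vbasis (phiL (delta_mx j k))) summxE.
by apply: eq_bigr => i _; rewrite mxE mulrC.
Qed.

Lemma lie_sl x y : lie x y \in g.
Proof. by rewrite mem_sl /lie linearB /= mxtrace_mulC subrr. Qed.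

(** The map sending z to a z b has trace tr(a) tr(b); this is applied to the four terms of the
    double commutator, whose values are always traceless. *)
Lemma killing_sl x y :
  killing g x y = (2 * n.+1)%:R * \tr (x *m y) - 2 * (\tr x * \tr y).
Proof.
have lin : linear (fun z => lie x (lie y z)).
  by move=> a z t; rewrite /= (lieDr y) (lieZr a y) (lieDr x) (lieZr a x).
pose phi : {linear M -> M} := HB.pack (fun z => lie x (lie y z)) (GRing.isLinear.Build _ _ _ _ _ lin).
rewrite /killing; rewrite (trace_coord (phi := phi)) => [|z]; last exact: lie_sl.
have mulD (a b : M) j k r s : (a *m delta_mx j k *m b) r s = a r j * b k s.
  rewrite -(mul_delta_mx (0 : 'I_1)) mulmxA -colE -mulmxA -rowE mxE big_ord1.
  by rewrite !mxE.
have E j k : phi (delta_mx j k) j k =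
    (x *m y) j j * 1%:M k k + 1%:M j j * (y *m x) k k - x j j * y k k - y j j * x k k.
  rewrite -!mulD /phi /= /lie !(mulmxBl, mulmxBr) !mulmxA !mulmx1 !mul1mx.
  by rewrite !mxE; ring.
transitivity (\sum_(j < n.+1) (n.+1%:R * (x *m y) j j + \tr (y *m x)
    - x j j * \tr y - y j j * \tr x)).
  apply: eq_bigr => j _.
  rewrite (eq_bigr (fun k => ((x *m y) j j + (y *m x) k k) - (x j j * y k k + y j j * x k k))); last first.
    by move=> k _; rewrite E [1%:M j j]mxE [1%:M k k]mxE !eqxx !mulr1n; ring.
  rewrite sumrB !big_split /= sumr_const card_ord -!mulr_sumr opprD addrA.
  by rewrite -/(\tr x) -/(\tr y) -/(\tr (y *m x)) mulr_natl.
rewrite (eq_bigr (fun j => n.+1%:R * (x *m y) j j + \tr (y *m x)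
    - (x j j * \tr y + y j j * \tr x))); last by move=> j _; ring.
rewrite sumrB !big_split /= sumr_const card_ord -!mulr_sumr -!mulr_suml.
rewrite -/(\tr x) -/(\tr y) -/(\tr (x *m y)) -mulr_natl [\tr (y *m x)]mxtrace_mulC.
by rewrite natrM; ring.
Qed.

End Gradation.

(** * The root system *)

Section FrameRoots.
Variables (R : realType) (l : nat).
Local Notation C := R[i].
Local Notation n := (2 * l).+1.
Local Notation M := 'M[C]_n.+1.
Local Notation g := (sl R n.+1).
Local Notation s0 := (neg_transpose R n.+1).
Local Notation s1 := (Ad (reflection R n)).
Local Notation gr := (graded g s0 s1 2 2).

Lemma graded_bigraded p q (x : M) : (x \in gr p q) <-> bigraded (parity p) (parity q) x.
Proof. by split=> [/gradedP|?]; [|apply/gradedP]. Qed.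

Lemma graded00P (x : M) : x \in gr 0 0 <-> skew_dd x.
Proof.
have ddE i j : (x *m delta_mx ord_max ord_max) i j = x i ord_max * (j == ord_max)%:R.
  rewrite mxE (bigD1 ord_max) //= big1 ?addr0; first by rewrite mxE eqxx.
  by move=> k km; rewrite mxE (negPf km) mulr0.
split=> [/gradedP[_ xT0 xs]|[xT xd]].
  have xT : x^T = - x by rewrite xT0 scaleN1r.
  split=> //.
  apply/matrixP => i j; rewrite -mulmxE ddE mxE.
  have [jm|_] := eqVneq j ord_max; last by rewrite mulr0.
  rewrite mulr1; apply: contrapT => /eqP im.
  have := xs _ _ im; rewrite eqxx addbT => /negbT; rewrite negbK => /eqP iE.
  have : x^T i i = - x i i by rewrite xT mxE.
  rewrite mxE => /eqP; rewrite -subr_eq0 opprK -mulr2n mulrn_eq0 /= => /eqP xi.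
  by move: im; rewrite -iE xi eqxx.
apply/gradedP; split; last 1 first.
- have xm i : x i ord_max = 0.
    have /matrixP/(_ i ord_max) := xd.
    by rewrite -mulmxE ddE mxE eqxx mulr1.
  move=> i j xij.
  have jm : (j == ord_max) = false by apply: contraNF xij => /eqP->; rewrite xm.
  rewrite jm addbF; apply: contraNF xij => /eqP->.
  have : x^T j ord_max = - x j ord_max by rewrite xT mxE.
  by rewrite mxE xm oppr0 => ->.
- have /eqP : \tr x = - \tr x by rewrite -[LHS]mxtrace_tr xT linearN.
  by rewrite -subr_eq0 opprK -mulr2n mulrn_eq0 => /eqP.
- by rewrite xT scaleN1r.
Qed.

Variable h : {vspace M}.

Lemma cartan_frame_graded : cartan_subalgebra (gr 0 0) h ->
  exists v : frame_index l -> 'cV[C]_n.+1,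
  [/\ forall y, y \in h -> y^T = - y, is_frame v,
      forall i, frame_torus v i \in h &
      forall y a, y \in h -> y *m v a = frame_coef v y a *: v a].
Proof.
move=> hC; have [/subvP hL hs hn hnorm] := hC.
have hskew y : y \in h -> skew_dd y by move=> /hL /graded00P.
have hT y : y \in h -> y^T = - y by move=> /hskew[].
have hnil : exists k, forall x y : M, x \in h -> y \in h -> iter k (ad x) y = 0.
  by have [k hk] := nilpotent_ad hn; exists k => x y xh yh; exact: hk.
have heng (W : M -> Prop) : (forall w, W w -> skew_dd w) ->
    (forall y w, y \in h -> W w -> W (ad y w)) ->
    (forall y w, y \in h -> W w -> exists k, iter k (ad y) w = 0) ->
    forall w, W w -> w \in h.
  move=> WL Ws Wn; apply: (engel hs hn Ws).
    by move=> y w yh /(Wn _ _ yh)[k kE]; exists k; rewrite kE mem0v.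
  move=> w /WL /graded00P wL wh; apply: hnorm => // y yh.
  by rewrite lieC memvN wh.
have hdd y : y \in h -> y * delta_mx ord_max ord_max = 0 by move=> /hskew[].
by have [v [fv tv ev]] := cartan_frame hT hnil heng hdd (erefl n); exists v.
Qed.

Variable v : frame_index l -> 'cV[C]_n.+1.
Hypothesis hT : forall y, y \in h -> y^T = - y.
Hypothesis frame_v : is_frame v.
Hypothesis torus_mem : forall i, frame_torus v i \in h.
Hypothesis eigen_v : forall y a, y \in h -> y *m v a = frame_coef v y a *: v a.
Local Notation mu := (frame_coef v).

Lemma frame_coef_linear a (c : C) (y z : M) : mu (c *: y + z) a = c * mu y a + mu z a.
Proof.
by rewrite /frame_coef mulmxDr mulmxDl -scalemxAr -scalemxAl mxE [X in X + _]mxE.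
Qed.

Lemma frame_coef_sum a (c : 'I_l -> C) (y : 'I_l -> M) :
  mu (\sum_i c i *: y i) a = \sum_i c i * mu (y i) a.
Proof.
rewrite /frame_coef mulmx_sumr mulmx_suml summxE; apply: eq_bigr => i _.
by rewrite -scalemxAr -scalemxAl mxE.
Qed.

Definition frame_functional (r : 'rV[C]_l) (H : subvs_of h) : C^o :=
  \sum_i r 0 i * mu (vsval H) (inl (i, false)).

Lemma frame_functional_linear r : linear (frame_functional r).
Proof.
move=> c H K; rewrite /frame_functional scaler_sumr -big_split /=.
apply: eq_bigr => i _; rewrite frame_coef_linear mulrDr.
by congr (_ + _); exact: mulrCA.
Qed.

Lemma frame_map_linear :
  linear ((fun r => linfun (frame_functional r)) : 'rV[C]_l -> dual h).
Proof.
move=> c r s; apply/lfunP => H; rewrite add_lfunE scale_lfunE.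
rewrite !(linfun_linear (@frame_functional_linear _)) /frame_functional.
rewrite scaler_sumr -big_split /=; apply: eq_bigr => i _.
by rewrite !mxE mulrDl; congr (_ + _); exact/esym/mulrA.
Qed.

(** Sends the i-th basis vector to the weight of [v (inl (i, false))]. It identifies C^l with the
    dual of [h] and carries the standard root system of type B to the roots. *)
Definition frame_map : 'Hom('rV[C]_l, dual h) :=
  linfun (fun r => linfun (frame_functional r)).

Lemma frame_mapE r H : frame_map r H = \sum_i r 0 i * mu (vsval H) (inl (i, false)).
Proof.
rewrite /frame_map (linfun_linear frame_map_linear).
by rewrite (linfun_linear (@frame_functional_linear _)).
Qed.

Definition torus (i : 'I_l) : subvs_of h := vsproj h (frame_torus v i).

Lemma vsval_torus i : vsval (torus i) = frame_torus v i.
Proof. exact: vsprojK. Qed.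

Lemma frame_map_torus r i : frame_map r (torus i) = r 0 i.
Proof.
rewrite frame_mapE vsval_torus (bigD1 i) //= big1 => [|j ji].
  by rewrite frame_torus_coef // eqxx mulr1 addr0.
by rewrite frame_torus_coef // eq_sym (negPf ji) mulr0.
Qed.

Lemma torus_sum (H : subvs_of h) : H = \sum_i mu (vsval H) (inl (i, false)) *: torus i.
Proof.
apply: val_inj; rewrite /= linear_sum /=.
rewrite [LHS](frame_torus_sum hT frame_v eigen_v (subvsP H)).
by apply: eq_bigr => i _; rewrite -vsval_torus.
Qed.

Lemma dual_torus (a : dual h) : a = frame_map (\row_i a (torus i)).
Proof.
apply/lfunP => H; rewrite frame_mapE {1}(torus_sum H) linear_sum.
by apply: eq_bigr => i _; rewrite linearZ mxE mulrC.
Qed.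

Lemma frame_map_inj : injective frame_map.
Proof.
move=> r s rs; apply/rowP => i.
by rewrite -(frame_map_torus r) rs frame_map_torus.
Qed.

(** The trace of [frame_torus v i *m K] receives the same contribution from both vectors of the i-th
    hyperbolic pair; this doubles the factor [2 * n.+1] of the trace form. *)
Lemma killing_frame (H K : subvs_of h) : killing g (vsval H) (vsval K) =
  (4 * n.+1)%:R * \sum_i mu (vsval H) (inl (i, false)) * mu (vsval K) (inl (i, false)).
Proof.
rewrite killing_sl.
have tr0 (y : M) : y \in h -> \tr y = 0.
  move=> yh; have /eqP : \tr y = - \tr y by rewrite -[LHS]mxtrace_tr (hT yh) linearN.
  by rewrite -subr_eq0 opprK -mulr2n mulrn_eq0 => /eqP.
rewrite (tr0 _ (subvsP H)) mul0r mulr0 subr0.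
rewrite {1}(frame_torus_sum hT frame_v eigen_v (subvsP H)) mulmx_suml linear_sum /=.
rewrite !mulr_sumr; apply: eq_bigr => i _.
rewrite -scalemxAl linearZ /= /frame_torus mulmxBl linearB /=.
have trE (a b : 'cV[C]_n.+1) (y : M) : \tr (a *m b^T *m y) = (b^T *m y *m a) 0 0.
  by rewrite -mulmxA mxtrace_mulC /mxtrace big_ord1.
rewrite !trE.
have -> : ((v (inl (i, true)))^T *m vsval K *m v (inl (i, false))) 0 0 = mu (vsval K) (inl (i, false)) by [].
have -> : ((v (inl (i, false)))^T *m vsval K *m v (inl (i, true))) 0 0 = mu (vsval K) (frame_dual (inl (i, false))) by [].
rewrite (frame_coef_dual _ _ (hT (subvsP K))).
by rewrite !natrM; ring.
Qed.

Lemma dual_form_frame r s : dual_form g (frame_map r) (frame_map s) =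
  (4 * n.+1)%:R^-1 * \sum_i r 0 i * s 0 i.
Proof.
set c : C := (4 * n.+1)%:R.
have c0 : c != 0 by rewrite pnatr_eq0.
have coefE t i : mu (vsval (dual_vect g (frame_map t))) (inl (i, false)) = c^-1 * t 0 i.
  have /xgetPex P : exists K : subvs_of h,
      forall H, killing g (vsval K) (vsval H) = frame_map t H.
    (* The elements [torus i] are orthogonal with Killing square [c], whence the coefficients. *)
    exists (\sum_i (c^-1 * t 0 i) *: torus i) => H.
    rewrite killing_frame -/c frame_mapE mulr_sumr; apply: eq_bigr => j _.
    suff -> : mu (vsval (\sum_i (c^-1 * t 0 i) *: torus i)) (inl (j, false)) = c^-1 * t 0 j.
      by rewrite mulrA mulrA divff // mul1r.
    have -> : vsval (\sum_i (c^-1 * t 0 i) *: torus i) = \sum_i (c^-1 * t 0 i) *: frame_torus v i.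
      by rewrite linear_sum /=; apply: eq_bigr => k _; rewrite -vsval_torus.
    rewrite frame_coef_sum (bigD1 j) //= big1 => [|k kj].
      by rewrite frame_torus_coef // eqxx mulr1 addr0.
    by rewrite frame_torus_coef // (negPf kj) mulr0.
  have := P 0 (torus i).
  rewrite killing_frame frame_map_torus -/c => <-.
  rewrite mulrA mulVf // mul1r (bigD1 i) //= big1 => [|k kj].
    by rewrite vsval_torus frame_torus_coef // eqxx mulr1 addr0.
  by rewrite vsval_torus frame_torus_coef // eq_sym (negPf kj) mulr0.
rewrite /dual_form killing_frame -/c !mulr_sumr; apply: eq_bigr => i _.
by rewrite !coefE mulrA mulVKf //; exact: mulrCA.
Qed.

End FrameRoots.

Local Open Scope classical_set_scope.
Local Open Scope complex_scope.

(** * Root vectors of the toroidal algebra *)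

Section ToroidalWeights.
Variables (R : realType) (n : nat).
Local Notation C := R[i].
Local Notation M := 'M[C]_n.+1.
Variables (g : {vspace M}) (s0 s1 : 'End(M)) (n0 n1 : nat) (h : {vspace M}).
Implicit Types (b : wspace h) (x : tor R n.+1).

Lemma fsum_at0 (V : nmodType) (F : int * int -> V) :
  (forall s, s != 0 -> F s = 0) -> \sum_(s \in [set: int * int]) F s = F 0.
Proof.
move=> F0; rewrite -(fsbig_widen [set (0 : int * int)] setT) ?fsbig_set1 //.
by move=> s [_ /= /eqP s0']; apply: F0.
Qed.

Lemma killing0l (z : M) : killing g 0 z = 0.
Proof. by rewrite /killing big1 // => i _; rewrite lie0l linear0. Qed.

Lemma scale2_0r (c : C) : scale2 c 0 = 0.
Proof. by rewrite /scale2 /= !mulr0. Qed.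

Lemma scale2_0l (w : C * C) : scale2 0 w = 0.
Proof. by rewrite /scale2 !mul0r. Qed.

Lemma toC0 : toC R 0 = 0. Proof. by []. Qed.

Lemma pairing0 (r : int * int) : pairing (0 : C * C) r = 0.
Proof. by rewrite /pairing !mul0r addr0. Qed.

Lemma bracket_loop H c e x r : deg x = 0 ->
  loop (tor_bracket g (@tor_cartan R n.+1 h H c e) x) r =
  lie (vsval H) (loop x r) + pairing e r *: loop x r.
Proof.
move=> x0; rewrite /= fsum_at0 => [|s s0']; last by rewrite (negPf s0') lie0l.
by rewrite eqxx subr0 x0 pairing0 scale0r subr0.
Qed.

Lemma bracket_form H c e x r : deg x = 0 ->
  Defs.form (tor_bracket g (@tor_cartan R n.+1 h H c e) x) r = scale2 (pairing e r) (Defs.form x r).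
Proof.
move=> x0; rewrite /= fsum_at0 => [|s s0']; last by rewrite (negPf s0') killing0l scale2_0l.
by rewrite toC0 scale2_0r add0r x0 pairing0 scale2_0l subr0.
Qed.

(* The component of degree r of a root vector is a weight vector for h in the
   graded piece of degree r, and the components along K and d_0, d_1 vanish. *)
Lemma weight_vectorP b : b.1 != 0 ->
  (exists x, weight_vector g s0 s1 n0 n1 b x /\ ~ tor_eq x (tor0 R n.+1)) <->
  exists r : int * int, b.2 = toC R r /\
    exists y, [/\ y \in graded g s0 s1 n0 n1 r.1 r.2, y != 0 &
      forall H, lie (vsval H) y = (b.1 H : C) *: y].
Proof.
move=> b0; split=> [[x [[xin xw] xn0]]|[r [br [y [yg y0 yw]]]]].
  have [H0 bH0] : exists H0, b.1 H0 != 0.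
    apply: contrapT => hn; move/negP: b0; apply; apply/eqP/lfunP => H.
    by rewrite zero_lfunE; apply: contrapT => /eqP bH; apply: hn; exists H.
  have wv0 : wval b H0 0 = b.1 H0 by rewrite /wval /= !mulr0 !addr0.
  have degx : deg x = 0.
    have [_ _ /=] := xw H0 0 0; rewrite /scale2 wv0 => /esym.
    case: (deg x) => a a' [] /eqP; rewrite mulf_eq0 (negPf bH0) /= => /eqP->.
    by move=> /eqP; rewrite mulf_eq0 (negPf bH0) /= => /eqP->.
  have [r xr] : exists r, loop x r != 0.
    apply: contrapT => hn; apply: xn0; split => //.
      by move=> r; apply: contrapT => /eqP xr; apply: hn; exists r.
    (* Bracketing with [H0] annihilates the form part, whereas the weight equation makes it [b.1 H0]
       times that part modulo exact forms. So a root vector without loop part is zero. *)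
    have [_ [f [ff fE]] _] := xw H0 0 0.
    exists (fun r => - (b.1 H0)^-1 * f r); split.
      apply: sub_finite_set ff => r /=; apply: contra => /eqP->.
      by rewrite mulr0.
    move=> r; have := fE r; rewrite bracket_form // pairing0 scale2_0l /= wv0 sub0r.
    rewrite subr0 /scale2; case: (Defs.form x r) => u u' /= [e1 e2].
    by congr (_, _); rewrite -mulrA -?e1 -?e2 mulrNN mulKf.
  have weq H e : lie (vsval H) (loop x r) + pairing e r *: loop x r = wval b H e *: loop x r.
    by have [/(_ r) lE _ _] := xw H 0 e; rewrite bracket_loop // in lE; exact: lE.
  exists r; split.
    (* Acting by d_0 and d_1 alone compares the isotropic part of [b] with the degree [r]. *)
    have e12 e : pairing e r = b.2.1 * e.1 + b.2.2 * e.2.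
      have := weq 0 e; rewrite linear0 lie0l add0r /wval linear0 add0r.
      by move=> /eqP; rewrite -subr_eq0 -scalerBl scaler_eq0 (negPf xr) orbF subr_eq0 => /eqP.
    have := e12 (1, 0); have := e12 (0, 1); rewrite /pairing /=.
    rewrite !mul0r !mul1r !mulr0 !mulr1 !add0r !addr0 /toC => -> ->.
    by case: (b.2).
  exists (loop x r); split=> //; first by have [] := xin.
  by move=> H; have := weq H 0; rewrite pairing0 scale0r addr0 /wval /= !mulr0 !addr0.
pose x : tor R n.+1 := Tor (fun s => if s == r then y else 0) (fun=> 0) 0.
exists x; split; last first.
  by case=> /(_ r) /=; rewrite eqxx => /eqP; rewrite (negPf y0).
split.
  split=> /=.
  - by move=> s; case: eqP => [->//|_]; exact: mem0v.
  - apply: (@sub_finite_set _ _ [set r]) => [s /=|]; last exact: finite_set1.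
    by case: (eqVneq s r) => // _ /eqP.
  - apply: (@sub_finite_set _ _ set0) => [s /eqP //|]; exact: finite_set0.
  - by move=> s /eqP.
move=> H c e; split.
- move=> s; rewrite bracket_loop //=; case: eqP => [->|_].
    by rewrite yw -scalerDl /wval br /pairing /toC /= ![e.1 * _]mulrC ![e.2 * _]mulrC.
  by rewrite lie0 !scaler0 addr0.
- exists (fun=> 0); split.
    apply: (@sub_finite_set _ _ set0) => [s /eqP //|]; exact: finite_set0.
  by move=> s; rewrite bracket_form //= !scale2_0r scale2_0l subrr.
- by rewrite /= scale2_0r.
Qed.

End ToroidalWeights.

(** * Short, long and doubled weights in coordinates *)

Section WeightVectors.
Variables (C : numClosedFieldType) (l : nat).
Implicit Types (r : 'rV[C]_l) (c d : frame_index l).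

Definition short_weight r := exists i (e : bool), r = (-1) ^+ e *: delta_mx 0 i.

Definition long_weight r := exists i j (e e' : bool),
  i != j /\ r = (-1) ^+ e *: delta_mx 0 i + (-1) ^+ e' *: delta_mx 0 j.

(** Bilinear, without conjugation: up to a positive constant, the dual of the Killing form. Its
    values on short, long and doubled weights are 1, 2 and 4. *)
Definition sqnorm r := \sum_i r 0 i * r 0 i.

Lemma short_sqnorm r : short_weight r -> sqnorm r = 1.
Proof.
case=> i [e ->]; rewrite /sqnorm (bigD1 i) //= big1 => [|j ji].
  by rewrite !mxE !eqxx /= mulr1 -expr2 sqrr_sign addr0.
by rewrite !mxE (negPf ji) andbF !mulr0.
Qed.

Lemma long_sqnorm r : long_weight r -> sqnorm r = 2.
Proof.
case=> i [j [e [e' [ij ->]]]]; rewrite /sqnorm (bigD1 i) //= (bigD1 j) 1?eq_sym //= big1.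
  rewrite !mxE !eqxx (negPf ij) eq_sym (negPf ij) /= !mulr0n !mulr1n.
  by rewrite !mulr0 !mulr1 !addr0 !add0r -!expr2 !sqrr_sign.
by move=> k /andP[ki kj]; rewrite !mxE (negPf ki) (negPf kj) /= !mulr0n !mulr0 addr0 mulr0.
Qed.

Lemma double_sqnorm r : sqnorm (r *+ 2) = 4 * sqnorm r.
Proof. by rewrite /sqnorm mulr_sumr; apply: eq_bigr => i _; rewrite !mxE; ring. Qed.

Lemma sqnorm_neq0 r : sqnorm r != 0 -> r != 0.
Proof.
apply: contra => /eqP->; rewrite /sqnorm big1 // => i _.
by rewrite mxE mulr0.
Qed.

Lemma frame_weight_dual c : frame_weight C (frame_dual c) = - frame_weight C c.
Proof. by case: c => [[i b]|b] /=; rewrite ?oppr0 // signrN scaleNr. Qed.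

Lemma allowed_short p c d : allowed p true c d ->
  frame_weight C c + frame_weight C d != 0 ->
  short_weight (frame_weight C c + frame_weight C d).
Proof.
move=> /andP[/eqP cd _].
case: c d cd => [[i e]|[]] [[j e']|[]] //= _; rewrite ?add0r ?addr0 ?eqxx // => _.
  by exists i, e.
by exists j, e'.
Qed.

(** Two labels in the same hyperbolic pair give weight zero if they are dual; if they are equal,
    they give a doubled weight, and a skew matrix does not admit equal labels. *)
Lemma allowed_even p c d : allowed p false c d ->
  frame_weight C c + frame_weight C d != 0 ->
  let r := frame_weight C c + frame_weight C d in
  [\/ short_weight r, long_weight r
    | p /\ exists2 s, short_weight s & r = s *+ 2].
Proof.
move=> /andP[/eqP cd pcd]; case: c d cd pcd => [[i e]|[]] [[j e']|[]] //= _ pcd;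
  rewrite ?add0r ?addr0 ?eqxx // => nz; last 2 first.
- by constructor 1; exists i, e.
- by constructor 1; exists j, e'.
have [ij|ij] := eqVneq i j; last by constructor 2; exists i, j, e, e'.
have [ee|ee] := eqVneq e e'.
  constructor 3; split; last by exists ((-1) ^+ e *: delta_mx 0 i); [exists i, e | rewrite -ij -ee -mulr2n].
  by move: pcd; rewrite ij ee eqxx orbF.
move: nz; have -> : e' = ~~ e by move: ee; case: (e); case: (e').
by rewrite ij signrN scaleNr subrr eqxx.
Qed.

(** The second label [inr q] is the weight-zero vector of the right second degree: the last
    coordinate vector exactly for odd [q]. *)
Lemma short_allowed p q r : short_weight r -> exists c d,
  [/\ allowed p q c d, d != frame_dual c & frame_weight C c + frame_weight C d = r].
Proof.
move=> [i [e ->]]; exists (inl (i, e)), (inr q); split=> //=; last by rewrite addr0.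
by rewrite /allowed /= orbT andbT; case: q.
Qed.

Lemma long_allowed p r : long_weight r -> exists c d,
  [/\ allowed p false c d, d != frame_dual c & frame_weight C c + frame_weight C d = r].
Proof.
move=> [i [j [e [e' [ij ->]]]]]; exists (inl (i, e)), (inl (j, e')); split=> //.
  rewrite /allowed /=; apply/orP; right; apply: contra ij => /eqP[-> _]; exact: eqxx.
by apply: contra ij => /eqP[-> _].
Qed.

Lemma double_allowed r : short_weight r -> exists c d,
  [/\ allowed true false c d, d != frame_dual c & frame_weight C c + frame_weight C d = r *+ 2].
Proof.
move=> [i [e ->]]; exists (inl (i, e)), (inl (i, e)); split=> //=.
by apply/eqP => -[]; case: e.
Qed.

End WeightVectors.

(** * Roots of the degree-zero algebra and the three families of non-isotropic roots *)

Section FrameRootSystem.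
Variables (R : realType) (l : nat).
Local Notation C := R[i].
Local Notation n := (2 * l).+1.
Local Notation M := 'M[C]_n.+1.
Local Notation g := (sl R n.+1).
Local Notation s0 := (neg_transpose R n.+1).
Local Notation s1 := (Ad (reflection R n)).
Local Notation gr := (graded g s0 s1 2 2).
Variables (h : {vspace M}) (v : frame_index l -> 'cV[C]_n.+1).
Hypothesis hT : forall y, y \in h -> y^T = - y.
Hypothesis frame_v : is_frame v.
Hypothesis torus_mem : forall i, frame_torus v i \in h.
Hypothesis eigen_v : forall y a, y \in h -> y *m v a = frame_coef v y a *: v a.
Local Notation mu := (frame_coef v).
Local Notation f := (frame_map h v).
Local Notation wt := (@frame_weight C l).

Lemma frame_map_weight (H : subvs_of h) c d :
  f (wt c + wt d) H = mu (vsval H) c + mu (vsval H) d.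
Proof.
rewrite frame_mapE (frame_coefE v hT c (subvsP H)) (frame_coefE v hT d (subvsP H)).
by rewrite -big_split; apply: eq_bigr => i _; rewrite mxE; exact: mulrDl.
Qed.

Lemma frame_map_neq0 r : (f r != 0) = (r != 0).
Proof.
congr (~~ _); apply/eqP/eqP => [fr|->]; last by rewrite linear0.
by apply: (frame_map_inj frame_v torus_mem); rewrite fr linear0.
Qed.

Lemma graded_weight p q (a : dual h) : a != 0 ->
  (exists x, [/\ x \in gr p q, x != 0 &
     forall H : subvs_of h, lie (vsval H) x = (a H : C) *: x]) <->
  exists c d, allowed (parity p) (parity q) c d /\ a = f (wt c + wt d).
Proof.
move=> a0; split=> [[x [xg x0 xw]]|[c [d [cd aE]]]].
  have [|c [d [cd ad]]] := @weight_allowed C n l (mem h) v hT frame_v eigen_v (parity p) (parity q) x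
      (fun y => a (vsproj h y)) ((graded_bigraded p q x).1 xg) x0.
    by move=> y yh; have := xw (vsproj h y); rewrite vsprojK.
  exists c, d; split=> //; apply/lfunP => H; rewrite frame_map_weight.
  by rewrite -(ad _ (subvsP H)) vsvalK.
have dc : d != frame_dual c.
  apply: contraNneq a0 => dE; apply/eqP.
  by rewrite aE dE frame_weight_dual subrr linear0.
have [x [xg x0 xw]] := allowed_weight hT frame_v eigen_v cd dc.
exists x; split=> //; first exact/graded_bigraded.
by move=> H; rewrite aE frame_map_weight -(xw _ (subvsP H)).
Qed.

Lemma rootsP a : Defs.roots (gr 0 0) h a <-> exists2 r, standard_B_root r & a = f r.
Proof.
split=> [[a0 /(graded_weight _ _ a0)[c [d [cd aE]]]]|[r rB ->]].
  exists (wt c + wt d) => //.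
  rewrite aE frame_map_neq0 in a0.
  by have [] := allowed_even cd a0; [left | right | case].
have r0 : r != 0.
  apply: sqnorm_neq0; case: rB => [/short_sqnorm|/long_sqnorm] ->.
    exact: oner_neq0.
  by rewrite pnatr_eq0.
have fr0 : f r != 0 by rewrite frame_map_neq0.
split=> //; apply/(graded_weight _ _ fr0).
have [c [d [cd _ cdE]]] : exists c d,
    [/\ allowed false false c d, d != frame_dual c & wt c + wt d = r].
  by case: rB => [/(short_allowed false false)|/(long_allowed false)].
by exists c, d; rewrite cdE.
Qed.

Lemma dual_form_sqnorm r : dual_form g (f r) (f r) = (4 * n.+1)%:R^-1 * sqnorm r.
Proof. exact: dual_form_frame. Qed.

Lemma dual_form_neq0 r : (dual_form g (f r) (f r) != 0) = (sqnorm r != 0).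
Proof. by rewrite dual_form_sqnorm mulf_eq0 invr_eq0 pnatr_eq0. Qed.

Hypothesis l_gt0 : (0 < l)%N.

Lemma short_rootsP a : short_roots g (gr 0 0) h a <-> exists2 r, short_weight r & a = f r.
Proof.
have c0 : 0 < ((4 * n.+1)%:R^-1 : C) by rewrite invr_gt0 ltr0n.
split=> [[/rootsP[r [rs|rl] aE] amin]|[r rs aE]].
- by exists r.
- pose s : 'rV[C]_l := (-1) ^+ false *: delta_mx 0 (Ordinal l_gt0).
  have ss : short_weight s by exists (Ordinal l_gt0), false.
  have /amin : Defs.roots (gr 0 0) h (f s) by apply/rootsP; exists s => //; left.
  rewrite aE !dual_form_sqnorm (ler_pM2l c0) (short_sqnorm ss) (long_sqnorm rl).
  by rewrite (ler_nat _ 2 1).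
- split; first by apply/rootsP; exists r => //; left.
  move=> b /rootsP[s sB ->]; rewrite aE !dual_form_sqnorm (ler_pM2l c0) (short_sqnorm rs).
  case: sB => [/short_sqnorm|/long_sqnorm] ->; first exact: lexx.
  by rewrite (ler_nat _ 1 2).
Qed.

Lemma long_rootsP a : long_roots g (gr 0 0) h a <-> exists2 r, long_weight r & a = f r.
Proof.
split=> [[/rootsP[r [rs|rl] aE] na]|[r rl aE]].
- by case: na; apply/short_rootsP; exists r.
- by exists r.
- split; first by apply/rootsP; exists r => //; right.
  move=> /short_rootsP[s ss]; rewrite aE => /(frame_map_inj frame_v torus_mem) rE.
  have := long_sqnorm rl; rewrite rE (short_sqnorm ss) => /eqP.
  by rewrite (eqr_nat _ 1 2).
Qed.

Lemma frame_roots_of_type_B : roots_of_type_B l (gr 0 0) h.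
Proof.
exists f; split; last exact: rootsP.
  by apply/eqP/lker0P; apply: (frame_map_inj frame_v torus_mem).
apply/vspaceP => a; rewrite memvf; apply/memv_imgP.
by exists (\row_i a (torus h v i)); [exact: memvf | exact: dual_torus].
Qed.

Lemma nonisotropic_rootsP (b : wspace h) :
  nonisotropic_roots g s0 s1 2 2 h b <->
  exists (m k : int) c d, let r := wt c + wt d in
    [/\ allowed (parity m) (parity k) c d, sqnorm r != 0 & b = (f r, toC R (m, k))].
Proof.
have f0 (r : 'rV[C]_l) : sqnorm r != 0 -> f r != 0.
  by move=> /sqnorm_neq0; rewrite frame_map_neq0.
split=> [[bb ex]|[m [k [c [d [cd cd0 bE]]]]]].
  have [r b1E] : exists r, b.1 = f r.
    by exists (\row_i b.1 (torus h v i)); apply: dual_torus.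
  have r0 : sqnorm r != 0 by move: bb; rewrite /wform b1E dual_form_neq0.
  have b10 : b.1 != 0 by rewrite b1E f0.
  have /(weight_vectorP _ _ _ _ _ b10)[[m k] [b2E /(graded_weight _ _ b10)[c [d [cd b1E']]]]] := ex.
  have rE : r = wt c + wt d.
    by apply: (frame_map_inj frame_v torus_mem); rewrite -b1E.
  exists m, k, c, d; split=> //; first by rewrite -rE.
  by rewrite -b1E' -b2E; case: (b).
have b10 : b.1 != 0 by rewrite bE f0.
split; first by rewrite bE /wform dual_form_neq0.
apply/(weight_vectorP _ _ _ _ _ b10); exists (m, k); split; first by rewrite bE.
by apply/(graded_weight _ _ b10); exists c, d; rewrite bE.
Qed.

Lemma parity_double k : parity (2 * k) = false.
Proof. by rewrite /parity abszM oddM. Qed.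

Lemma parityP k : parity k = false -> exists j, k = 2 * j.
Proof. by rewrite /parity => kE; exists (k %/ 2)%Z; lia. Qed.

Lemma parity1P k : parity k = true -> exists j, k = 2 * j + 1.
Proof. by rewrite /parity => kE; exists (k %/ 2)%Z; lia. Qed.

Lemma nonisotropic_roots_BC : nonisotropic_roots g s0 s1 2 2 h =
  [set b : wspace h | exists (a : dual h) (m n : int), short_roots g (gr 0 0) h a /\
             b = (a, (m%:~R, n%:~R))]
  `|` [set b : wspace h | exists (a : dual h) (m n : int), long_roots g (gr 0 0) h a /\
             b = (a, (m%:~R, (2 * n)%:~R))]
  `|` [set b : wspace h | exists (a : dual h) (m n : int), long_roots_C g (gr 0 0) h a /\
             b = (a, ((2 * m + 1)%:~R, (2 * n)%:~R))].
Proof.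
apply/seteqP; split=> b.
  move=> /nonisotropic_rootsP[m [k [c [d [cd cd0 ->]]]]].
  have r0 := sqnorm_neq0 cd0.
  case kp : (parity k) cd => cd.
    left; left; exists (f (wt c + wt d)), m, k; split; last exact: erefl.
    by apply/short_rootsP; exists (wt c + wt d) => //; apply: allowed_short cd r0.
  have [j ->] := parityP kp.
  have [rs|rl|[mp [s ss ->]]] := allowed_even cd r0.
  - left; left; exists (f (wt c + wt d)), m, (2 * j); split; last exact: erefl.
    by apply/short_rootsP; exists (wt c + wt d).
  - left; right; exists (f (wt c + wt d)), m, j; split; last exact: erefl.
    by apply/long_rootsP; exists (wt c + wt d).
  - have [i ->] := parity1P mp; right; exists (f (s *+ 2)), i, j; split; last exact: erefl.
    by exists (f s); [apply/short_rootsP; exists s | rewrite linearMn].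
move=> [[]|] [a [m [k [ar ->]]]]; apply/nonisotropic_rootsP.
- have /short_rootsP[r rs ->] := ar.
  have [c [d [cd _ cdE]]] := short_allowed (parity m) (parity k) rs.
  by exists m, k, c, d => /=; rewrite cdE (short_sqnorm rs) oner_neq0.
- have /long_rootsP[r rl ->] := ar.
  have [c [d [cd _ cdE]]] := long_allowed (parity m) rl.
  by exists m, (2 * k), c, d => /=; rewrite cdE (long_sqnorm rl) parity_double pnatr_eq0.
- have [_ /short_rootsP[r rs ->] <-] := ar.
  have [c [d [cd _ cdE]]] := double_allowed rs.
  exists (2 * m + 1), (2 * k), c, d => /=; rewrite cdE parityD !parity_double.
  rewrite double_sqnorm (short_sqnorm rs) mulr1 pnatr_eq0; split=> //.
  by rewrite linearMn.
Qed.

End FrameRootSystem.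

(** * The graded pieces as modules *)

Section GradedModules.
Variables (R : realType) (l : nat).
Hypothesis l_gt0 : (0 < l)%N.
Local Notation C := R[i].
Local Notation n := (2 * l).+1.
Local Notation M := 'M[C]_n.+1.
Local Notation g := (sl R n.+1).
Local Notation s0 := (neg_transpose R n.+1).
Local Notation s1 := (Ad (reflection R n)).
Local Notation gr := (graded g s0 s1 2 2).
Local Notation om := (ord_max : 'I_n.+1).
Local Notation dd := (delta_mx ord_max ord_max : M).
Implicit Types (x y z : M) (V W : {vspace M}) (p q : int) (i j a : 'I_n.+1).

Lemma graded_lie p q p' q' x y : x \in gr p q -> y \in gr p' q' ->
  lie x y \in gr (p + p') (q + q').
Proof.
rewrite (graded_mem p) (graded_mem p') => /and3P[xt /eqP x0 /eqP x1] /and3P[yt /eqP y0 /eqP y1].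
rewrite -neg_transposeE in x0; rewrite -neg_transposeE in y0.
have [xg yg] : x \in g /\ y \in g by rewrite !mem_sl.
have [_ a0] := neg_transpose_automorphism R n; have [_ a1] := Ad_reflection_automorphism R n.
have E (a b : C) : lie (a *: x) (b *: y) = (a * b) *: lie x y.
  by rewrite (lieZl a x) (lieZr b x) scalerA.
rewrite graded_mem -neg_transposeE a0 // a1 // x0 y0 x1 y1 !E !parityD !signr_addb.
by apply/and3P; split; [rewrite -mem_sl; exact: lie_sl | exact: eqxx | exact: eqxx].
Qed.

Lemma graded00_lie p q x y : x \in gr 0 0 -> y \in gr p q -> lie x y \in gr p q.
Proof. by move=> xL yW; have := graded_lie xL yW; rewrite (add0r p) (add0r q). Qed.

Lemma even_support_mul_dd x : even_support x -> x * dd = 0.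
Proof.
move=> xe; apply/matrixP => r s; rewrite -mulmxE !mxE big1 // => k _; rewrite mxE.
have [->|ko] := eqVneq k om; last by rewrite mulr0.
rewrite [x r om](_ : _ = 0) ?mul0r //.
by apply: contrapT => /eqP /xe[]; rewrite eqxx.
Qed.

Lemma graded00_support x : x \in gr 0 0 <-> x^T = - x /\ even_support x.
Proof.
split=> [xg|[xT xe]]; last first.
  by apply/graded00P; split=> //; exact: even_support_mul_dd.
have /graded00P[xT _] := xg; split=> //.
move/gradedP: xg => [_ _ xs] r s xrs; have := xs _ _ xrs.
have [rE|ro] := eqVneq r om; have [sE|so] := eqVneq s om => //= _.
have : x^T r s = - x r s by rewrite xT mxE.
rewrite mxE rE sE => /eqP; rewrite -subr_eq0 opprK -mulr2n mulrn_eq0 /= => /eqP x0.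
by move: xrs; rewrite rE sE x0 eqxx.
Qed.

Lemma rot_graded i j : i != om -> j != om -> rot C i j \in gr 0 0.
Proof.
move=> io jo; apply/graded00_support; split.
  by rewrite /rot linearB /= !trmx_delta opprB.
move=> r s; rewrite !mxE => nz.
have [/andP[/eqP-> /eqP->] //|E1] := boolP ((r == i) && (s == j)).
have [/andP[/eqP-> /eqP->] //|E2] := boolP ((r == j) && (s == i)).
by move: nz; rewrite (negPf E1) (negPf E2) subr0 eqxx.
Qed.

Lemma submodule_rot V W : submodule (gr 0 0) W V ->
  forall i j x, i != om -> j != om -> i != j -> x \in V -> ad (rot C i j) x \in V.
Proof. by move=> [_ st] i j x io jo _ xV; apply: st => //; apply: rot_graded. Qed.

Lemma rot_neq0 i j : i != j -> rot C i j != 0.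
Proof.
move=> ij; apply/eqP => /matrixP/(_ i j); rewrite !mxE !eqxx (negPf ij) /= subr0.
by move/eqP; rewrite oner_eq0.
Qed.

Lemma ex_small3 : exists a b c : 'I_n.+1,
  [/\ [&& a != om, b != om & c != om], a != b, a != c & b != c].
Proof.
have [a [ao _ _]] := ex_third l_gt0 om om.
have [b [bo ba _]] := ex_third l_gt0 a om.
have [c [co ca cb]] := ex_third l_gt0 a b.
by exists a, b, c; rewrite ao bo co ![a == _]eq_sym [b == c]eq_sym.
Qed.

Lemma graded00_simple : lie_simple (gr 0 0).
Proof.
have [a [b [c [/and3P[ao bo co] ab ac bc]]]] := ex_small3.
split.
- by move=> x y; exact: graded00_lie.
- exists (rot C a b), (rot C b c); rewrite !rot_graded //; split=> //.
  by rewrite lie_ad rot_rot // rot_neq0.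
move=> I [/subvP IL Iid].
have [I0|/eqP I0] := eqVneq I 0%VS; [by left | right].
apply/vspaceP => y; apply/idP/idP => [/IL //|/graded00_support[yT ye]].
have [x xI x0] : exists2 x, x \in I & x != 0.
  by exists (vpick I); rewrite ?memv_pick // vpick0; apply/eqP.
have /graded00_support[xT xe] := IL _ xI.
apply: (skew_span l_gt0 _ xT xe xI x0 yT ye).
by move=> i j z io jo _ zI; apply: Iid => //; apply: rot_graded.
Qed.

Lemma irreducibleI W : submodule (gr 0 0) W W -> W != 0%VS ->
  (forall V, submodule (gr 0 0) W V ->
     forall x y, x \in V -> x != 0 -> y \in W -> y \in V) ->
  irreducible (gr 0 0) W.
Proof.
move=> sW W0 H; split=> // V sV.
have [V0|/eqP V0] := eqVneq V 0%VS; [by left | right].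
have [/subvP VW _] := sV; apply/vspaceP => y; apply/idP/idP => [/VW //|yW].
by apply: (H V sV (vpick V)); rewrite ?memv_pick // vpick0; apply/eqP.
Qed.

Lemma irreducible_no_trivial W : irreducible (gr 0 0) W ->
  (exists x y, [/\ x \in gr 0 0, y \in W & lie x y != 0]) ->
  no_trivial_summand (gr 0 0) W.
Proof.
move=> [_ _ Wirr] [x [y [xL yW xy]]] U T [sU _ _ _] Utriv.
have [//|UW] := Wirr U sU; move/eqP: xy; case.
by apply: Utriv; rewrite ?UW.
Qed.

Lemma odd_entry (a : 'I_n.+1) (e : bool) : a != om ->
  let x : M := delta_mx a om + (-1) ^+ e *: delta_mx om a in
  [/\ x^T = (-1) ^+ e *: x, odd_support x, \tr x = 0 & x a om = 1].
Proof.
move=> ao x; split.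
- rewrite /x linearD linearZ /= !trmx_delta scalerDr scalerA -signr_addb addbb scale1r.
  exact: addrC.
- move=> r s; rewrite !mxE => nz.
  have [/andP[/eqP-> /eqP->]|E1] := boolP ((r == a) && (s == om)).
    by rewrite eqxx (negPf ao).
  have [/andP[/eqP-> /eqP->]|E2] := boolP ((r == om) && (s == a)).
    by rewrite eqxx (negPf ao).
  by move: nz; rewrite (negPf E1) (negPf E2) mulr0 addr0 eqxx.
- have tr0 (k m : 'I_n.+1) : k != m -> \tr (delta_mx k m : M) = 0.
    move=> km; apply: big1 => r _; rewrite mxE.
    by have [->|//] := eqVneq r k; rewrite (negPf km).
  by rewrite /x linearD linearZ /= (tr0 a om) // (tr0 om a) 1?eq_sym // ?scaler0 ?mulr0 addr0.
- by rewrite !mxE !eqxx (negPf ao) /= mulr0 addr0.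
Qed.

Lemma odd_entry_graded a p : a != om ->
  (delta_mx a om + (-1) ^+ (~~ parity p) *: delta_mx om a : M) \in gr p 1.
Proof. by move=> ao; have [xT xo xt _] := odd_entry (~~ parity p) ao; apply/gradedP. Qed.

Lemma graded_odd_irreducible p :
  irreducible (gr 0 0) (gr p 1) /\ no_trivial_summand (gr 0 0) (gr p 1).
Proof.
have [a [b [c [/and3P[ao bo co] ab ac bc]]]] := ex_small3.
suff irr : irreducible (gr 0 0) (gr p 1).
  split=> //; apply: irreducible_no_trivial => //.
  exists (rot C b a), (delta_mx a om + (-1) ^+ (~~ parity p) *: delta_mx om a).
  split; [exact: rot_graded | exact: odd_entry_graded |].
  rewrite lie_ad rot_col_unit //; apply/eqP => /matrixP/(_ b om).
  have [_ _ _ ->] := odd_entry (~~ parity p) bo; rewrite mxE => /eqP.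
  by rewrite oner_eq0.
apply: irreducibleI.
- split; first exact: subvv.
  by move=> x u; exact: graded00_lie.
- apply/eqP => W0; have := odd_entry_graded p ao; rewrite W0 memv0 => /eqP /matrixP/(_ a om).
  have [_ _ _ ->] := odd_entry (~~ parity p) ao; rewrite mxE => /eqP.
  by rewrite oner_eq0.
move=> V sV x y xV x0 /gradedP[_ yT yo]; have [/subvP VW _] := sV.
have /gradedP[_ xT xo] := VW _ xV.
exact: (odd_span l_gt0 (submodule_rot sV) xT xo xV x0 yT yo).
Qed.

(* The hyperplane of gr 1 0 without component along the trivial line. *)
Definition sym_traceless : {vspace M} :=
  (gr 1 0 :&: lker (linfun (fun x : M => x om om : C^o)))%VS.

Lemma mem_sym_traceless x : (x \in sym_traceless) = (x \in gr 1 0) && (x om om == 0).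
Proof.
have lin : linear (fun x : M => x om om : C^o) by move=> a y z; rewrite !mxE.
exact: memv_cap_linfun.
Qed.

Lemma sym_tracelessI x : x \in gr 1 0 -> x om om = 0 -> x \in sym_traceless.
Proof. by move=> xg x0; rewrite mem_sym_traceless xg x0 eqxx. Qed.

Lemma sym_tracelessP x : x \in sym_traceless <-> [/\ x^T = x, even_support x & \tr x = 0].
Proof.
rewrite mem_sym_traceless.
split=> [/andP[/gradedP[xt xT xs] /eqP xo]|[xT xe xt]].
  split=> //; first by rewrite xT scale1r.
  move=> r s xrs; have := xs _ _ xrs.
  have [rE|ro] := eqVneq r om; have [sE|so] := eqVneq s om => //= _.
  by move: xrs; rewrite rE sE xo eqxx.
apply/andP; split; last first.
  by apply: contraT => /xe[]; rewrite eqxx.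
apply/gradedP; split=> //; first by rewrite xT scale1r.
by move=> r s /xe[/negPf-> /negPf->].
Qed.

(** Scalar on the first 2l+1 coordinates and on the last one, so it commutes with so(2l+1); the
    coefficient [n.+1] makes the trace vanish. *)
Definition trivial_vector : M := 1 - n.+1%:R *: dd.

Lemma trivial_vector_entry : trivial_vector om om = - n%:R.
Proof. by rewrite !mxE !eqxx mulr1 mulr1n mulrSr opprD addrCA subrr addr0. Qed.

Lemma trivial_vector_graded : trivial_vector \in gr 1 0.
Proof.
apply/gradedP; split.
- rewrite linearB linearZ /= mxtrace1.
  have -> : \tr dd = 1.
    by rewrite /mxtrace (bigD1 om) //= big1 ?mxE ?eqxx ?addr0 // => i io; rewrite mxE (negPf io).
  by rewrite mulr1 subrr.
- by rewrite /trivial_vector linearB linearZ /= trmx1 trmx_delta scale1r.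
move=> r s; rewrite !mxE; have [->|rs] := eqVneq r s; first by rewrite addbb.
rewrite mulr0n sub0r; have [rE|rm] := eqVneq r om; have [sE|sm] := eqVneq s om => //=;
  rewrite ?(rE, sE, eqxx) // in rs *;
  by rewrite mulr0 oppr0 eqxx.
Qed.

Lemma trivial_vector_lie x : x \in gr 0 0 -> lie x trivial_vector = 0.
Proof.
move=> /graded00P[xT xd].
have dx : dd * x = 0.
  have := congr1 trmx xd; rewrite -mulmxE trmx_mul trmx_delta xT trmx0 mulmxN.
  by move=> /eqP; rewrite oppr_eq0 => /eqP.
by rewrite lie_ad /ad /trivial_vector mulrBr mulrBl -scalerAr -scalerAl xd dx !scaler0 mulr1 mul1r subrr.
Qed.

Lemma lie_even_entry x y : x \in gr 0 0 -> (lie x y) om om = 0.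
Proof.
move=> /graded00_support[xT xe].
have xr k : x om k = 0 by apply: contrapT => /eqP /xe[]; rewrite eqxx.
have xc k : x k om = 0 by apply: contrapT => /eqP /xe[_]; rewrite eqxx.
rewrite /lie !mxE !big1 ?subr0 // => k _; first by rewrite xc mulr0.
by rewrite xr mul0r.
Qed.

Lemma sym_traceless_submodule : submodule (gr 0 0) (gr 1 0) sym_traceless.
Proof.
split; first exact: capvSl.
move=> x u xL; rewrite (mem_sym_traceless u) => /andP[ug _].
exact: sym_tracelessI (graded00_lie xL ug) (lie_even_entry u xL).
Qed.

End GradedModules.

(** * The symmetric piece, a standard Cartan subalgebra, and dimensions *)

Section SymTraceless.
Variables (R : realType) (l : nat).
Hypothesis l_gt0 : (0 < l)%N.
Local Notation C := R[i].
Local Notation n := (2 * l).+1.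
Local Notation M := 'M[C]_n.+1.
Local Notation g := (sl R n.+1).
Local Notation s0 := (neg_transpose R n.+1).
Local Notation s1 := (Ad (reflection R n)).
Local Notation gr := (graded g s0 s1 2 2).
Local Notation om := (ord_max : 'I_n.+1).
Local Notation U := (sym_traceless R l).
Local Notation t0 := (trivial_vector R l).
Implicit Types (x y z : M) (i j a b r s : 'I_n.+1).

Lemma sym_unit_mem a b : a != om -> b != om -> a != b -> sym_unit C a b \in U.
Proof.
move=> ao bo ab; apply/sym_tracelessP; split.
- by rewrite /sym_unit linearD /= !trmx_delta addrC.
- move=> r s; rewrite !mxE => nz.
  have [/andP[/eqP-> /eqP->] //|E1] := boolP ((r == a) && (s == b)).
  have [/andP[/eqP-> /eqP->] //|E2] := boolP ((r == b) && (s == a)).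
  by move: nz; rewrite (negPf E1) (negPf E2) addr0 eqxx.
have tr0 i j : i != j -> \tr (delta_mx i j : M) = 0.
  move=> ij; apply: big1 => r _; rewrite mxE.
  by have [->|//] := eqVneq r i; rewrite (negPf ij).
by rewrite /sym_unit linearD /= (tr0 a b) // (tr0 b a) 1?eq_sym // addr0.
Qed.

Lemma sym_unit_neq0 a b : a != b -> sym_unit C a b != 0.
Proof.
move=> ab; apply/eqP => /matrixP/(_ a b); rewrite !mxE !eqxx (negPf ab) /= addr0.
by move/eqP; rewrite oner_eq0.
Qed.

Lemma sym_traceless_irreducible :
  irreducible (gr 0 0) U /\ no_trivial_summand (gr 0 0) U.
Proof.
have [a [b [c [/and3P[ao bo co] ab ac bc]]]] := ex_small3 l_gt0.
suff irr : irreducible (gr 0 0) U.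
  split=> //; apply: irreducible_no_trivial => //.
  exists (rot C a b), (sym_unit C b c).
  split; [exact: rot_graded | exact: sym_unit_mem |].
  by rewrite lie_ad rot_sym_unit // sym_unit_neq0.
apply: irreducibleI.
- split; first exact: subvv.
  by have [_] := sym_traceless_submodule R l; apply.
- apply/eqP => U0; have := sym_unit_mem ao bo ab; rewrite U0 memv0.
  by rewrite (negPf (sym_unit_neq0 ab)).
move=> V sV x y xV x0 /sym_tracelessP[yT ye yt]; have [/subvP VW _] := sV.
have /sym_tracelessP[xT xe xt] := VW _ xV.
exact: (sym_span l_gt0 (submodule_rot sV) xT xe xt xV x0 yT ye yt).
Qed.

Lemma trivial_vector_acts : acts_trivially (gr 0 0) <[t0]>%VS.
Proof.
move=> x _ xL /vlineP[c ->].
by rewrite (lieZr c x) trivial_vector_lie // scaler0.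
Qed.

Lemma sym_traceless_summand : direct_sum_of_submodules (gr 0 0) (gr 1 0) U <[t0]>%VS.
Proof.
have tg := trivial_vector_graded R l.
have n0 : - n%:R != 0 :> C by rewrite oppr_eq0 pnatr_eq0.
split.
- exact: sym_traceless_submodule.
- split; first by rewrite -memvE.
  by move=> x u xL uT; rewrite (trivial_vector_acts xL uT) mem0v.
- apply/eqP; rewrite eqEsubv; apply/andP; split.
    by rewrite subv_add -memvE tg capvSl.
  apply/subvP => x xg; pose c := x om om / - n%:R.
  rewrite -[x](subrK (c *: t0)); apply: memv_add; last by rewrite memvZ // memv_line.
  apply: sym_tracelessI; first by rewrite memvB // memvZ.
  by rewrite entry_subZ trivial_vector_entry divfK // subrr.
- apply/eqP; rewrite -subv0; apply/subvP => x; rewrite memv_cap => /andP[].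
  move=> /sym_tracelessP[_ xe _] /vlineP[c xE].
  have : x om om = 0 by apply: contrapT => /eqP /xe[]; rewrite eqxx.
  rewrite xE [LHS]mxE trivial_vector_entry => /eqP.
  by rewrite mulf_eq0 (negPf n0) orbF => /eqP->; rewrite scale0r mem0v.
Qed.

(** The rotations in the coordinate planes {2t, 2t+1} with t < l, providing the existence of a
    Cartan subalgebra. In the last block, skewness and the zero last row and column leave only 0. *)
Definition std_cartan : {vspace M} := (gr 0 0 :&: half_block_space C n.+1)%VS.

Lemma std_cartanP x : x \in std_cartan <->
  x \in gr 0 0 /\ forall r s, (r : nat)./2 != (s : nat)./2 -> x r s = 0.
Proof.
rewrite -half_block_spaceP; split=> [xh|[xL xb]].
  by apply/andP; rewrite -memv_cap.
by rewrite memv_cap; apply/andP.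
Qed.

Lemma std_cartan_abelian x y : x \in std_cartan -> y \in std_cartan -> lie x y = 0.
Proof.
move=> /std_cartanP[/graded00_support[xT _] x0] /std_cartanP[/graded00_support[yT _] y0].
have sk z r s : z^T = - z -> z s r = - z r s by move=> /matrixP/(_ r s); rewrite !mxE.
have diag z r : z^T = - z -> z r r = 0.
  by move=> zT; have /eqP := sk z r r zT; rewrite -subr_eq0 opprK -mulr2n mulrn_eq0 => /eqP.
apply/matrixP => r s; rewrite !mxE -sumrB big1 // => k _.
have [rk|rk] := eqVneq (r : nat)./2 (k : nat)./2; last first.
  by rewrite (x0 r k) // (y0 r k) // !mul0r subrr.
have [ks|ks] := eqVneq (k : nat)./2 (s : nat)./2; last first.
  by rewrite (x0 k s) // (y0 k s) // !mulr0 subrr.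
have [<-|nrk] := eqVneq r k; first by rewrite (diag x r) // (diag y r) // !mul0r subrr.
have [<-|nks] := eqVneq k s; first by rewrite (diag x k) // (diag y k) // !mulr0 subrr.
(* Both [r] and [s] are the partner of [k] in a block of two indices. *)
have -> : s = r by apply: val_inj; move: nrk nks; rewrite -!val_eqE /=; lia.
by rewrite (sk x r k) // (sk y r k) //; ring.
Qed.

Lemma std_cartan_cartan : cartan_subalgebra (gr 0 0) std_cartan.
Proof.
split.
- exact: capvSl.
- by move=> x y xh yh; rewrite std_cartan_abelian // mem0v.
- exists 1%N; apply/eqP; rewrite -subv0; apply: lie_prod_sub => x y xh yh.
  by rewrite std_cartan_abelian // mem0v.
move=> x xL xn; apply/std_cartanP; split=> //.
have low r s : ((r : nat)./2 < l)%N -> (r : nat)./2 != (s : nat)./2 -> x r s = 0.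
  move=> rl rs.
  pose a : 'I_n.+1 := inord ((r : nat)./2).*2.
  pose b : 'I_n.+1 := inord ((r : nat)./2).*2.+1.
  have aE : (a : nat) = ((r : nat)./2).*2 by rewrite inordK //; lia.
  have bE : (b : nat) = ((r : nat)./2).*2.+1 by rewrite inordK //; lia.
  have ao : a != om by rewrite -val_eqE /= aE; lia.
  have bo : b != om by rewrite -val_eqE /= bE; lia.
  have ab : a != b by rewrite -val_eqE /= aE bE; lia.
  have Fh : rot C a b \in std_cartan.
    apply/std_cartanP; split; first exact: rot_graded.
    move=> i j ij; rewrite !mxE.
    have -> : (i == a) && (j == b) = false.
      by apply/negP => /andP[/eqP iE /eqP jE]; move: ij; rewrite iE jE aE bE; lia.
    have -> : (i == b) && (j == a) = false.
      by apply/negP => /andP[/eqP iE /eqP jE]; move: ij; rewrite iE jE aE bE; lia.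
    by rewrite subr0.
  (* As [x] normalizes an abelian algebra containing the rotation, the second bracket vanishes, and
     the sieve finds no entry of [x] linking {a, b} to another index. *)
  have ad2 : ad (rot C a b) (ad (rot C a b) x) = 0.
    apply: (std_cartan_abelian Fh); rewrite -lie_ad lieC memvN; exact: xn.
  have /matrixP/(_ r s) := sieve_ad2 ab ad2.
  rewrite !mxE /crosses.
  have -> : (r == a) || (r == b).
    by rewrite -!val_eqE /= aE bE; lia.
  have -> : (s == a) || (s == b) = false.
    by apply/negP; rewrite -!val_eqE /= aE bE; lia.
  by rewrite mulr1n.
(* If [r] lies in the last block, then [s] does not, and skewness exchanges the two. *)
move=> r s rs; have [rl|rl] := ltnP (r : nat)./2 l; first exact: low.
have /graded00_support[/matrixP/(_ r s)] := xL; rewrite !mxE => xT _.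
apply/eqP; rewrite -oppr_eq0 -xT low ?eqxx // 1?eq_sym //.
by move: rs rl (ltn_ord r) (ltn_ord s); lia.
Qed.

Lemma graded00_type_B : simple_of_type_B l (gr 0 0).
Proof.
split; first exact: graded00_simple.
  by exists std_cartan; apply: std_cartan_cartan.
move=> h /cartan_frame_graded[v [hT fv tv ev]].
exact: (frame_roots_of_type_B hT fv tv ev).
Qed.

Lemma dim_sym_traceless : \dim U = (2 * l ^ 2 + 3 * l)%N.
Proof.
have -> : U = (symmetric_block C n :&: lker (linfun (fun x : M => \tr x : C^o)))%VS.
  have lin : linear (fun x : M => \tr x : C^o) by move=> a y z; rewrite linearD linearZ.
  apply/vspaceP => x; have E := memv_cap_linfun (symmetric_block C n) x lin.
  apply/idP/idP => [/sym_tracelessP[xT xe xt]|xin].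
    apply: etrans E _; apply/andP; split; last exact/eqP.
    apply/symmetric_blockP; split=> // r.
    by apply: contrapT => /eqP /xe[_]; rewrite eqxx.
  have /andP[/symmetric_blockP[xT xc] /eqP xt] :
      (x \in symmetric_block C n) && (\tr x == 0) by exact: etrans (esym E) xin.
  apply/sym_tracelessP; split=> // r s xrs; split.
    apply: contra_neq xrs => ->.
    have : x^T s om = x s om by rewrite xT.
    by rewrite mxE xc.
  by apply: contra_neq xrs => ->.
have := dim_symmetric_traceless C (isT : 0 < n)%N.
have := card_lower_pairs n.
set d := \dim _; set c := #|_|; move=> h1 h2; move: h1; rewrite -h2.
by rewrite expnS expn1; nia.
Qed.

Lemma dim_trivial_line : \dim <[t0]>%VS = 1%N.
Proof.
rewrite dim_vline; case: eqVneq => // t00.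
have := trivial_vector_entry R l; rewrite t00 mxE => /eqP.
by rewrite eq_sym oppr_eq0 pnatr_eq0.
Qed.

Lemma dim_graded_odd (p : int) : \dim (gr p 1) = (2 * l + 1)%N.
Proof.
rewrite addn1; pose e := ~~ parity p.
apply: (dim_entries (pos := fun j : 'I_n => (lift om j, om))) => [x /gradedP[_ xT xo] x0|w] /=.
  have sk r s : x s r = (-1) ^+ e * x r s.
    by have /matrixP/(_ r s) := xT; rewrite !mxE.
  have x0' r : r != om -> x r om = 0.
    by case: (unliftP om r) => [j -> _|->]; [exact: x0 | rewrite eqxx].
  apply/matrixP => r s; rewrite [RHS]mxE; apply: contrapT => /eqP xrs.
  have := xo _ _ xrs; have [rE|ro] := eqVneq r om; have [sE|so] := eqVneq s om => //= _.
    by move: xrs; rewrite rE sk x0' // mulr0 eqxx.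
  by move: xrs; rewrite sE x0' // eqxx.
have lo (j : 'I_n) : lift om j != om by rewrite eq_sym neq_lift.
exists (\sum_j w 0 j *: (delta_mx (lift om j) om + (-1) ^+ e *: delta_mx om (lift om j) : M)).
  by rewrite memv_suml // => j _; rewrite memvZ // odd_entry_graded.
move=> k; rewrite summxE (bigD1 k) //= big1 => [|j jk].
  by rewrite !mxE !eqxx (negPf (lo k)) /= mulr0 !addr0 mulr1.
rewrite !mxE (inj_eq lift_inj) [k == j]eq_sym (negPf jk) (negPf (lo k)) /=.
by rewrite mulr0 addr0 mulr0.
Qed.

End SymTraceless.

Theorem mainTheorem13 (R : realType) (l : nat) (l_gt0 : (0 < l)%N) :
  let g := sl R (2 * l).+2 in
  let s0 := neg_transpose R (2 * l).+2 in
  let s1 := Ad (reflection R (2 * l).+1) in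
  let gr := graded g s0 s1 2 2 in
  [/\ (* s0 and s1 are commuting automorphisms of g, of orders n0 = n1 = 2 *)
      [/\ lie_automorphism g s0, lie_automorphism g s1,
          has_order g s0 2, has_order g s1 2
        & forall x, x \in g -> s0 (s1 x) = s1 (s0 x)],
      (* R, for every Cartan subalgebra h of g_(0,0) *)
      forall h : {vspace 'M[R[i]]_((2 * l).+2)}, cartan_subalgebra (gr 0 0) h ->
        nonisotropic_roots g s0 s1 2 2 h =
          [set b : wspace h | exists (a : dual h) (m n : int), short_roots g (gr 0 0) h a /\
                     b = (a, (m%:~R, n%:~R))]
          `|` [set b : wspace h | exists (a : dual h) (m n : int), long_roots g (gr 0 0) h a /\
                     b = (a, (m%:~R, (2 * n)%:~R))]
          `|` [set b : wspace h | exists (a : dual h) (m n : int), long_roots_C g (gr 0 0) h a /\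
                     b = (a, ((2 * m + 1)%:~R, (2 * n)%:~R))],
      (* g_(0,0) *)
      simple_of_type_B l (gr 0 0),
      (* g_(1,0): a (2l^2+3l)-dimensional irreducible module U and a trivial
         line T, the line of diag(1, ..., 1, -(2l+1)) *)
      exists U T : {vspace 'M[R[i]]_((2 * l).+2)},
        [/\ direct_sum_of_submodules (gr 0 0) (gr 1 0) U T,
            \dim U = (2 * l ^ 2 + 3 * l)%N, irreducible (gr 0 0) U,
            no_trivial_summand (gr 0 0) U
          & \dim T = 1%N /\ acts_trivially (gr 0 0) T]
    & (* g_(0,1) and g_(1,1) *)
      forall p : int, p = 0 \/ p = 1 ->
        [/\ \dim (gr p 1) = (2 * l + 1)%N, irreducible (gr 0 0) (gr p 1)
          & no_trivial_summand (gr 0 0) (gr p 1)]].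
Proof.
move=> g s0 s1 gr; split.
- split; [exact: neg_transpose_automorphism | exact: Ad_reflection_automorphism | exact: neg_transpose_order
         | exact: Ad_reflection_order | by move=> x _; exact: neg_transpose_Ad_reflection].
- move=> h /cartan_frame_graded[v [hT fv tv ev]].
  exact: (nonisotropic_roots_BC hT fv tv ev l_gt0).
- exact: graded00_type_B.
- exists (sym_traceless R l), <[trivial_vector R l]>%VS.
  have [irr nt] := sym_traceless_irreducible R l_gt0.
  split; [exact: sym_traceless_summand | exact: dim_sym_traceless | exact: irr | exact: nt |].
  by split; [exact: dim_trivial_line | exact: trivial_vector_acts].
- move=> p _; have [irr nt] := graded_odd_irreducible R l_gt0 p.
  by split; [exact: dim_graded_odd | exact: irr | exact: nt].
Qed.
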